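(* Let $p>1$ and $l\in(0,\pi/2]$. Then, up to the reflection $h\mapsto \pi-h$ with respect to $\pi/2$ in the case $l=\pi/2$, there exists a unique solution $h_l$ of the minimization problem $$h_l\in\operatorname{argmin}\{G_{p,l}(h): h\in W^{1,1}(0,1)\cap W^{1,p}_{\mathrm{loc}}(0,1)\}.$$ Furthermore, $h_l\in C^\infty((0,1])\cap C^1([0,1])$, $h_l$ is positive and increasing in $(0,1]$, $h_l(0)=0$, $h_l(1)=l$, and $h_l$ solves in the classical sense (for $r\in(0,1)$) the ordinary differential equation $$(p-1)h'^2h''+(p-3)\left(h'^2\frac{\sin h\cos h}{r^2}-h'\frac{\sin^2 h}{r^3}\right)+\frac{h'^3}{r}+\frac{h''\sin^2 h}{r^2}-\frac{\sin^3 h\cos h}{r^4}=0.$$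
   Context: For $h:(0,1)\to\mathbb{R}$, the rotationally symmetric $p$-energy is $$E_p(h)=\int_0^1\left(r^{2/p}\,h_r^2+r^{(2-2p)/p}\sin^2 h\right)^{p/2}dr=\int_0^1 r\left(h_r^2+\frac{\sin^2h}{r^2}\right)^{p/2}dr\in[0,+\infty],$$ and $G_{p,l}(h):=E_p(h)$ if $h(1)=l$, $G_{p,l}(h):=+\infty$ otherwise. Functions in $W^{1,1}(0,1)$ are identified with their continuous representatives on $[0,1]$, so that $h(1)$ makes sense. In the case $l=\pi/2$, ''up to reflection'' means that the minimizers are exactly $h_l$ and $\pi-h_l$, and the stated properties are those of $h_l$ with values in $[0,\pi/2]$. *)

(* Defs.v *)
From HB Require Import structures.
From mathcomp Require Import all_boot all_order all_algebra.
From mathcomp Require Import all_classical all_reals all_analysis.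

Set Implicit Arguments.
Unset Strict Implicit.
Unset Printing Implicit Defensive.

Import Order.TTheory GRing.Theory Num.Theory.
Import numFieldNormedType.Exports.

Local Open Scope ring_scope.
Local Open Scope classical_set_scope.

Section Regularity.
Context {R : realType}.
Implicit Types (A : set R) (f : R -> R).

(* The difference quotient is restricted to [A], so that at an end point of an
   interval this is the one-sided derivative. *)
Definition is_derive_within A f (x d : R) : Prop :=
  (f y - f x) / (y - x) @[y --> within A x^'] --> d.

Fixpoint Ck_on A (k : nat) f : Prop :=
  if k is k'.+1 then
    exists f' : R -> R,
      (forall x, A x -> is_derive_within A f x (f' x)) /\ Ck_on A k' f'
  else {within A, continuous f}.

Definition Cinfty_on A f : Prop := forall k, Ck_on A k f.

End Regularity.

Section Sobolev.
Context {R : realType}.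
Implicit Types (Om : set R) (p : R) (f g h phi : R -> R).

Let mu := @lebesgue_measure R.

(* Elements of C_c^oo(Om), extended by 0 to the whole line. *)
Definition test_function Om phi : Prop :=
  Cinfty_on setT phi /\
  exists K : set R,
    [/\ compact K, K `<=` Om & forall x, ~ K x -> phi x = 0].

Definition is_weak_derivative Om h g : Prop :=
  [/\ locally_integrable Om h, locally_integrable Om g &
      forall phi, test_function Om phi ->
        \int[mu]_(x in Om) (h x * derive1 phi x) =
        - \int[mu]_(x in Om) (g x * phi x)].

(* One representative among the almost everywhere equal weak derivatives;
   the zero function when there is none. *)
Definition weak_derivative Om h : R -> R :=
  xget (cst 0) [set g | is_weak_derivative Om h g].

Definition Lp_loc Om p f : Prop :=
  measurable_fun Om f /\
  forall K : set R, compact K -> K `<=` Om ->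
    (\int[mu]_(x in K) (`|f x| `^ p)%:E < +oo)%E.

Definition W11 Om : set (R -> R) :=
  [set h | mu.-integrable Om (EFin \o h) /\
           exists2 g, is_weak_derivative Om h g &
                      mu.-integrable Om (EFin \o g)].

Definition W1p_loc Om p : set (R -> R) :=
  [set h | Lp_loc Om p h /\
           exists2 g, is_weak_derivative Om h g & Lp_loc Om p g].

End Sobolev.

Section Energy.
Context {R : realType}.
Implicit Types (p l : R) (h : R -> R).

Let mu := @lebesgue_measure R.

Definition energy p h : \bar R :=
  let hr := weak_derivative `]0, 1[ h in
  (\int[mu]_(r in `]0%R, 1%R[)
     ((r `^ (2 / p) * hr r ^+ 2 +
       r `^ ((2 - 2 * p) / p) * sin (h r) ^+ 2) `^ (p / 2))%:E)%E.

Lemma energyE p h : 1 < p ->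
  energy p h =
  (\int[mu]_(r in `]0%R, 1%R[)
     (r * (weak_derivative `]0, 1[ h r ^+ 2 +
           sin (h r) ^+ 2 / r ^+ 2) `^ (p / 2))%:E)%E.
Proof.
move=> p1; have p0 : p != 0 by rewrite gt_eqF // (lt_trans ltr01).
apply: eq_integral => r; rewrite inE /= in_itv /= => /andP[r0 _].
congr (_%:E); set a := weak_derivative _ _ _.
have -> : (2 - 2 * p) / p = 2 / p + - 2%:R by rewrite mulrBl mulfK.
rewrite powRD; last by apply/implyP => _; rewrite gt_eqF.
rewrite powRN powR_mulrn ?ltW// -mulrA -mulrDr [_^-1 * _]mulrC.
rewrite powRM ?powR_ge0 ?addr_ge0 ?divr_ge0 ?sqr_ge0//.
rewrite -powRrM mulrA mulfVK// divff ?pnatr_eq0//.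
by rewrite powRr1 // ltW.
Qed.

Definition constrained_energy p l h : \bar R :=
  if h 1 == l then energy p h else +oo%E.

(* W^{1,1}(0,1) `&` W^{1,p}_loc(0,1), each class being represented by functions
   continuous on [0,1]; values outside [0,1] are irrelevant. *)
Definition admissible p : set (R -> R) :=
  [set h : R -> R | {within `[0, 1], continuous h}] `&`
  W11 `]0, 1[ `&` W1p_loc `]0, 1[ p.

Definition argmin {T : Type} (G : T -> \bar R) (S : set T) : set T :=
  [set h | S h /\ forall k, S k -> (G h <= G k)%E].

Definition eq_on01 (h k : R -> R) : Prop := {in `[0, 1]%R, h =1 k}.

End Energy.

(* Main.v *)
(* The density r (h'^2 + sin^2 h / r^2)^(p/2) only depends, up to a factor r^(1-p),
   on h and r h', so the Euler-Lagrange equation has solutions of the autonomous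
   first-order form r h' = sin h q(1 - cos h), where the profile q solves an ODE with
   a singular point at 0. These solutions form a field of extremals, and the minimizer
   is the one through (1, l). Optimality is proved by calibration: there is W with
     d/dr (r^(2-p) W(1 - |cos h|)) <= density,
   for every competitor h, with equality only where r h' = q sin h sgn (cos h).
   Using 1 - |cos h| instead of 1 - cos h identifies h and pi - h and only requires
   W and q on [0, 1]. Integration over ]0, 1[ gives E_p(h) >= W(1 - cos l): the
   boundary term at 0 vanishes along a sequence because 1/r is not integrable. In the
   equality case F(1 - |cos h|) / r^2 is constant for a strictly increasing F, which
   determines |cos h|, hence by continuity h up to the reflection. *)
Require Import Defs.
From HB Require Import structures.
From mathcomp Require Import all_boot all_order all_algebra.
From mathcomp Require Import all_classical all_reals all_analysis.
From mathcomp Require Import measurable_realfun.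
From mathcomp Require Import lra.
Import Order.TTheory GRing.Theory Num.Theory.
Import numFieldNormedType.Exports.
Local Open Scope ring_scope.
Local Open Scope classical_set_scope.

Set Implicit Arguments.
Unset Strict Implicit.
Unset Printing Implicit Defensive.

(** * Derivatives within a set *)

(** The function [r^(2-p) W] has to solve the Hamilton-Jacobi equation of the field: its derivative
    in h is the momentum, which prescribes [W'], and its derivative in r is the Lagrangian minus h'
    times the momentum, which prescribes [(2 - p) W]. The equation of the profile is exactly the
    compatibility of the two prescriptions. That equation is singular at z = 0; there its right-hand
    side vanishes for q = 1 and decreases in q, which selects q(0) = 1 and yields a contraction. An
    explicit candidate together with the calibration replaces the direct method. The work lies in
    the low regularity: a competitor is only absolutely continuous on compact subintervals of ]0,
    1[, the fold is not differentiable where the cosine vanishes, for p < 2 the derivative [W'] is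
    unbounded at 0, and for p > 2 the factor [r^(2-p)] is. The chain rule is therefore proved for
    smoothed folds and passed to the limit by dominated convergence. *)

Section derivation_rules.
Context {R : realType}.
Implicit Types (f g : R -> R) (x a b : R).

Lemma is_derive_eqr f x a b : is_derive x 1 f a -> a = b -> is_derive x 1 f b.
Proof. by move=> ? <-. Qed.

Lemma is_derive_funD f g x a b : is_derive x 1 f a -> is_derive x 1 g b ->
  is_derive x 1 (fun y => f y + g y) (a + b).
Proof. by move=> fa gb; exact: is_deriveD. Qed.

Lemma is_derive_funN f x a : is_derive x 1 f a ->
  is_derive x 1 (fun y => - f y) (- a).
Proof. by move=> fa; exact: is_deriveN. Qed.

Lemma is_derive_funB f g x a b : is_derive x 1 f a -> is_derive x 1 g b ->
  is_derive x 1 (fun y => f y - g y) (a - b).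
Proof. by move=> fa gb; exact: is_deriveB. Qed.

Lemma is_derive_funM f g x a b : is_derive x 1 f a -> is_derive x 1 g b ->
  is_derive x 1 (fun y => f y * g y) (a * g x + f x * b).
Proof.
move=> fa gb; apply: is_derive_eqr (is_deriveM fa gb) _.
by rewrite /GRing.scale /= addrC mulrC.
Qed.

Lemma is_derive_funV f x a : f x != 0 -> is_derive x 1 f a ->
  is_derive x 1 (fun y => (f y)^-1) (- a * ((f x)^-1 * (f x)^-1)).
Proof.
move=> f0 fa; apply: is_derive_eqr (is_deriveV f0 fa) _.
by rewrite -[LHS]/(- f x ^- 2 * a) !mulNr mulrC -exprVn expr2.
Qed.

Lemma is_derive_funX f n x a : is_derive x 1 f a ->
  is_derive x 1 (fun y => f y ^+ n) (n%:R * f x ^+ n.-1 * a).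
Proof.
move=> fa; have -> : (fun y => f y ^+ n) = f ^+ n by apply/funext => y; rewrite exprfctE.
exact: is_deriveX.
Qed.

Lemma is_derive_funcomp f g x a b : is_derive (g x) 1 f a -> is_derive x 1 g b ->
  is_derive x 1 (fun y => f (g y)) (a * b).
Proof. exact: is_derive1_comp. Qed.

Lemma is_derive_affine (c d x : R) : is_derive x 1 (fun y => c * y + d) c.
Proof.
apply: is_derive_eqr (is_derive_funD (is_derive_funM (is_derive_cst c x 1)
  (is_derive_id x 1)) (is_derive_cst d x 1)) _.
by rewrite mul0r add0r mulr1 addr0.
Qed.

Lemma is_derive_continuous f x a : is_derive x 1 f a -> {for x, continuous f}.
Proof. by move=> [fx _]; exact/differentiable_continuous/derivable1_diffP. Qed.

End derivation_rules.

Section Ck_calculus.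
Context {R : realType}.
Implicit Types (A : set R) (f g : R -> R).

Lemma near_within_dnbhs A (x : R) (P : set R) :
  (\forall y \near within A x^', P y) <->
  (\forall y \near x, y != x -> A y -> P y).
Proof. by []. Qed.

Lemma near_within_dnbhsW A (x : R) (P : R -> Prop) :
  (forall y, y != x -> A y -> P y) -> \forall y \near within A x^', P y.
Proof. by move=> H; apply/near_within_dnbhs; near=> y; exact: H.
Unshelve. all: by end_near. Qed.

Lemma is_derive_within_cvg A f x d : is_derive_within A f x d ->
  f y @[y --> within A x^'] --> f x.
Proof.
move=> fd; have ywx : y @[y --> within A x^'] --> x.
  by move=> U Ux; apply/near_within_dnbhs; apply: filterS Ux => y Uy _ _.
have : (f y - f x) / (y - x) * (y - x) + f x @[y --> within A x^'] --> d * (x - x) + f x.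
  apply: cvgD; last exact: cvg_cst.
  by apply: cvgM; [exact: fd|apply: cvgB; [exact: ywx|exact: cvg_cst]].
rewrite subrr mulr0 add0r; apply: cvg_trans; apply: near_eq_cvg.
apply: near_within_dnbhsW => y yx Ay.
by rewrite divfK ?subrK// subr_eq0.
Qed.

Lemma derive_within_continuous A f :
  (forall x, A x -> exists d, is_derive_within A f x d) -> {within A, continuous f}.
Proof.
move=> df; apply/subspace_continuousP => x Ax.
have [d /is_derive_within_cvg fx] := df x Ax.
move=> U Ux; have Ufx : U (f x) := nbhs_singleton Ux.
have /near_within_dnbhs := fx _ Ux.
apply: filterS => y H Ay; have [->|yx] := eqVneq y x; [by []|exact: H].
Qed.

Lemma is_derive_withinD A f g x a b : is_derive_within A f x a ->
  is_derive_within A g x b -> is_derive_within A (fun y => f y + g y) x (a + b).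
Proof.
move=> fa gb; rewrite /is_derive_within.
under eq_fun => y do rewrite opprD addrACA mulrDl.
exact: cvgD.
Qed.

Lemma is_derive_withinM A f g x a b : is_derive_within A f x a ->
  is_derive_within A g x b ->
  is_derive_within A (fun y => f y * g y) x (a * g x + f x * b).
Proof.
move=> fa gb; rewrite /is_derive_within.
have -> : (fun y => (f y * g y - f x * g x) / (y - x)) =
  (fun y => (f y - f x) / (y - x) * g y + f x * ((g y - g x) / (y - x))).
  apply/funext => y; lra.
apply: cvgD; last by apply: cvgM => //; exact: cvg_cst.
by apply: cvgM => //; exact: is_derive_within_cvg gb.
Qed.

Lemma subr_invV (a b : R) : a != 0 -> b != 0 ->
  a^-1 - b^-1 = - (a - b) * (a^-1 * b^-1).
Proof. by move=> a0 b0; rewrite mulNr mulrBl mulVKf// mulrCA mulfV// mulr1 opprB. Qed.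

Lemma is_derive_withinV A f x a : (forall y, A y -> f y != 0) -> A x ->
  is_derive_within A f x a ->
  is_derive_within A (fun y => (f y)^-1) x (- a * ((f x)^-1 * (f x)^-1)).
Proof.
move=> f0 Ax fa; rewrite /is_derive_within.
have : - ((f y - f x) / (y - x)) * ((f y)^-1 * (f x)^-1) @[y --> within A x^'] -->
  - a * ((f x)^-1 * (f x)^-1).
  apply: cvgM; first exact: cvgN.
  apply: cvgM; last exact: cvg_cst.
  by apply: cvgV; [exact: f0|exact: is_derive_within_cvg fa].
apply: cvg_trans; apply: near_eq_cvg.
apply: near_within_dnbhsW => y yx Ay.
rewrite [in RHS](subr_invV (f0 _ Ay) (f0 _ Ax)) !mulNr; congr (- _).
by rewrite mulrAC.
Qed.

Lemma is_derive_within_cst A (c x : R) : is_derive_within A (cst c) x 0.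
Proof.
rewrite /is_derive_within; under eq_fun => y do rewrite subrr mul0r.
exact: cvg_cst.
Qed.

Lemma is_derive_within_id A (x : R) : is_derive_within A id x 1.
Proof.
rewrite /is_derive_within; have : (fun _ : R => (1 : R)) y @[y --> within A x^'] --> (1 : R) by exact: cvg_cst.
apply: cvg_trans; apply: near_eq_cvg.
apply: near_within_dnbhsW => y yx Ay.
by rewrite divff// subr_eq0.
Qed.

Lemma is_derive_is_derive_within A f (x d : R) :
  is_derive x 1 f d -> is_derive_within A f x d.
Proof.
move=> /is_derive1_caratheodory[k [fk kx kxd]]; rewrite /is_derive_within.
have kc : k y @[y --> within A x^'] --> k x.
  move=> U Ux; apply/near_within_dnbhs.
  have kU : \forall y \near x, U (k y) := kx _ Ux.
  by apply: filterS kU.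
rewrite -kxd; apply: cvg_trans kc; apply: near_eq_cvg.
apply: near_within_dnbhsW => y yx Ay.
by rewrite fk mulfK// subr_eq0.
Qed.

Lemma is_derive_withinT f (x d : R) :
  is_derive_within setT f x d <-> is_derive x 1 f d.
Proof.
split=> [fd|]; last exact: is_derive_is_derive_within.
apply/is_derive1_caratheodory.
exists (fun y => if y == x then d else (f y - f x) / (y - x)); split.
- move=> y; case: eqVneq => [->|yx]; first by rewrite !subrr mulr0.
  by rewrite divfK// subr_eq0.
- move=> U /=; rewrite eqxx => Ud; have Ud0 : U d := nbhs_singleton Ud.
  have /near_within_dnbhs := fd _ Ud.
  apply: filterS => y H /=; have [yx|yx] := eqVneq y x; first by [].
  exact: H.
- by rewrite eqxx.
Qed.

Lemma CkS A k f : Ck_on A k.+1 f -> Ck_on A k f.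
Proof.
elim: k f => [|k IH] f /= [f' [df f'C]].
  by apply: derive_within_continuous => x Ax; exists (f' x); exact: df.
by exists f'; split=> //; exact: IH.
Qed.

Lemma Ck_cst A k (c : R) : Ck_on A k (fun _ => c).
Proof.
elim: k c => [|k IH] c /=; first by apply: continuous_subspaceT; exact: cst_continuous.
by exists (fun _ => 0); split => [x Ax|]; [exact: is_derive_within_cst|exact: IH].
Qed.

Lemma Ck_id A k : Ck_on A k (fun x : R => x).
Proof.
case: k => [|k] /=; first by apply: continuous_subspaceT => x; exact: cvg_id.
by exists (fun _ => 1); split => [x Ax|]; [exact: is_derive_within_id|exact: Ck_cst].
Qed.

Lemma CkD A k f g : Ck_on A k f -> Ck_on A k g -> Ck_on A k (fun x => f x + g x).
Proof.
elim: k f g => [|k IH] f g /=.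
  by move=> fc gc x; apply: (@cvgD _ R); [exact: fc|exact: gc].
move=> [f' [df f'k]] [g' [dg g'k]]; exists (fun x => f' x + g' x).
by split=> [x Ax|]; [apply: is_derive_withinD; [exact: df|exact: dg]|exact: IH].
Qed.

Lemma CkM A k f g : Ck_on A k f -> Ck_on A k g -> Ck_on A k (fun x => f x * g x).
Proof.
elim: k f g => [|k IH] f g.
  by move=> fc gc x; apply: (@cvgM R); [exact: fc|exact: gc].
move=> /[dup] /CkS fk [f' [df f'k]] /[dup] /CkS gk [g' [dg g'k]].
exists (fun x => f' x * g x + f x * g' x); split=> [x Ax|].
  by apply: is_derive_withinM; [exact: df|exact: dg].
by apply: CkD; exact: IH.
Qed.

Lemma CkN A k f : Ck_on A k f -> Ck_on A k (fun x => - f x).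
Proof.
move=> fk; under eq_fun do rewrite -mulN1r.
by apply: CkM => //; exact: Ck_cst.
Qed.

Lemma CkB A k f g : Ck_on A k f -> Ck_on A k g -> Ck_on A k (fun x => f x - g x).
Proof. by move=> fk gk; apply: CkD => //; exact: CkN. Qed.

Lemma CkV A k f : (forall y, A y -> f y != 0) ->
  Ck_on A k f -> Ck_on A k (fun x => (f x)^-1).
Proof.
move=> f0; elim: k => [|k IH].
  move=> /= /subspace_continuousP fc; apply/subspace_continuousP => x Ax.
  by apply: cvgV; [exact: f0|exact: fc].
move=> /[dup] /CkS fk [f' [df f'k]].
exists (fun x => - f' x * ((f x)^-1 * (f x)^-1)); split=> [x Ax|].
  by apply: is_derive_withinV => //; exact: df.
by apply: CkM; [exact: CkN|apply: CkM; exact: IH].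
Qed.

Lemma CkX A k f n : Ck_on A k f -> Ck_on A k (fun x => f x ^+ n).
Proof.
move=> fk; elim: n => [|n IH]; first by under eq_fun do rewrite expr0; exact: Ck_cst.
by under eq_fun do rewrite exprS; exact: CkM.
Qed.

Lemma continuous_within_setT f : {within setT, continuous f} -> continuous f.
Proof. by move=> /subspace_continuousP fc x; have := fc x I; rewrite withinET. Qed.

Lemma CkT_affine k f (a b : R) : Ck_on setT k f -> Ck_on setT k (fun x => f (a * x + b)).
Proof.
have ac : continuous (fun x : R => a * x + b).
  move=> x; apply: (@cvgD _ R); last exact: cvg_cst.
  by apply: cvgM; [exact: cvg_cst|exact: cvg_id].
elim: k f => [|k IH] f.
  move=> /continuous_within_setT fc; apply: continuous_subspaceT => x.
  by apply: (continuous_comp (ac x)); exact: fc.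
move=> [f' [df f'k]]; exists (fun x => f' (a * x + b) * a); split; last first.
  by apply: CkM; [exact: IH|exact: Ck_cst].
move=> x _; apply/is_derive_withinT.
apply: (@is_derive_funcomp _ f (fun x => a * x + b)).
  exact/is_derive_withinT/df.
exact: is_derive_affine.
Qed.

End Ck_calculus.

(** * A smooth step function *)

Section smooth_step.
Context {R : realType}.
Implicit Types (x y : R) (k m : nat).

(* Unlike exp (-1/x) alone, this family is closed under differentiation. *)
Let flat m x : R := if 0 < x then x^-1 ^+ m * expR (- x^-1) else 0.

Let flat_ge0 m x : 0 <= flat m x.
Proof.
rewrite /flat; case: ifPn => // x0.
by rewrite mulr_ge0 ?expR_ge0// exprn_ge0// invr_ge0 ltW.
Qed.

(** For u = 1/x this is u^m <= m! exp u, a single term of the exponential series. *)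
Let flat_le m x : flat m x <= m`!%:R.
Proof.
rewrite /flat; case: ifPn => // x0.
have u0 : 0 <= x^-1 by rewrite invr_ge0 ltW.
rewrite expRN ler_pdivrMr ?expR_gt0// mulrC -ler_pdivrMr ?ltr0n ?fact_gt0//.
case: m => [|m]; first by rewrite expr0 fact0 divr1 -expR0 ler_expR.
by apply: le_trans (expR_ge1Dxn m u0); rewrite lerDr.
Qed.

Let flat_shift m x : flat m x = x * flat m.+1 x.
Proof.
rewrite /flat; case: ifPn => x0; last by rewrite mulr0.
by rewrite exprS !mulrA mulfV ?mul1r// gt_eqF.
Qed.

Let is_derive_flat m x :
  is_derive x 1 (flat m) (- m%:R * flat m.+1 x + flat m.+2 x).
Proof.
have [x0|x0|->] := ltgtP x 0.
- have -> : - m%:R * flat m.+1 x + flat m.+2 x = 0.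
    by rewrite /flat ltNge (ltW x0) /= mulr0 addr0.
  apply: (@near_eq_is_derive _ _ _ (cst 0)).
  near=> y; rewrite /flat ltNge.
  suff -> : y <= 0 by [].
  by rewrite ltW//; near: y; exact: lt_nbhsl.
- have xN0 : x != 0 by rewrite gt_eqF.
  apply: (@near_eq_is_derive _ _ _ (fun y => y^-1 ^+ m * expR (- y^-1))).
    near=> y; rewrite /flat.
    suff -> : 0 < y by [].
    by near: y; exact: lt_nbhsr.
  have dinv := is_derive_funV xN0 (is_derive_id x 1).
  have dE := is_derive_funcomp (is_derive_expR _) (is_derive_funN dinv).
  apply: is_derive_eqr (is_derive_funM (is_derive_funX m dinv) dE) _.
  rewrite /flat x0 /= /id.
  case: m => [|m]; rewrite /= !exprS ?expr0; set e := expR _; set u := x^-1; try set w := u ^+ m; lra.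
- have f0 k : flat k 0 = 0 by rewrite /flat ltxx.
  rewrite !f0 mulr0 addr0; apply/is_derive_withinT; rewrite /is_derive_within.
  apply/cvgrPdist_lt => e e0; apply/near_within_dnbhs.
  (* Two uses of [flat_shift]: the difference quotient at 0 is [flat m.+1 y], that is
     [y * flat m.+2 y], and the second factor is bounded. *)
  pose C : R := (m.+2)`!%:R + 1.
  have C0 : 0 < C by rewrite ltr_wpDl// ler0n.
  near=> y => y0 _; rewrite f0 !subr0 sub0r normrN flat_shift mulrC mulKf//.
  rewrite flat_shift normrM (ger0_norm (flat_ge0 _ _)).
  apply: (@le_lt_trans _ _ (`|y| * C)).
    by rewrite ler_wpM2l// (le_trans (flat_le _ _))// lerDl.
  rewrite -ltr_pdivlMr//; near: y.
  have := @nbhs0_lt R R _ (divr_gt0 e0 C0); exact.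
Unshelve. all: by end_near. Qed.

Let Ck_flat k m : Ck_on setT k (flat m).
Proof.
elim: k m => [|k IH] m /=.
  apply: continuous_subspaceT => x.
  apply/differentiable_continuous/derivable1_diffP.
  by have [] := is_derive_flat m x.
exists (fun x => - m%:R * flat m.+1 x + flat m.+2 x); split.
  by move=> x _; apply/is_derive_withinT; exact: is_derive_flat.
by apply: CkD => //; apply: CkM => //; exact: Ck_cst.
Qed.

(** The classical quotient f(x) / (f(x) + f(1 - x)) with f = [flat 0]. Rescaled differences of J
    serve as test functions approximating indicators, and the rescaled [j] as mollifiers; this is
    why the bound and the support of [j] are exported. *)
Lemma smooth_step_exists : exists J j : R -> R, exists C : R,
  [/\ Cinfty_on setT J, continuous j, (forall x, is_derive x 1 J (j x)),
      (forall x, `|j x| <= C /\ (~ 0 <= x <= 1 -> j x = 0)) &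
      [/\ (forall x, 0 <= J x <= 1), (forall x, x <= 0 -> J x = 0) &
          (forall x, 1 <= x -> J x = 1)]].
Proof.
pose d x := flat 0 x + flat 0 (-1 * x + 1); pose J x := flat 0 x * (d x)^-1.
have flat_gt0 x : 0 < x -> 0 < flat 0 x.
  by move=> x0; rewrite /flat x0 expr0 mul1r expR_gt0.
have d0 x : 0 < d x.
  rewrite /d; have [x0|x0] := ltP 0 x; first by rewrite ltr_wpDr// flat_gt0.
  by rewrite ltr_wpDl// flat_gt0//; lra.
have JC : Cinfty_on setT J.
  move=> k; apply: CkM; first exact: Ck_flat.
  apply: CkV; first by move=> y _; rewrite gt_eqF.
  by apply: CkD; [exact: Ck_flat|apply: CkT_affine; exact: Ck_flat].
have J0 x : x <= 0 -> J x = 0 by move=> x0; rewrite /J /flat ltNge x0 /= mul0r.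
have J1 x : 1 <= x -> J x = 1.
  move=> x1; rewrite /J /d [X in _ + X]/flat ltNge.
  have -> /= : -1 * x + 1 <= 0 by lra.
  by rewrite addr0 divff// gt_eqF// flat_gt0//; lra.
have [j [dJ /continuous_within_setT jc]] := JC 1%N.
have {}dJ x : is_derive x 1 J (j x) by apply/is_derive_withinT/dJ.
have j0 x : x < 0 -> j x = 0.
  move=> x0; have [_ <-] := dJ x.
  have : is_derive x 1 J 0.
    apply: (@near_eq_is_derive _ _ _ (cst 0)).
    by near=> y; rewrite J0// ltW//; near: y; exact: lt_nbhsl.
  by move=> [].
have j1 x : 1 < x -> j x = 0.
  move=> x0; have [_ <-] := dJ x.
  have : is_derive x 1 J 0.
    apply: (@near_eq_is_derive _ _ _ (cst (1 : R))).
    by near=> y; rewrite J1// ltW//; near: y; exact: lt_nbhsr.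
  by move=> [].
have [c _ cmax] : exists2 c, c \in `[(0:R), 1]%R & forall t, t \in `[(0:R), 1]%R -> `|j t| <= `|j c|.
  apply: (@EVT_max R (fun t => `|j t|) 0 1 ler01).
  by apply: continuous_subspaceT => x; apply: cvg_norm; exact: jc.
exists J, j, `|j c|; split=> //.
  move=> x; split; last first.
    by move=> /negP; rewrite negb_and -!ltNge => /orP[]; [exact: j0|exact: j1].
  have [x0|x0] := ltP x 0; first by rewrite j0// normr0.
  have [x1|x1] := ltP 1 x; first by rewrite j1// normr0.
  by apply: cmax; rewrite in_itv /= x0.
split=> // x; rewrite divr_ge0 ?flat_ge0//= ?ler_pdivrMr ?mul1r ?lerDl//; exact: ltW.
Unshelve. all: by end_near. Qed.

End smooth_step.

(** * Weak derivatives and absolute continuity *)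

Section Rintegral_complements.
Context {R : realType}.
Notation mu := (@lebesgue_measure R).
Implicit Types (f g G : R -> R) (D E : set R).

Lemma Rintegral_support D E f : E `<=` D ->
  (forall x, D x -> ~ E x -> f x = 0) ->
  \int[mu]_(x in D) f x = \int[mu]_(x in E) f x.
Proof.
move=> ED f0; rewrite Rintegral_mkcond [RHS]Rintegral_mkcond.
apply: eq_Rintegral => x _; rewrite /patch.
case: ifPn => [/set_mem Dx|/negP xD]; case: ifPn => [/set_mem Ex|/negP xE] //.
  by rewrite f0// => Ex; apply: xE; exact: mem_set.
by case: xD; apply: mem_set; exact: ED.
Qed.

Lemma Rintegral_dct D (f_ : nat -> R -> R) f G : measurable D ->
  (forall n, measurable_fun D (f_ n)) ->
  (forall x, D x -> f_ n x @[n --> \oo] --> f x) ->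
  mu.-integrable D (EFin \o G) ->
  (forall n x, D x -> `|f_ n x| <= G x) ->
  mu.-integrable D (EFin \o f) /\
  \int[mu]_(x in D) f_ n x @[n --> \oo] --> \int[mu]_(x in D) f x.
Proof.
move=> mD mf ff iG fG.
have mlim : measurable_fun D f by apply: measurable_fun_cvg ff.
have [|||||intf _ cvgf] := @dominated_convergence _ _ R mu D mD
    (fun n => EFin \o f_ n) (EFin \o f) (EFin \o G).
- by move=> n; exact: (@measurable_EFinP _ _ _ D (f_ n)).2.
- exact: (@measurable_EFinP _ _ _ D f).2.
- by apply: aeW => x Dx; apply: cvg_EFin; [exact: nearW|exact: ff].
- exact: iG.
- by apply: aeW => x n Dx /=; rewrite lee_fin fG.
split => //; rewrite /Rintegral; apply: fine_cvg; rewrite fineK//.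
exact: integrable_fin_num.
Qed.

Lemma integrable_funB D f g : measurable D -> mu.-integrable D (EFin \o f) ->
  mu.-integrable D (EFin \o g) -> mu.-integrable D (EFin \o (fun x => f x - g x)).
Proof.
move=> mD fi gi; have -> : EFin \o (fun x => f x - g x) = ((EFin \o f) \- (EFin \o g))%E by [].
exact: integrableB.
Qed.

Lemma integrable_funD D f g : measurable D -> mu.-integrable D (EFin \o f) ->
  mu.-integrable D (EFin \o g) -> mu.-integrable D (EFin \o (fun x => f x + g x)).
Proof.
move=> mD fi gi; have -> : EFin \o (fun x => f x + g x) = ((EFin \o f) \+ (EFin \o g))%E by [].
exact: integrableD.
Qed.

Lemma integrable_funZ D f (M : R) : measurable D -> mu.-integrable D (EFin \o f) ->
  mu.-integrable D (EFin \o (fun x => M * f x)).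
Proof.
move=> mD fi; have -> : EFin \o (fun x => M * f x) = (fun x => M%:E * (EFin \o f) x)%E by [].
exact: integrableZl.
Qed.

Lemma integrable_norm D f : mu.-integrable D (EFin \o f) ->
  mu.-integrable D (EFin \o (fun x => `|f x|)).
Proof. exact: integrable_abse. Qed.

Lemma continuous_integrable_itv (a b : R) f : {within `[a, b], continuous f} ->
  mu.-integrable `[a, b] (EFin \o f).
Proof. by move=> fc; apply: continuous_compact_integrable => //; exact: segment_compact. Qed.

Lemma Rintegral_FTC2 (a b : R) (F f : R -> R) : a < b ->
  {within `[a, b], continuous f} -> {within `[a, b], continuous F} ->
  (forall x, a < x < b -> is_derive x 1 F (f x)) ->
  \int[mu]_(x in `[a, b]) f x = F b - F a.
Proof.
move=> ab fc Fc dF; have [_ Fa Fb] := (continuous_within_itvP F ab).1 Fc.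
rewrite /Rintegral (@continuous_FTC2 _ f F)//.
  split=> // x; rewrite in_itv /= => /dF[]; by [].
move=> x; rewrite in_itv /= => /dF[_ <-]; by rewrite derive1E.
Qed.

Lemma Rintegral_cst_itv (a b c : R) : a <= b ->
  \int[mu]_(x in `[a, b]) (fun _ => c) x = c * (b - a).
Proof.
rewrite le_eqVlt => /predU1P[->|ab].
  by rewrite set_itv1 Rintegral_set1 subrr mulr0.
by rewrite Rintegral_cst//= lebesgue_measure_itv /= lte_fin ab.
Qed.

Lemma le_normr_Rintegral_itv (a b c : R) f : a <= b ->
  mu.-integrable `[a, b] (EFin \o f) ->
  (forall x, a <= x <= b -> `|f x| <= c) ->
  `|\int[mu]_(x in `[a, b]) f x| <= c * (b - a).
Proof.
move=> ab fi fc; apply: (le_trans (le_normr_Rintegral _ fi)) => //.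
rewrite -(@Rintegral_cst_itv a b c)//; apply: le_Rintegral => //.
- exact: (integrable_abse fi).
- by apply: continuous_integrable_itv; apply: continuous_subspaceT; exact: cst_continuous.
Qed.

End Rintegral_complements.

(** * The du Bois-Reymond lemma *)

Section du_bois_reymond.
Context {R : realType}.
Notation mu := (@lebesgue_measure R).
Implicit Types (h g : R -> R).

(** The kernel has integral J 1 - J 0 = 1 and lives on [a, a + 1/c], so only the right continuity of
    [h] at [a] matters. The sign of [j] is not controlled; the bound C makes the L^1 norm of the
    kernel at most C. *)
Let cvg_mollify (J j : R -> R) (C : R) h (a e : R) (c_ : nat -> R) : a < e ->
  (forall x : R, is_derive x 1 J (j x)) -> continuous j ->
  (forall x, `|j x| <= C /\ (~ 0 <= x <= 1 -> j x = 0)) ->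
  J 0 = 0 -> J 1 = 1 ->
  {within `[a, e], continuous h} -> c_ n @[n --> \oo] --> +oo ->
  \int[mu]_(x in `[a, e]) (h x * (c_ n * j (c_ n * x + - (c_ n * a)))) @[n --> \oo] --> h a.
Proof.
move=> ae dJ jc jC J0 J1 hc cy.
have C0 : 0 <= C by apply: le_trans (jC 0).1.
have ha : h x @[x --> a^'+] --> h a by have [] := (continuous_within_itvP h ae).1 hc.
apply/cvgrPdist_le => eps eps0.
pose eta := eps / (C + 1).
have eta0 : 0 < eta by rewrite divr_gt0// ltr_wpDl.
have /cvgrPdist_le/(_ _ eta0) := ha; move=> -[d /= d0 hd].
near=> n.
have c0 : 0 < c_ n by near: n; exact: cvgry_gt.
have ce : (e - a)^-1 <= c_ n by near: n; exact: cvgry_ge.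
have cd : d^-1 < c_ n by near: n; exact: cvgry_gt.
set c := c_ n in c0 ce cd *.
have cV0 : 0 < c^-1 by rewrite invr_gt0.
have {}ce : a + c^-1 <= e.
  by rewrite -lerBrDl -[leRHS]invrK lef_pV2 ?posrE ?invr_gt0 ?subr_gt0.
have {}cd : c^-1 < d by rewrite -[ltRHS]invrK ltf_pV2 ?posrE ?invr_gt0.
have ac : a < a + c^-1 by rewrite ltrDl.
have sub : `[a, a + c^-1] `<=` `[a, e].
  by move=> x /=; rewrite !in_itv /= => /andP[-> /le_trans ->].
rewrite (@Rintegral_support _ _ `[a, a + c^-1])//; last first.
  move=> x _ /= xac; rewrite (jC _).2 ?mulr0// => /andP[H1 H2].
  apply: xac; rewrite in_itv /= -(ler_pM2l c0) -subr_ge0 H1 /=.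
  by rewrite -(ler_pM2l c0) mulrDr mulfV ?gt_eqF// addrC -lerBlDr.
have ac_cont : continuous (fun x : R => c * x + - (c * a)).
  move=> x; apply: (@cvgD _ R); last exact: cvg_cst.
  by apply: cvgM; [exact: cvg_cst|exact: cvg_id].
have jac : continuous (fun x => c * j (c * x + - (c * a))).
  move=> x; apply: cvgM; first exact: cvg_cst.
  by apply: (continuous_comp (ac_cont x)); exact: jc.
have int1 : \int[mu]_(x in `[a, a + c^-1]) (c * j (c * x + - (c * a))) = 1.
  have dJa (x : R) : is_derive x 1 (fun x => J (c * x + - (c * a))) (c * j (c * x + - (c * a))).
    rewrite [X in is_derive _ _ _ X]mulrC.
    exact: (@is_derive_funcomp _ J (fun x => c * x + - (c * a)) _ _ _ (dJ _) (is_derive_affine _ _ _)).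
  rewrite (@Rintegral_FTC2 _ _ _ (fun x => J (c * x + - (c * a))))//.
  - by rewrite mulrDr mulfV ?gt_eqF// addrAC subrr add0r J1 J0 subr0.
  - exact: continuous_subspaceT.
  - apply: continuous_subspaceT => x.
    by apply/differentiable_continuous/derivable1_diffP; have [] := dJa x.
have hc' : {within `[a, a + c^-1], continuous h} by exact: continuous_subspaceW hc.
have i1 : mu.-integrable `[a, a + c^-1] (EFin \o (fun x => h x * (c * j (c * x + - (c * a))))).
  apply: continuous_integrable_itv => x; apply: (@cvgM R); first exact: hc'.
  by move: x; exact: continuous_subspaceT.
have i2 : mu.-integrable `[a, a + c^-1] (EFin \o (fun x => h a * (c * j (c * x + - (c * a))))).
  apply: continuous_integrable_itv => x; apply: (@cvgM R); first exact: cvg_cst.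
  by move: x; exact: continuous_subspaceT.
have -> : h a = \int[mu]_(x in `[a, a + c^-1]) (h a * (c * j (c * x + - (c * a)))).
  rewrite RintegralZl// ?int1 ?mulr1//.
  by apply: continuous_integrable_itv; exact: continuous_subspaceT.
rewrite -RintegralB//.
apply: (le_trans (@le_normr_Rintegral_itv _ _ _ (eta * (c * C)) _ (ltW ac) _ _)).
- exact: integrable_funB.
- move=> x /andP[ax xac]; rewrite -mulrBl !normrM ler_pM// ?mulr_ge0//.
    have [->|xa] := eqVneq x a; first by rewrite subrr normr0 ltW.
    have {}ax : a < x by rewrite lt_neqAle eq_sym xa.
    apply: hd => //; rewrite /ball_ /= distrC gtr0_norm ?subr_gt0//.
    by apply: le_lt_trans cd; rewrite lerBlDl.
  by rewrite ler_pM// ?(gtr0_norm c0)//; exact: (jC _).1.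
- rewrite addrC addKr -!mulrA [C * _]mulrC mulVKf ?gt_eqF//.
  by rewrite /eta ler_piMr ?(ltW eps0)// mulrC ler_pdivrMr ?ltr_wpDl// mul1r lerDl.
Unshelve. all: by end_near. Qed.

(** Testing against smoothed indicators of []a, b]] turns the weak identity, in the limit, into the
    fundamental theorem of calculus. All later work on Sobolev competitors goes through this
    form. *)
Lemma weak_derivative_primitive h g : {in `]0, 1[%R, continuous h} ->
  is_weak_derivative `]0, 1[ h g -> forall a b : R, 0 < a -> a < b -> b < 1 ->
  mu.-integrable `[a, b] (EFin \o g) /\ h b - h a = \int[mu]_(x in `[a, b]) g x.
Proof.
move=> hc [_ [mg _ gloc] wd] a b a0 ab b1.
have [J [j [C [JC jc dJ jC [J01 J0 J1]]]]] := @smooth_step_exists R.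
(* Room to the right of b for the second transition: the widths [1 / c_ n] chosen below are at most
   [del]. *)
pose del := (1 - b) / 2; pose e := b + del.
have del0 : 0 < del by rewrite divr_gt0// subr_gt0.
have be : b < e by rewrite ltrDl.
have e1 : e < 1 by rewrite /e /del; lra.
have ae : a < e by exact: lt_trans be.
have sub : `[a, e] `<=` `]0, 1[.
  move=> x /=; rewrite !in_itv /= => /andP[ax xe].
  by rewrite (lt_le_trans a0 ax) (le_lt_trans xe e1).
have subb : `[a, b] `<=` `[a, e].
  by move=> x /=; rewrite !in_itv /= => /andP[-> /le_trans ->]//; exact: ltW.
have ig : mu.-integrable `[a, e] (EFin \o g).
  apply/integrableP; split.
    by apply/measurable_EFinP; exact: measurable_funS mg.
  by apply: gloc => //; exact: segment_compact.
split; first by apply: integrableS ig => //; exact: subb.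
pose c_ n : R := n.+1%:R / del.
have c0 n : 0 < c_ n by rewrite divr_gt0.
have cdel n : 1 <= c_ n * del by rewrite divfK ?gt_eqF// ler1n.
have cy : c_ n @[n --> \oo] --> +oo.
  apply/cvgryPge => M; near=> n; rewrite ler_pdivlMr// (@le_trans _ _ n%:R)// ?ler_nat//.
  by near: n; exact: nbhs_infty_ger.
(* Smooth approximations of the indicator function of ]a, b], whose derivatives
   are differences of mollifiers concentrated to the right of a and of b. *)
pose ph n x := J (c_ n * x + - (c_ n * a)) - J (c_ n * x + - (c_ n * b)).
pose dph n x := c_ n * j (c_ n * x + - (c_ n * a)) - c_ n * j (c_ n * x + - (c_ n * b)).
have Cph n : Cinfty_on setT (ph n).
  by move=> k; apply: CkB; apply: CkT_affine; exact: JC.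
have argE n x y : c_ n * x + - (c_ n * y) = c_ n * (x - y) by rewrite mulrBr.
have ph0 n x : ~ `[a, e] x -> ph n x = 0.
  move=> /= /negP; rewrite in_itv /= negb_and -!ltNge /ph !argE => /orP[xa|ex].
    by rewrite !J0 ?subrr// pmulr_rle0// subr_le0 ltW//; apply: lt_trans ab.
  have cb : 1 <= c_ n * (x - b).
    apply: le_trans (cdel n) _; rewrite ler_pM2l// lerBrDl; exact: ltW.
  rewrite !J1 ?subrr//; apply: le_trans cb _; rewrite ler_pM2l// lerB// ltW//.
have ddph n (x : R) : is_derive x 1 (ph n) (dph n x).
  have dJa (y : R) : is_derive x 1 (fun x => J (c_ n * x + - (c_ n * y))) (c_ n * j (c_ n * x + - (c_ n * y))).
    rewrite [X in is_derive _ _ _ X]mulrC.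
    exact: (@is_derive_funcomp _ J (fun x => c_ n * x + - (c_ n * y)) _ _ _ (dJ _) (is_derive_affine _ _ _)).
  exact: (is_derive_funB (dJa a) (dJa b)).
have dphE n : derive1 (ph n) = dph n.
  by apply/funext => x; rewrite derive1E; have [_ ->] := ddph n x.
have tph n : test_function `]0, 1[ (ph n).
  split; first exact: Cph.
  by exists `[a, e]; split => //; [exact: segment_compact|exact: ph0].
have hce y : a <= y -> {within `[y, e], continuous h}.
  move=> ay; apply: continuous_in_subspaceT => x.
  rewrite inE /= in_itv /= => /andP[yx xe]; apply: hc; rewrite in_itv /=.
  by rewrite (lt_le_trans a0 (le_trans ay yx)) (le_lt_trans xe e1).
have ie n y : mu.-integrable `[a, e] (EFin \o (fun x => h x * (c_ n * j (c_ n * x + - (c_ n * y))))).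
  apply: continuous_integrable_itv => x; apply: (@cvgM R); first exact: hce.
  move: x; apply: continuous_subspaceT => x; apply: cvgM; first exact: cvg_cst.
  apply: (@continuous_comp _ _ _ (fun x => c_ n * x + - (c_ n * y))); last exact: jc.
  apply: (@cvgD _ R); last exact: cvg_cst.
  by apply: cvgM; [exact: cvg_cst|exact: cvg_id].
have lhs : \int[mu]_(x in `]0, 1[) (h x * derive1 (ph n) x) @[n --> \oo] --> h a - h b.
  have E n : \int[mu]_(x in `]0, 1[) (h x * derive1 (ph n) x) =
      \int[mu]_(x in `[a, e]) (h x * (c_ n * j (c_ n * x + - (c_ n * a)))) -
      \int[mu]_(x in `[b, e]) (h x * (c_ n * j (c_ n * x + - (c_ n * b)))).
    rewrite (@Rintegral_support _ _ `[a, e])//; last first.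
      move=> x _ xae; rewrite dphE /dph !argE.
      move: xae => /= /negP; rewrite in_itv /= negb_and -!ltNge => xae.
      rewrite !(jC _).2 ?mulr0 ?subrr ?mulr0//.
        apply/negP; rewrite negb_and -!ltNge; case/orP: xae => [xa|ex]; apply/orP; [left|right].
          by rewrite pmulr_rlt0// subr_lt0 (lt_trans xa).
        apply: le_lt_trans (cdel n) _; rewrite ltr_pM2l// ltrBrDl//.
      apply/negP; rewrite negb_and -!ltNge; case/orP: xae => [xa|ex]; apply/orP; [left|right].
        by rewrite pmulr_rlt0// subr_lt0.
      apply: le_lt_trans (cdel n) _; rewrite ltr_pM2l// ltrBrDl (le_lt_trans _ ex)//.
      by rewrite lerD2r ltW.
    rewrite -[X in _ - X](@Rintegral_support _ `[a, e]).
    - rewrite -RintegralB//; apply: eq_Rintegral => x _.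
      by rewrite dphE /dph mulrBr.
    - by move=> x /=; rewrite !in_itv /= => /andP[bx ->]; rewrite (le_trans _ bx)// ltW.
    - move=> x /=; rewrite !in_itv /= => /andP[ax xe] /negP; rewrite xe andbT -ltNge => xb.
      rewrite (jC _).2 ?mulr0// argE => /andP[+ _].
      by rewrite pmulr_rge0// subr_ge0 leNgt xb.
  under eq_fun do rewrite E.
  have J00 := J0 _ (lexx 0); have J11 := J1 _ (lexx 1).
  apply: cvgB; apply: cvg_mollify jC _ _ _ cy => //; first exact: hce.
  by apply: hce; exact: ltW.
have rhs : \int[mu]_(x in `]0, 1[) (g x * ph n x) @[n --> \oo] --> \int[mu]_(x in `[a, b]) g x.
  (* Half-open because J vanishes at 0: the first step tends to 0 at x = a, and the second one tends
     to 0 at x = b. *)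
  pose chi x : R := (a < x <= b)%R%:R.
  have -> : \int[mu]_(x in `[a, b]) g x = \int[mu]_(x in `[a, e]) (g x * chi x).
    rewrite -Rintegral_itv_obnd_cbnd; last first.
      apply: integrableS ig => // x /=; rewrite !in_itv /= => /andP[/ltW -> xb] /=.
      exact: le_trans xb (ltW be).
    rewrite [RHS](@Rintegral_support _ _ `]a, b])//; last first.
    - by move=> x _ /=; rewrite in_itv /= /chi => /negP/negbTE ->; rewrite mulr0.
    - by move=> x /=; rewrite !in_itv /= => /andP[/ltW -> /le_trans ->]//; exact: ltW.
    apply: eq_Rintegral => x; rewrite inE /= in_itv /= /chi => ->.
    by rewrite mulr1.
  have phb n x : `|ph n x| <= 1.
    have := J01 (c_ n * x + - (c_ n * a)); have := J01 (c_ n * x + - (c_ n * b)).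
    by rewrite /ph ler_norml; lra.
  have E n : \int[mu]_(x in `]0, 1[) (g x * ph n x) = \int[mu]_(x in `[a, e]) (g x * ph n x).
    by apply: Rintegral_support => // x _ /ph0 ->; rewrite mulr0.
  under eq_fun do rewrite E.
  apply: (@Rintegral_dct _ `[a, e] _ (fun x => g x * chi x) (fun x => `|g x|) _ _ _ _ _).2 => //.
  - move=> n; apply: measurable_funM; first exact: measurable_funS mg.
    apply: measurable_funTS; apply: continuous_measurable_fun => x.
    by apply/differentiable_continuous/derivable1_diffP; have [] := ddph n x.
  - move=> x _; apply: cvgM; first exact: cvg_cst.
    have Jlim y : J (c_ n * x + - (c_ n * y)) @[n --> \oo] --> ((y < x)%R%:R : R).
      have [yx|xy] := ltP y x.
        apply: cvg_near_cst; near=> n; rewrite argE J1//.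
        rewrite -ler_pdivrMr ?subr_gt0// mul1r; near: n; exact: cvgry_ge.
      apply: cvg_near_cst; near=> n; rewrite argE J0//.
      by rewrite pmulr_rle0// subr_le0.
    have -> : chi x = (a < x)%R%:R - (b < x)%R%:R.
      rewrite /chi; have [bx|xb] := ltP b x; first by rewrite (lt_trans ab bx) /= subrr.
      by rewrite subr0 andbT.
    exact: cvgB.
  - exact: (integrable_abse ig).
  - by move=> n x _; rewrite normrM ler_piMr.
have : \int[mu]_(x in `]0, 1[) (h x * derive1 (ph n) x) @[n --> \oo] --> - \int[mu]_(x in `[a, b]) g x.
  under eq_fun do rewrite wd//.
  exact: cvgN.
move=> /(cvg_unique (@Rhausdorff R) lhs) E; lra.
Unshelve. all: by end_near. Qed.

End du_bois_reymond.

(** * Chain rules for absolutely continuous functions *)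

Section interval_integrals.
Context {R : realType}.
Notation mu := (@lebesgue_measure R).
Implicit Types (a b x y M : R) (f g k : R -> R).

Lemma within_continuous_eq (D : set R) f g : (forall x, D x -> f x = g x) ->
  {within D, continuous f} -> {within D, continuous g}.
Proof.
move=> fg /subspace_continuousP fc; apply/subspace_continuousP => x Dx.
rewrite /from_subspace -(fg x Dx); apply: cvg_trans (fc x Dx); apply: near_eq_cvg.
by near=> y; apply: fg; near: y; exact: withinT.
Unshelve. all: by end_near. Qed.

Lemma within_itv_bounded a b f : a <= b -> {within `[a, b], continuous f} ->
  exists2 M, 0 <= M & forall x, a <= x <= b -> `|f x| <= M.
Proof.
move=> ab fc.
have nc : {within `[a, b], continuous (fun x => `|f x|)}.
  by move=> x; apply: cvg_norm; exact: fc.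
have [c _ cmax] := EVT_max ab nc; by exists `|f c|.
Qed.

Lemma integrable_bounded_mul (D : set R) k g M : measurable D ->
  mu.-integrable D (EFin \o g) -> measurable_fun D k ->
  (forall x, D x -> `|k x| <= M) -> mu.-integrable D (EFin \o (fun x => k x * g x)).
Proof.
move=> mD ig mk kM.
have mg : measurable_fun D g by case/integrableP : ig => /(measurable_EFinP D g).1.
apply: (@le_integrable _ _ R mu D mD _ (EFin \o (fun x => M * `|g x|))).
- exact: (@measurable_EFinP _ _ _ D (fun x => k x * g x)).2 (measurable_funM mk mg).
- move=> x Dx /=; rewrite lee_fin normrM [leRHS]ger0_norm.
    by rewrite ler_wpM2r// kM.
  by rewrite mulr_ge0// (le_trans _ (kM _ Dx)).
- by apply: integrable_funZ => //; exact: integrable_norm.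
Qed.

Lemma le_Rintegral_subset (D E : set R) f : measurable D -> measurable E ->
  E `<=` D -> mu.-integrable D (EFin \o f) -> (forall x, D x -> 0 <= f x) ->
  \int[mu]_(x in E) f x <= \int[mu]_(x in D) f x.
Proof.
move=> mD mE ED fi f0; apply: fine_le.
- by apply: integrable_fin_num => //; apply: integrableS fi.
- by apply: integrable_fin_num.
- apply: ge0_subset_integral => //; first by case/integrableP : fi.
Qed.

Lemma measurable_within_itv a b f : {within `[a, b], continuous f} ->
  measurable_fun `[a, b] f.
Proof.
by move=> fc; apply: subspace_continuous_measurable_fun => //; exact: measurable_itv.
Qed.

Lemma lipschitz_of_bounded_derive (F phi : R -> R) (C : R) :
  (forall y, is_derive y 1 F (phi y)) -> (forall y, `|phi y| <= C) ->
  forall u v, `|F u - F v| <= C * `|u - v|.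
Proof.
move=> dF phiC u v; wlog uv : u v / v <= u.
  move=> H; have [/H//|/ltW/H] := leP v u.
  by rewrite distrC [`|u - v|]distrC.
have [|c _ ->] := @MVT_segment R F phi v u uv (fun x _ => dF x).
  by apply: continuous_subspaceT => x; exact: is_derive_continuous (dF x).
by rewrite normrM ler_wpM2r.
Qed.

End interval_integrals.

Section chain_rule.
Context {R : realType}.
Notation mu := (@lebesgue_measure R).
Variables (a b : R) (h g A A' : R -> R).
Hypothesis ab : a < b.
Hypothesis ig : mu.-integrable `[a, b] (EFin \o g).
Hypothesis hg : forall x, a <= x <= b -> h x = h a + \int[mu]_(y in `[a, x]) g y.
Hypothesis dA : forall x, a <= x <= b -> is_derive x 1 A (A' x).
Hypothesis cA' : {within `[a, b], continuous A'}.

Let cA : {within `[a, b], continuous A}.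
Proof.
apply: continuous_in_subspaceT => x; rewrite inE /= in_itv /= => xab.
exact: is_derive_continuous (dA xab).
Qed.

Let prim_continuous k : mu.-integrable `[a, b] (EFin \o k) ->
  {within `[a, b], continuous (fun x => h a + \int[mu]_(y in `[a, x]) k y)}.
Proof.
move=> ik x; apply: (@cvgD _ R); first exact: cvg_cst.
exact: (@parameterized_integral_continuous R a b k (ltW ab) ik x).
Qed.

Let ch : {within `[a, b], continuous h}.
Proof.
apply: within_continuous_eq (prim_continuous ig) => x /=.
by rewrite in_itv /= => /hg.
Qed.

Let comp_within (F k : R -> R) : continuous F -> {within `[a, b], continuous k} ->
  {within `[a, b], continuous (fun x => F (k x))}.
Proof. by move=> Fc kc x; apply: (continuous_comp (kc x)); exact: Fc. Qed.

(** The product and chain rules for [A x * F (h x)], with [g] in place of the derivative of [h]. *)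
Let D (F phi : R -> R) x := A' x * F (h x) + A x * (phi (h x) * g x).

Lemma chain_rule_C1 (F phi : R -> R) C :
  (forall y : R, is_derive y 1 F (phi y)) -> continuous phi ->
  (forall y, `|phi y| <= C) ->
  mu.-integrable `[a, b] (EFin \o D F phi) /\
  \int[mu]_(x in `[a, b]) D F phi x = A b * F (h b) - A a * F (h a).
Proof.
move=> dF cphi phiC.
have lab := ltW ab.
have cF : continuous F by move=> y; exact: is_derive_continuous (dF y).
have lipF := lipschitz_of_bounded_derive dF phiC.
have C0 : 0 <= C by apply: le_trans (phiC 0).
have [M1 M10 AM1] := within_itv_bounded lab cA.
have [M2 M20 AM2] := within_itv_bounded lab cA'.
have mE : measurable `[a, b] by exact: measurable_itv.
have iD : mu.-integrable `[a, b] (EFin \o D F phi).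
  apply: integrable_funD => //.
    apply: continuous_integrable_itv => x.
    by apply: (@cvgM R); [exact: cA'|exact: comp_within].
  rewrite (_ : (fun x => _) = (fun x => A x * phi (h x) * g x)); last first.
    by apply/funext => x; rewrite mulrA.
  apply: (@integrable_bounded_mul _ _ _ _ (M1 * C)) => //.
    by apply: measurable_within_itv => x; apply: (@cvgM R); [exact: cA|exact: comp_within].
  by move=> x /=; rewrite in_itv /= => xab; rewrite normrM ler_pM// AM1.
split => //.
have muE : (mu `[a, b] < +oo)%E by rewrite lebesgue_measure_itv /= lte_fin ab ltry.
(* For continuous g this is the fundamental theorem of calculus, and continuous
   functions are dense in L^1. *)
have [gn [cgn ign gn0]] := approximation_continuous_integrable mE muE ig.
pose eps n := \int[mu]_(x in `[a, b]) `|g x - gn n x|.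
have igd n : mu.-integrable `[a, b] (EFin \o (fun x => g x - gn n x)).
  exact: integrable_funB.
have igdn n : mu.-integrable `[a, b] (EFin \o (fun x => `|g x - gn n x|)).
  exact: (integrable_abse (igd n)).
have eps0 : eps n @[n --> \oo] --> 0 by exact: (fine_cvg gn0).
pose hn n x := h a + \int[mu]_(y in `[a, x]) gn n y.
have chn n : {within `[a, b], continuous (hn n)} by exact: prim_continuous.
have hnh n x : a <= x <= b -> `|hn n x - h x| <= eps n.
  move=> xab; rewrite (hg xab) /hn opprD addrACA subrr add0r.
  have sub : `[a, x] `<=` `[a, b].
    move=> y /=; rewrite !in_itv /= => /andP[-> yx] /=.
    by case/andP : xab => _; exact: le_trans.
  have mx : measurable `[a, x] by exact: measurable_itv.
  have ig1 : mu.-integrable `[a, x] (EFin \o g) by apply: integrableS ig.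
  have ig2 : mu.-integrable `[a, x] (EFin \o gn n) by apply: integrableS (ign n).
  rewrite distrC -RintegralB//.
  apply: le_trans (le_normr_Rintegral _ (integrable_funB mx ig1 ig2)) _ => //.
  exact: le_Rintegral_subset.
have dhn n x : a < x < b -> is_derive x 1 (hn n) (gn n x).
  move=> /andP[ax xb].
  have [d1 d2] := continuous_FTC1_closed xb (ign n) ax (cgn n x).
  have dI : is_derive x 1 (fun x => \int[mu]_(y in `[a, x]) gn n y) (gn n x).
    by split; [exact: d1|rewrite -derive1E d2].
  by have := is_derive_funD (is_derive_cst (h a) x 1) dI; rewrite add0r.
pose Dn n x := A' x * F (hn n x) + A x * (phi (hn n x) * gn n x).
have cDn n : {within `[a, b], continuous (Dn n)}.
  move=> x; apply: (@cvgD _ R); apply: (@cvgM R).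
  - exact: cA'.
  - exact: comp_within.
  - exact: cA.
  - apply: (@cvgM R); first exact: comp_within.
    by move: x; exact: continuous_subspaceT.
have intDn n : \int[mu]_(x in `[a, b]) Dn n x = A b * F (hn n b) - A a * F (h a).
  have cG : {within `[a, b], continuous (fun x => A x * F (hn n x))}.
    by move=> x; apply: (@cvgM R); [exact: cA|exact: comp_within].
  have dG x : a < x < b -> is_derive x 1 (fun x => A x * F (hn n x)) (Dn n x).
    move=> xab; have xab' : a <= x <= b by case/andP: xab => /ltW -> /ltW ->.
    exact: is_derive_funM (dA xab') (is_derive_funcomp (dF _) (dhn n x xab)).
  have -> := Rintegral_FTC2 ab (cDn n) cG dG.
  by have -> : hn n a = h a by rewrite /hn set_itv1 Rintegral_set1 addr0.
have lim1 : \int[mu]_(x in `[a, b]) Dn n x @[n --> \oo] --> A b * F (h b) - A a * F (h a).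
  under eq_fun do rewrite intDn.
  apply: cvgB; last exact: cvg_cst.
  apply: cvgM; first exact: cvg_cst.
  apply: (cvg_comp (fun n => hn n b) F _ (cF _)).
  apply/cvgrPdist_le => e e0.
  have /cvgrPdist_le/(_ _ e0) := eps0; apply: filterS => n.
  rewrite sub0r normrN => en; rewrite distrC (le_trans (hnh n b _))//.
    by rewrite lexx lab.
  by rewrite (le_trans _ en)// ler_norm.
(* Since [phi] is merely continuous, the error is split: Q carries the difference of the values of
   [phi] and tends to 0 by dominated convergence, while the rest P is of the order of [eps n]. *)
pose Q n x := A x * (phi (hn n x) - phi (h x)) * g x.
have mQ n : measurable_fun `[a, b] (fun x => A x * (phi (hn n x) - phi (h x))).
  apply: measurable_within_itv => x; apply: (@cvgM R); first exact: cA.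
  by apply: (@cvgB _ R); exact: comp_within.
have QM n x : a <= x <= b -> `|A x * (phi (hn n x) - phi (h x))| <= M1 * (C + C).
  move=> xab; rewrite normrM ler_pM// ?AM1// (le_trans (ler_normB _ _))//.
  by rewrite lerD.
have iQ n : mu.-integrable `[a, b] (EFin \o Q n).
  apply: (@integrable_bounded_mul _ _ _ _ (M1 * (C + C))) => //.
  by move=> x /=; rewrite in_itv /=; exact: QM.
have limQ : \int[mu]_(x in `[a, b]) Q n x @[n --> \oo] --> 0.
  have -> : 0 = \int[mu]_(x in `[a, b]) (fun _ => 0 : R) x.
    by rewrite Rintegral_cst// mul0r.
  apply: (@Rintegral_dct _ _ _ _ (fun x => M1 * (C + C) * `|g x|) _ _ _ _ _).2 => //.
  - move=> n; case/integrableP: (iQ n) => + _.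
    exact: (@measurable_EFinP _ _ _ `[a, b]%classic (Q n)).1.
  - move=> x /=; rewrite in_itv /= => xab.
    have hnx : hn n x @[n --> \oo] --> h x.
      apply/cvgrPdist_le => e e0.
      have /cvgrPdist_le/(_ _ e0) := eps0; apply: filterS => n.
      rewrite sub0r normrN => en; rewrite distrC (le_trans (hnh n x _))//.
      by rewrite (le_trans _ en)// ler_norm.
    have H : A x * (phi (hn n x) - phi (h x)) * g x @[n --> \oo] -->
        A x * (phi (h x) - phi (h x)) * g x.
      apply: cvgM; last exact: cvg_cst.
      apply: cvgM; first exact: cvg_cst.
      apply: cvgB; last exact: cvg_cst.
      exact: (cvg_comp (fun n => hn n x) phi hnx (cphi _)).
    by rewrite subrr mulr0 mul0r in H.
  - by apply: integrable_funZ => //; exact: integrable_norm.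
  - move=> n x /=; rewrite in_itv /= => xab.
    by rewrite normrM ler_wpM2r// QM.
pose P n x := (Dn n x - D F phi x) - Q n x.
have iDn n : mu.-integrable `[a, b] (EFin \o Dn n) by exact: continuous_integrable_itv.
have iP n : mu.-integrable `[a, b] (EFin \o P n).
  by apply: integrable_funB => //; exact: integrable_funB.
have PE n x : P n x = A' x * (F (hn n x) - F (h x)) - A x * phi (hn n x) * (g x - gn n x).
  by rewrite /P /Dn /D /Q; lra.
have Pb n : `|\int[mu]_(x in `[a, b]) P n x| <= (M2 * C * (b - a) + M1 * C) * eps n.
  have ic : mu.-integrable `[a, b] (EFin \o (fun _ : R => M2 * C * eps n)).
    by apply: continuous_integrable_itv; apply: continuous_subspaceT; exact: cst_continuous.
  have ig' : mu.-integrable `[a, b] (EFin \o (fun x => M1 * C * `|g x - gn n x|)).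
    exact: integrable_funZ.
  apply: (le_trans (le_normr_Rintegral _ (iP n))) => //.
  apply: (@le_trans _ _ (\int[mu]_(x in `[a, b]) (M2 * C * eps n + M1 * C * `|g x - gn n x|))).
    apply: le_Rintegral => //.
    - exact: (integrable_abse (iP n)).
    - exact: integrable_funD.
    - move=> x /=; rewrite in_itv /= => xab; rewrite PE.
      rewrite (le_trans (ler_normB _ _))// !normrM lerD//.
        rewrite -mulrA ler_pM// ?AM2// (le_trans (lipF _ _))// ler_wpM2l//.
        exact: hnh.
      by rewrite ler_wpM2r// ler_pM// AM1.
  rewrite RintegralD// [X in _ + X](_ : _ = M1 * C * eps n); last exact: RintegralZl.
  by rewrite (Rintegral_cst_itv _ lab) le_eqVlt; apply/orP; left; apply/eqP; lra.
have lim2 : \int[mu]_(x in `[a, b]) Dn n x @[n --> \oo] --> \int[mu]_(x in `[a, b]) D F phi x.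
  have E n : \int[mu]_(x in `[a, b]) Dn n x = \int[mu]_(x in `[a, b]) P n x +
      \int[mu]_(x in `[a, b]) Q n x + \int[mu]_(x in `[a, b]) D F phi x.
    rewrite -RintegralD// -RintegralD//; last exact: integrable_funD.
    by apply: eq_Rintegral => x _; rewrite /P; lra.
  under eq_fun do rewrite E.
  have limP : \int[mu]_(x in `[a, b]) P n x @[n --> \oo] --> 0.
    apply/norm_cvg0P; apply: (@squeeze_cvgr _ _ _ _ (cst 0) (fun n => (M2 * C * (b - a) + M1 * C) * eps n)).
    - by apply: nearW => n; rewrite normr_ge0 Pb.
    - exact: cvg_cst.
    - have H : (M2 * C * (b - a) + M1 * C) * eps n @[n --> \oo] --> (M2 * C * (b - a) + M1 * C) * 0.
        by apply: cvgM => //; exact: cvg_cst.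
      by rewrite mulr0 in H.
  have H : \int[mu]_(x in `[a, b]) P n x + \int[mu]_(x in `[a, b]) Q n x +
      \int[mu]_(x in `[a, b]) D F phi x @[n --> \oo] --> 0 + 0 + \int[mu]_(x in `[a, b]) D F phi x.
    by apply: cvgD; [exact: cvgD|exact: cvg_cst].
  by rewrite !add0r in H.
exact: (cvg_unique (@Rhausdorff R) lim2 lim1).
Qed.

(** Dominated convergence only asks for uniform bounds and pointwise limits, so [phi] may be
    discontinuous. The derivative of the folding map jumps where the cosine vanishes. *)
Lemma chain_rule_limit (F_ phi_ : nat -> R -> R) (F phi : R -> R) C :
  (forall n (y : R), is_derive y 1 (F_ n) (phi_ n y)) ->
  (forall n, continuous (phi_ n)) ->
  (forall n y, `|F_ n y| <= C) -> (forall n y, `|phi_ n y| <= C) ->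
  (forall y, F_ n y @[n --> \oo] --> F y) ->
  (forall y, phi_ n y @[n --> \oo] --> phi y) ->
  mu.-integrable `[a, b] (EFin \o D F phi) /\
  \int[mu]_(x in `[a, b]) D F phi x = A b * F (h b) - A a * F (h a).
Proof.
move=> dF cphi FC phiC limF limphi.
have lab := ltW ab.
have mE : measurable `[a, b] by exact: measurable_itv.
have [M1 M10 AM1] := within_itv_bounded lab cA.
have [M2 M20 AM2] := within_itv_bounded lab cA'.
have C0 : 0 <= C by apply: le_trans (phiC 0%N 0).
have H n := chain_rule_C1 (dF n) (cphi n) (phiC n).
have [] := @Rintegral_dct R `[a, b] (fun n => D (F_ n) (phi_ n)) (D F phi)
    (fun x => M2 * C + M1 * C * `|g x|).
- exact: mE.
- move=> n; case/integrableP: (H n).1 => + _.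
  exact: (@measurable_EFinP _ _ _ `[a, b]%classic (D (F_ n) (phi_ n))).1.
- move=> x _; apply: cvgD; apply: cvgM; try exact: cvg_cst.
    exact: limF.
  by apply: cvgM; [exact: limphi|exact: cvg_cst].
- apply: integrable_funD => //.
    by apply: continuous_integrable_itv; apply: continuous_subspaceT; exact: cst_continuous.
  by apply: integrable_funZ => //; exact: integrable_norm.
- move=> n x /=; rewrite in_itv /= => xab.
  rewrite (le_trans (ler_normD _ _))// !normrM lerD//.
    by rewrite ler_pM// AM2.
  by rewrite mulrA ler_wpM2r// ler_pM// AM1.
move=> iD lim1; split => //.
have lim2 : \int[mu]_(x in `[a, b]) D (F_ n) (phi_ n) x @[n --> \oo] -->
    A b * F (h b) - A a * F (h a).
  under eq_fun do rewrite (H _).2.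
  by apply: cvgB; apply: cvgM; try exact: cvg_cst; exact: limF.
exact: (cvg_unique (@Rhausdorff R) lim1 lim2).
Qed.

End chain_rule.

(** * The chain rule through the folding map *)

Section folded_chain_rule.
Context {R : realType}.
Notation mu := (@lebesgue_measure R).
Implicit Types (e y z : R).

(* A smooth approximation, as e tends to 0, of the folding map y |-> 1 - |cos y|.
   Since |sin y| <= 2 sqrt (zt e y), an outer function f with f' z = O(1 / sqrt z)
   has bounded derivative after composition with zt e, uniformly in e. *)
Let s e y : R := Num.sqrt (cos y ^+ 2 + e ^+ 2).
Let zt e y : R := 1 - (1 - e) * s e y.

Let s_sqr e y : s e y ^+ 2 = cos y ^+ 2 + e ^+ 2.
Proof. by rewrite sqr_sqrtr// addr_ge0// sqr_ge0. Qed.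

Let s_gt0 e y : 0 < e -> 0 < s e y.
Proof. by move=> e0; rewrite sqrtr_gt0 ltr_wpDl// ?sqr_ge0// exprn_gt0. Qed.

Let cos_le_s e y : `|cos y| <= s e y.
Proof. by rewrite -sqrtr_sqr ler_wsqrtr// lerDl sqr_ge0. Qed.

Let s_le e y : 0 < e -> s e y <= 1 + e.
Proof.
move=> e0; have e1 : 0 <= 1 + e by rewrite addr_ge0// ltW.
rewrite -ler_sqr ?nnegrE ?sqrtr_ge0// s_sqr.
have := sin2cos2 y; have := sqr_ge0 (sin y) => h1 h2.
by rewrite sqrrD expr1n; nra.
Qed.

(** The factor 1 - e against s <= 1 + e gives zt >= e^2, so the smoothed fold stays strictly inside
    ]0, 1[, where the outer function is differentiable. The same inequality absorbs the error in
    sin^2 <= 2 zt + e^2, which follows from (1 - zt)^2 <= cos^2 + e^2. *)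
Let zt_bounds e y : 0 < e < 1 -> [/\ 0 < zt e y, zt e y < 1,
  `|sin y| <= 2 * Num.sqrt (zt e y) & `|(1 - e) * cos y * sin y / s e y| <= `|sin y|].
Proof.
move=> /andP[e0 e1]; have s0 := s_gt0 y e0; have sl := s_le y e0.
have z0 : e ^+ 2 <= zt e y by rewrite /zt; nra.
have z1 : zt e y < 1 by rewrite /zt; nra.
have zp : 0 < zt e y by apply: lt_le_trans z0; rewrite exprn_gt0.
split=> //.
  rewrite -ler_sqr ?nnegrE ?mulr_ge0 ?sqrtr_ge0// exprMn sqr_sqrtr ?(ltW zp)//.
  rewrite real_normK ?num_real//.
  have h1 := cos2Dsin2 y; have h2 := s_sqr e y.
  have h3 : ((1 - e) * s e y) ^+ 2 <= s e y ^+ 2.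
    by rewrite ler_sqr ?nnegrE ?mulr_ge0 ?(ltW s0) ?subr_ge0 ?(ltW e1)//; nra.
  move: h3; rewrite h2 => h3.
  have h4 : (1 - e) * s e y = 1 - zt e y by rewrite /zt; lra.
  by rewrite h4 in h3; nra.
rewrite mulrAC normrM ler_piMl// normrM normfV (gtr0_norm s0) normrM.
rewrite ler_pdivrMr// mul1r gtr0_norm ?subr_gt0//.
by apply: le_trans (cos_le_s e y); rewrite ler_piMl//; lra.
Qed.

Let is_derive_zt e y : 0 < e -> is_derive y 1 (zt e) ((1 - e) * cos y * sin y / s e y).
Proof.
move=> e0; have s0 := s_gt0 y e0.
have p0 : 0 < cos y ^+ 2 + e ^+ 2 by rewrite -sqrtr_gt0.
have d1 : is_derive y 1 (fun y : R => cos y ^+ 2 + e ^+ 2) (- (2 * cos y * sin y)).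
  apply: is_derive_eqr (is_derive_funD (is_derive_funX 2 (is_derive_cos y)) (is_derive_cst (e ^+ 2) y 1)) _.
  by rewrite /= expr1; lra.
have d2 := @is_derive_funcomp R Num.sqrt (fun y => cos y ^+ 2 + e ^+ 2) y _ _ (is_derive1_sqrt p0) d1.
apply: is_derive_eqr (is_derive_funB (is_derive_cst (1 : R) y 1)
  (is_derive_funM (is_derive_cst (1 - e) y 1) d2)) _.
rewrite /= mul0r !add0r -/(s e y) invfM.
by move: ((s e y)^-1) => j; lra.
Qed.

Let continuous_dzt e : 0 < e -> continuous (fun y => (1 - e) * cos y * sin y / s e y).
Proof.
move=> e0 y; apply: cvgM.
  apply: cvgM; last exact: continuous_sin.
  by apply: cvgM; [exact: cvg_cst|exact: continuous_cos].
apply: cvgV; first by rewrite gt_eqF// s_gt0.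
apply: (@continuous_comp _ _ _ (fun y => cos y ^+ 2 + e ^+ 2)); last exact: sqrt_continuous.
apply: (@cvgD _ R); last exact: cvg_cst.
by apply: (@continuous_comp _ _ _ cos (fun x => x ^+ 2)); [exact: continuous_cos|exact: exprn_continuous].
Qed.

Let e_ (n : nat) : R := n.+2%:R^-1.

Let e_01 n : 0 < e_ n < 1.
Proof. by rewrite /e_ invr_gt0 ltr0n/= invf_lt1 ?ltr0n// ltr1n. Qed.

Let cvg_e : e_ n @[n --> \oo] --> 0.
Proof.
have := @cvg_harmonic R; rewrite -(cvg_shiftS (@harmonic R)).
by apply: cvg_trans; apply: near_eq_cvg; near=> n.
Unshelve. all: by end_near. Qed.

Let cvg_s y : s (e_ n) y @[n --> \oo] --> `|cos y|.
Proof.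
rewrite -sqrtr_sqr.
have H : cos y ^+ 2 + e_ n ^+ 2 @[n --> \oo] --> cos y ^+ 2 + 0 ^+ 2.
  apply: cvgD; first exact: cvg_cst.
  exact: (cvg_comp _ _ cvg_e (@exprn_continuous R 2 0)).
rewrite expr0n addr0 in H.
exact: (cvg_comp _ _ H (@sqrt_continuous R _)).
Qed.

Let cvg_zt y : zt (e_ n) y @[n --> \oo] --> 1 - `|cos y|.
Proof.
have -> : 1 - `|cos y| = 1 - (1 - 0) * `|cos y| by rewrite subr0 mul1r.
apply: cvgB; first exact: cvg_cst.
apply: cvgM; last exact: cvg_s.
by apply: cvgB; [exact: cvg_cst|exact: cvg_e].
Qed.

Lemma folded_chain_rule (a b : R) (h g A A' f f' : R -> R) (C : R) : a < b ->
  mu.-integrable `[a, b] (EFin \o g) ->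
  (forall x, a <= x <= b -> h x = h a + \int[mu]_(y in `[a, x]) g y) ->
  (forall x, a <= x <= b -> is_derive x 1 A (A' x)) ->
  {within `[a, b], continuous A'} ->
  {within `[0, 1], continuous f} ->
  (forall z, 0 < z < 1 -> is_derive z 1 f (f' z)) ->
  (forall z, 0 < z < 1 -> {for z, continuous f'}) ->
  (forall z, 0 < z < 1 -> `|f' z| <= C / Num.sqrt z) ->
  let G x := A' x * f (1 - `|cos (h x)|) +
    A x * (f' (1 - `|cos (h x)|) * (Num.sg (cos (h x)) * sin (h x)) * g x) in
  mu.-integrable `[a, b] (EFin \o G) /\
  \int[mu]_(x in `[a, b]) G x =
    A b * f (1 - `|cos (h b)|) - A a * f (1 - `|cos (h a)|).
Proof.
move=> ab ig hg dA cA' cf df cf' f'C.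
have [C1 C10 fC1] := within_itv_bounded ler01 cf.
have C0 : 0 <= C.
  have h2 : 0 < (2^-1 : R) < 1 by rewrite invr_gt0 ltr0n/= invf_lt1 ?ltr0n// ltr1n.
  have := le_trans (normr_ge0 _) (f'C _ h2).
  by rewrite pmulr_lge0// invr_gt0 sqrtr_gt0; case/andP: h2.
pose F_ n y := f (zt (e_ n) y).
pose dz n y := (1 - e_ n) * cos y * sin y / s (e_ n) y.
pose phi_ n y := f' (zt (e_ n) y) * dz n y.
have zb n y := zt_bounds y (e_01 n).
have z01 n y : 0 < zt (e_ n) y < 1 by have [-> ->] := zb n y.
have e0 n : 0 < e_ n by case/andP: (e_01 n).
have cosb y : 0 <= 1 - `|cos y| <= 1.
  have := cos2Dsin2 y; have := sqr_ge0 (sin y); have := normr_ge0 (cos y).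
  by rewrite -[cos y ^+ 2]real_normK ?num_real// => ? ? ?; apply/andP; split; nra.
apply: (@chain_rule_limit R a b h g A A' ab ig hg dA cA' F_ phi_
  (fun y => f (1 - `|cos y|)) (fun y => f' (1 - `|cos y|) * (Num.sg (cos y) * sin y)) (C1 + 2 * C)).
- move=> n y; exact: is_derive_funcomp (df _ (z01 n y)) (is_derive_zt _ (e0 n)).
- move=> n y; apply: cvgM; last exact: continuous_dzt.
  apply: (@continuous_comp _ _ _ (zt (e_ n))); last exact: cf'.
  exact: is_derive_continuous (is_derive_zt _ (e0 n)).
- move=> n y; rewrite (le_trans (fC1 _ _))//; last by rewrite lerDl mulr_ge0.
  by have /andP[/ltW -> /ltW ->] := z01 n y.
- move=> n y; have [zp _ sinz dzs] := zb n y.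
  rewrite normrM (@le_trans _ _ (C / Num.sqrt (zt (e_ n) y) * (2 * Num.sqrt (zt (e_ n) y))))//.
    by rewrite ler_pM// ?f'C// (le_trans dzs).
  have sz0 : Num.sqrt (zt (e_ n) y) != 0 by rewrite gt_eqF// sqrtr_gt0.
  by rewrite [2 * _]mulrC mulrA divfK// [C * 2]mulrC lerDr.
- move=> y; have /subspace_continuousP/(_ (1 - `|cos y|)) := cf.
  move=> /(_ _)/cvgrPdist_le cfy; apply/cvgrPdist_le => eps eps0.
  have : `[0, 1]%classic (1 - `|cos y|) by rewrite /= in_itv /= cosb.
  move=> /cfy/(_ eps eps0) H.
  have {}H : \forall t \near 1 - `|cos y|, 0 <= t <= 1 -> `|f (1 - `|cos y|) - f t| <= eps.
    have H' : \forall t \near 1 - `|cos y|, `[0, 1]%classic t -> `|f (1 - `|cos y|) - f t| <= eps := H.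
    by apply: filterS H' => t H' t01; apply: H'; rewrite /= in_itv.
  have Hn : \forall n \near \oo, 0 <= zt (e_ n) y <= 1 ->
    `|f (1 - `|cos y|) - f (zt (e_ n) y)| <= eps := @cvg_zt y _ H.
  apply: filterS Hn => n; apply.
  by have /andP[/ltW -> /ltW ->] := z01 n y.
- move=> y; rewrite /phi_.
  (* Where the cosine or the sine vanishes, the fold takes the value 1 or 0, at which nothing is
     known of [f']. There the inner derivative [dz n y] is identically 0, and so is the claimed
     limit, thanks to the value 0 of the sign at 0. *)
  have [c0|c0] := eqVneq (cos y) 0.
    have -> : (fun n => f' (zt (e_ n) y) * dz n y) = (fun _ => 0).
      by apply/funext => n; rewrite /dz c0 mulr0 !mul0r mulr0.
    by rewrite c0 sgr0 mul0r mulr0; exact: cvg_cst.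
  have [s0|s0] := eqVneq (sin y) 0.
    have -> : (fun n => f' (zt (e_ n) y) * dz n y) = (fun _ => 0).
      by apply/funext => n; rewrite /dz s0 mulr0 !mul0r mulr0.
    by rewrite s0 !mulr0; exact: cvg_cst.
  have zy : 0 < 1 - `|cos y| < 1.
    have h1 := cos2Dsin2 y; have h2 : 0 < sin y ^+ 2 by rewrite exprn_even_gt0.
    have h3 : 0 < `|cos y| by rewrite normr_gt0.
    by rewrite -[cos y ^+ 2]real_normK ?num_real// in h1; apply/andP; split; nra.
  apply: cvgM.
    exact: (cvg_comp (fun n => zt (e_ n) y) f' (@cvg_zt y) (cf' _ zy)).
  have -> : Num.sg (cos y) * sin y = (1 - 0) * cos y * sin y / `|cos y|.
    rewrite subr0 mul1r mulrAC; congr (_ * _).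
    apply: (mulIf (_ : `|cos y| != 0)); first by rewrite normr_eq0.
    by rewrite divfK ?normr_eq0// -numEsg.
  apply: cvgM; last by apply: cvgV; [rewrite normr_eq0|exact: cvg_s].
  apply: cvgM; last exact: cvg_cst.
  apply: cvgM; last exact: cvg_cst.
  by apply: cvgB; [exact: cvg_cst|exact: cvg_e].
Unshelve. all: by end_near. Qed.

End folded_chain_rule.

(** * A first-order equation with a singular point *)

Section fuchsian_ode.
Context {R : realType}.
Notation mu := (@lebesgue_measure R).
Variables (Psi : R -> R -> R) (k : nat) (C u0 : R).
Implicit Types (u v f : R -> R) (x y B : R) (n : nat).
Hypothesis C0 : 0 <= C.
Hypothesis cPsi : forall u, continuous u -> continuous (fun x => Psi x (u x)).
Hypothesis Psi0 : forall x, 0 <= x -> `|Psi x u0| <= C * x.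
Hypothesis Psi_lip : forall x (a b : R), 0 <= x -> a <= b ->
  0 <= Psi x a - Psi x b <= k.+1%:R * (b - a).

(* x u' = Psi x u is (x^(k+1) u)' = x^k N x u, hence u = T u. By Psi_lip the map
   N x is k.+1-Lipschitz, so T contracts the norm sup |u x - u0| / x by th. *)
Let N x (a : R) := Psi x a + k.+1%:R * a.
Let I u x := \int[mu]_(y in `[0, x]) (y ^+ k * N y (u y)).
Let T u x := if 0 < x then x^-1 ^+ k.+1 * I u x else u0.
Let th : R := k.+1%:R / k.+2%:R.

Let th01 : 0 <= th < 1.
Proof. by rewrite /th divr_ge0//= ltr_pdivrMr// mul1r ltr_nat. Qed.

Let thE : th = 1 - k.+2%:R^-1.
Proof. by rewrite /th -[k.+1%:R](addrK 1) natr1 mulrBl mulfV ?pnatr_eq0// mul1r. Qed.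

Let N_lip x (a b : R) : 0 <= x -> `|N x a - N x b| <= k.+1%:R * `|a - b|.
Proof.
move=> x0; wlog ab : a b / a <= b.
  move=> H; have [/H//|/ltW/H] := leP a b.
  by rewrite distrC [in leRHS]distrC.
rewrite [`|a - b|]distrC (ger0_norm (_ : 0 <= b - a)) ?subr_ge0// distrC.
have /andP[h1 h2] := Psi_lip x0 ab; set q : R := k.+1%:R in h2 *.
have qb : 0 <= q * (b - a) by exact: le_trans h2.
by rewrite /N -/q ler_norml; lra.
Qed.

Let cX n : continuous (fun y : R => y ^+ n).
Proof. exact: exprn_continuous. Qed.

Let cN u : continuous u -> continuous (fun x => N x (u x)).
Proof.
move=> uc x; apply: (@cvgD _ R); first exact: cPsi.
by apply: cvgM; [exact: cvg_cst|exact: uc].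
Qed.

Let cXN u : continuous u -> continuous (fun y => y ^+ k * N y (u y)).
Proof. by move=> uc x; apply: cvgM; [exact: cX|exact: cN]. Qed.

Let int_c f x : continuous f -> mu.-integrable `[0, x] (EFin \o f).
Proof. by move=> fc; apply: continuous_integrable_itv; exact: continuous_subspaceT. Qed.

Let int_pow n x : 0 < x -> \int[mu]_(y in `[0, x]) (y ^+ n) = x ^+ n.+1 / n.+1%:R.
Proof.
move=> x0; have dF (y : R) : is_derive y 1 (fun y : R => y ^+ n.+1 * n.+1%:R^-1) (y ^+ n).
  apply: is_derive_eqr (is_derive_funM (is_derive_funX n.+1 (is_derive_id y 1))
    (is_derive_cst (n.+1%:R^-1 : R) y 1)) _.
  by rewrite /= mulr0 addr0 mulr1 mulrAC mulfV ?mul1r// pnatr_eq0.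
rewrite (@Rintegral_FTC2 _ _ _ (fun y : R => y ^+ n.+1 * n.+1%:R^-1))//.
- by rewrite expr0n mul0r subr0.
- exact: continuous_subspaceT.
- by apply: continuous_subspaceT => y; exact: is_derive_continuous.
Qed.

Let int_pow_bound n B f x : 0 < x -> continuous f ->
  (forall y, 0 <= y -> `|f y| <= B * y ^+ n) ->
  `|\int[mu]_(y in `[0, x]) f y| <= B * (x ^+ n.+1 / n.+1%:R).
Proof.
move=> x0 fc fB; apply: (le_trans (le_normr_Rintegral _ (int_c x fc))) => //.
have iX : mu.-integrable `[0, x] (EFin \o (fun y : R => y ^+ n)) by exact: int_c.
rewrite -int_pow// -RintegralZl//; apply: le_Rintegral => //.
- by apply: int_c => y; apply: cvg_norm; exact: fc.
- by apply: int_c => y; apply: cvgM; [exact: cvg_cst|exact: cX].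
- by move=> y /=; rewrite in_itv /= => /andP[y0 _]; exact: fB.
Qed.

Let scale_bound B x : 0 < x ->
  x^-1 ^+ k.+1 * (B * (x ^+ k.+2 / k.+2%:R)) = B / k.+2%:R * x.
Proof.
move=> x0; rewrite (exprS x k.+1) exprVn.
have xN0 : x ^+ k.+1 != 0 by rewrite expf_neq0// gt_eqF.
have E := mulVf xN0; clear xN0.
set a := _^-1 in E *; set b := x ^+ k.+1 in E *; set c := k.+2%:R^-1.
have -> : a * (B * (x * b * c)) = (a * b) * (B * c * x) by lra.
by rewrite E mul1r.
Qed.

(** The contraction factor is a quotient: [N] contributes its Lipschitz constant k + 1, and the
    integration of y^(k+1) divides by k + 2. *)
Let T_lip u v B x : continuous u -> continuous v ->
  (forall y, 0 <= y -> `|u y - v y| <= B * y) -> 0 <= x ->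
  `|T u x - T v x| <= th * B * x.
Proof.
move=> uc vc uv; rewrite [0 <= x]le_eqVlt => /predU1P[<-|x0].
  by rewrite /T ltxx subrr normr0 mulr0.
rewrite /T x0 -mulrBr -RintegralB//; [|exact/int_c/cXN..].
rewrite normrM ger0_norm ?exprn_ge0 ?invr_ge0 ?(ltW x0)//.
have -> : th * B * x = (k.+1%:R * B) / k.+2%:R * x by rewrite /th -!mulrA; congr (_ * _); rewrite mulrCA.
rewrite -scale_bound// ler_wpM2l ?exprn_ge0 ?invr_ge0 ?(ltW x0)//.
apply: int_pow_bound => //.
  by move=> y; apply: (@cvgB _ R); exact: cXN.
move=> y y0; rewrite -mulrBr normrM ger0_norm ?exprn_ge0// exprS.
rewrite mulrA [leRHS]mulrC ler_wpM2l ?exprn_ge0// (le_trans (N_lip _ _ y0))//.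
by rewrite -mulrA ler_wpM2l// uv.
Qed.

(** The constant is (1 - th) C, exactly what is left for T to preserve the cone
    [|u x - u0| <= C * x] after a contraction by [th]. *)
Let T_u0 x : 0 <= x -> `|T (fun _ => u0) x - u0| <= C / k.+2%:R * x.
Proof.
rewrite [0 <= x]le_eqVlt => /predU1P[<-|x0].
  by rewrite /T ltxx subrr normr0 mulr0.
have c0 : continuous (fun _ : R => u0) by exact: cst_continuous.
rewrite /T x0.
have E : u0 = x^-1 ^+ k.+1 * \int[mu]_(y in `[0, x]) (k.+1%:R * u0 * y ^+ k).
  rewrite RintegralZl//; last exact: int_c.
  rewrite int_pow// exprVn [_ * u0]mulrC -!mulrA mulrCA [X in _ = u0 * X](_ : _ = 1) ?mulr1//.
  rewrite [X in _ * X]mulrCA mulfV ?pnatr_eq0// mulr1 mulVf//.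
  by rewrite expf_neq0// gt_eqF.
rewrite [X in _ - X]E -mulrBr -RintegralB//; last first.
- by apply: int_c => y; apply: cvgM; [exact: cvg_cst|exact: cX].
- exact/int_c/cXN.
rewrite normrM ger0_norm ?exprn_ge0 ?invr_ge0 ?(ltW x0)//.
rewrite -scale_bound// ler_wpM2l ?exprn_ge0 ?invr_ge0 ?(ltW x0)//.
apply: int_pow_bound => //.
  move=> y; apply: (@cvgB _ R); first exact: cXN.
  by apply: cvgM; [exact: cvg_cst|exact: cX].
move=> y y0; rewrite [X in `|X|](_ : _ = y ^+ k * Psi y u0); last first.
  by rewrite /N; set q := k.+1%:R; set w := y ^+ k; lra.
rewrite normrM ger0_norm ?exprn_ge0// exprS [leRHS]mulrA [leRHS]mulrC.
by rewrite ler_wpM2l ?exprn_ge0// Psi0.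
Qed.

(** At a fixed point the second term drops out and x u' = Psi x u remains. *)
Let is_derive_T u x : continuous u -> 0 < x ->
  is_derive x 1 (T u) ((Psi x (u x) + k.+1%:R * (u x - T u x)) / x).
Proof.
move=> uc x0.
have x1 : x < x + 1 by rewrite ltrDl.
have cx : {for x, continuous (fun y => y ^+ k * N y (u y))} by exact: cXN.
have [dI dIE] := @continuous_FTC1_closed R _ 0 x (x + 1) x1 (int_c _ (cXN uc)) x0 cx.
have {dIE}dI : is_derive x 1 (I u) (x ^+ k * N x (u x)).
  by split; [exact: dI|rewrite -derive1E dIE].
have xN0 : x != 0 by rewrite gt_eqF.
have dV := is_derive_funV xN0 (is_derive_id x 1).
apply: (@near_eq_is_derive _ _ _ (fun y => y^-1 ^+ k.+1 * I u y)).
  by near=> y; rewrite /T ifT//; near: y; exact: lt_nbhsr.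
apply: is_derive_eqr (is_derive_funM (is_derive_funX k.+1 dV) dI) _.
rewrite /T x0 /N /id /=.
have E : x^-1 ^+ k.+1 * x ^+ k = x^-1.
  by rewrite exprS -mulrA -exprMn mulVf// expr1n mulr1.
set q := k.+1%:R; rewrite [X in _ + X]mulrA E exprS.
set w := x^-1 ^+ k; set J := I u x; set p := Psi x (u x); set i := x^-1; lra.
Unshelve. all: by end_near. Qed.

(** The constant extension to x <= 0 makes the iterates continuous on the whole line, as [cPsi]
    requires; the linear bound is what gives continuity at 0. *)
Let good u := [/\ continuous u, (forall x, x <= 0 -> u x = u0) &
  (forall x, 0 <= x -> `|u x - u0| <= C * x)].

Let continuous_good u : (forall x, 0 < x -> {for x, continuous u}) ->
  (forall x, x <= 0 -> u x = u0) -> (forall x, 0 <= x -> `|u x - u0| <= C * x) ->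
  continuous u.
Proof.
move=> up um ub x; have [x0|x0|->] := ltgtP x 0; [|exact: up|].
- apply/cvgrPdist_lt => e e0; near=> y.
  rewrite !um ?subrr ?normr0 ?(ltW x0)// ltW//; near: y; exact: lt_nbhsl.
- apply/cvgrPdist_lt => e e0; rewrite um//.
  have C1 : 0 < C + 1 by rewrite ltr_wpDl.
  near=> y; apply: (@le_lt_trans _ _ (`|y| * (C + 1))).
    have [y0|y0] := leP y 0; first by rewrite um// subrr normr0 mulr_ge0// ltW.
    rewrite distrC (le_trans (ub _ (ltW y0)))// (gtr0_norm y0) mulrC.
    by rewrite ler_wpM2l ?ltW// ltrDl.
  rewrite -ltr_pdivlMr//; near: y.
  have := @nbhs0_lt R R _ (divr_gt0 e0 C1); exact.
Unshelve. all: by end_near. Qed.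

Let good_u0 : good (fun _ => u0).
Proof.
split => // [|x x0]; first exact: cst_continuous.
by rewrite subrr normr0 mulr_ge0.
Qed.

Let good_T u : good u -> good (T u).
Proof.
move=> [uc um ub].
have Tm x : x <= 0 -> T u x = u0 by rewrite /T ltNge => ->.
have Tb x : 0 <= x -> `|T u x - u0| <= C * x.
  move=> x0; rewrite (le_trans (ler_distD (T (fun _ => u0) x) _ _))//.
  have := T_lip uc (@cst_continuous _ _ u0) ub x0; have := T_u0 x0.
  have -> : th * C * x = C * x - C / k.+2%:R * x.
    by rewrite thE; move: (k.+2%:R^-1) => i; lra.
  move: (C / k.+2%:R * x) => w h1 h2; lra.
split=> //; apply: continuous_good => // x x0.
exact: is_derive_continuous (is_derive_T uc x0).
Qed.

Let u_ n := iter n T (fun _ => u0).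

Let good_u n : good (u_ n).
Proof. by elim: n => [|n IH]; [exact: good_u0|exact: good_T]. Qed.

Let u_step n x : 0 <= x -> `|u_ n.+1 x - u_ n x| <= C * th ^+ n * x.
Proof.
elim: n x => [|n IH] x x0.
  by rewrite expr0 mulr1; have [_ _] := good_u 1; exact.
have [c1 _ _] := good_u n.+1; have [c2 _ _] := good_u n.
have := @T_lip _ _ (C * th ^+ n) _ c1 c2 IH x0.
by rewrite mulrCA -exprS.
Qed.

(** Since 1 - th = 1 / (k + 2), the bound on one step telescopes. Hence [u_ n x] plus, respectively
    minus, [B x * th ^+ n] is nonincreasing, respectively nondecreasing, and the two sequences
    enclose the limit with an explicit error. *)
Let thC x n : C * th ^+ n * x = C * k.+2%:R * x * th ^+ n - C * k.+2%:R * x * th ^+ n.+1.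
Proof.
have E1 : th * k.+2%:R = k.+2%:R - 1.
  by rewrite thE mulrBl mul1r mulVf// pnatr_eq0.
rewrite exprS; move: (th ^+ n) k.+2%:R E1 => t P; move: th => s E1.
have -> : C * P * x * (s * t) = C * x * t * (s * P) by lra.
by rewrite E1; lra.
Qed.

Lemma fuchsian_ode_solution : exists u C',
  [/\ continuous u, (forall x, x <= 0 -> u x = u0),
      (forall x, 0 <= x -> `|u x - u0| <= C' * x) &
      (forall x, 0 < x -> is_derive x 1 u (Psi x (u x) / x))].
Proof.
pose B x := C * k.+2%:R * x.
have thn x : B x * th ^+ n @[n --> \oo] --> 0.
  have -> : (fun n => B x * th ^+ n) = geometric (B x) th by [].
  by apply: cvg_geometric; rewrite ger0_norm; case/andP: th01.
have B0 x : 0 <= x -> 0 <= B x by move=> x0; rewrite !mulr_ge0.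
have thn0 x n : 0 <= x -> 0 <= B x * th ^+ n.
  by move=> x0; rewrite mulr_ge0 ?B0// exprn_ge0//; case/andP: th01.
have ubd n x : 0 <= x -> `|u_ n x - u0| <= C * x by have [_ _] := good_u n; exact.
have dec x : 0 <= x -> nonincreasing_seq (fun n => u_ n x + B x * th ^+ n).
  move=> x0; apply/nonincreasing_seqP => n.
  by have := u_step n x0; rewrite thC -/(B x) ler_norml; lra.
have inc x : 0 <= x -> nondecreasing_seq (fun n => u_ n x - B x * th ^+ n).
  move=> x0; apply/nondecreasing_seqP => n.
  by have := u_step n x0; rewrite thC -/(B x) ler_norml; lra.
have cvu x : 0 <= x -> cvgn (fun n => u_ n x).
  move=> x0; have : cvgn (fun n => u_ n x + B x * th ^+ n).
    apply: nonincreasing_is_cvgn; first exact: dec.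
    exists (u0 - C * x) => _ [n _ <-].
    by have := ubd n _ x0; have := thn0 x n x0; rewrite ler_norml; lra.
  move=> vc; apply/cvg_ex; exists (limn (fun n => u_ n x + B x * th ^+ n) - 0).
  have -> : (fun n => u_ n x) = (fun n => (u_ n x + B x * th ^+ n) - B x * th ^+ n).
    by apply/funext => n; rewrite addrK.
  by apply: cvgB; [exact: vc|exact: thn].
pose u x := limn (fun n => u_ n x).
have uc x : 0 <= x -> u_ n x @[n --> \oo] --> u x by move/cvu.
have uun n x : 0 <= x -> `|u x - u_ n x| <= B x * th ^+ n.
  move=> x0; rewrite ler_distl.
  have l1 : limn (fun n => u_ n x + B x * th ^+ n) = u x.
    apply/cvg_lim => //; rewrite -[u x]addr0; apply: cvgD; [exact: uc|exact: thn].
  have l2 : limn (fun n => u_ n x - B x * th ^+ n) = u x.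
    apply/cvg_lim => //; rewrite -[u x]subr0; apply: cvgB; [exact: uc|exact: thn].
  apply/andP; split.
    rewrite -l2; apply: (@nondecreasing_cvgn_le _ (fun n => u_ n x - B x * th ^+ n)); first exact: inc.
    apply/cvg_ex; exists (u x); rewrite -[u x]subr0.
    by apply: cvgB; [exact: uc|exact: thn].
  rewrite -l1; apply: (@nonincreasing_cvgn_ge _ (fun n => u_ n x + B x * th ^+ n)); first exact: dec.
  apply/cvg_ex; exists (u x); rewrite -[u x]addr0.
  by apply: cvgD; [exact: uc|exact: thn].
have um x : x <= 0 -> u x = u0.
  move=> x0; apply/cvg_lim => //; under eq_fun => n.
    by have [_ /(_ x x0) -> _] := good_u n; over.
  exact: cvg_cst.
have ub x : 0 <= x -> `|u x - u0| <= C * x.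
  move=> x0; have : `|u_ n x - u0| @[n --> \oo] --> `|u x - u0|.
    by apply: cvg_norm; apply: cvgB; [exact: uc|exact: cvg_cst].
  move=> H; rewrite -(cvg_lim _ H)//; apply: limr_le; first by apply/cvg_ex; exists `|u x - u0|.
  by apply: nearW => n; exact: ubd.
have cu : continuous u.
  apply: continuous_good => // x x0; apply/cvgrPdist_lt => e e0.
  have e3 : 0 < e / 3 by rewrite divr_gt0.
  have [n hn] : exists n, B (x + 1) * th ^+ n < e / 3.
    have /cvgr0_norm_lt/(_ _ e3)[n _ /(_ n (leqnn n)) hn] := thn (x + 1).
    by exists n; apply: le_lt_trans hn; exact: ler_norm.
  have [unc _ _] := good_u n.
  have near1 y : 0 <= y -> y <= x + 1 -> `|u y - u_ n y| < e / 3.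
    move=> y0 yx; apply: le_lt_trans hn; apply: le_trans (uun n y y0) _.
    rewrite ler_wpM2r ?exprn_ge0//; first by case/andP: th01.
    by rewrite /B ler_wpM2l// mulr_ge0.
  near=> y.
  have h1 : `|u_ n x - u_ n y| < e / 3.
    by near: y; have /cvgrPdist_lt := unc x; exact.
  have y0 : 0 < y by near: y; exact: lt_nbhsr.
  have y1 : y < x + 1 by near: y; apply: lt_nbhsl; rewrite ltrDl.
  have h2 := near1 y (ltW y0) (ltW y1).
  have h3 : `|u x - u_ n x| < e / 3 by apply: near1; rewrite ?ltW// ltrDl.
  by move: h1 h2 h3; rewrite !ltr_norml; lra.
(* Both [T u x] and [u x] lie within [B x * th ^+ n.+1] of the iterate of index n + 1. *)
have Tu x : 0 <= x -> T u x = u x.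
  move=> x0; apply/eqP; rewrite -subr_eq0 -normr_le0.
  have H n : `|T u x - u x| <= 2 * (B x * th ^+ n.+1).
    have [unc _ _] := good_u n.
    have h1 := @T_lip u (u_ n) (C * k.+2%:R * th ^+ n) x cu unc _ x0.
    have {}h1 : `|T u x - u_ n.+1 x| <= B x * th ^+ n.+1.
      apply: le_trans (h1 _) _; last by rewrite /B exprS; lra.
      by move=> y y0; apply: le_trans (uun n y y0) _; rewrite /B mulrAC.
    have := uun n.+1 x x0; move: h1; rewrite !ler_norml; lra.
  have l : 2 * (B x * th ^+ n.+1) @[n --> \oo] --> (2 * 0 : R).
    apply: cvgM; first exact: cvg_cst.
    by have := thn x; rewrite -(cvg_shiftS (fun n => B x * th ^+ n)).
  rewrite mulr0 in l; rewrite -(cvg_lim _ l)//; apply: limr_ge; first by apply/cvg_ex; exists 0.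
  by apply: nearW.
exists u, C; split => // x x0.
have := is_derive_T cu x0; rewrite (Tu x (ltW x0)) subrr mulr0 addr0.
apply: near_eq_is_derive; near=> y; apply: Tu; rewrite ltW//.
by near: y; exact: lt_nbhsr.
Unshelve. all: by end_near. Qed.

End fuchsian_ode.

(** * The profile *)

Section profile.
Context {R : realType}.
Implicit Types (b c u v q z : R).

(* With b = p - 1 and c = cos h, substituting r h' = q(1 - cos h) sin h into the
   Euler-Lagrange equation gives z (2 - z) q q' = slope_num b c q for z = 1 - c.
   slope is the partial fraction form of slope_num / q. *)
Definition slope_num b c q := (1 + q ^+ 2) * (c * (1 - b * q ^+ 2) + (b - 1) * q) /
  (1 + b * q ^+ 2).

Definition slope b c q := c * (q^-1 - q + 2 * (1 - b) * (q / (1 + b * q ^+ 2))) +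
  (b - 1) * ((1 + q ^+ 2) / (1 + b * q ^+ 2)).

Let den_gt0 b q : 0 < b -> 0 < 1 + b * q ^+ 2.
Proof. by move=> b0; rewrite ltr_pwDl// mulr_ge0 ?sqr_ge0// ltW. Qed.

Lemma slopeM b c q : 0 < b -> q != 0 -> slope b c q * q = slope_num b c q.
Proof.
move=> b0 q0; have D0 := lt0r_neq0 (den_gt0 q b0); rewrite /slope /slope_num.
apply: (mulIf D0); rewrite divfK//.
have h1 := divfK D0 q; have h2 := divfK D0 (1 + q ^+ 2); have h3 := mulVf q0.
set D := 1 + b * q ^+ 2 in D0 h1 h2 *.
have -> : (c * (q^-1 - q + 2 * (1 - b) * (q / D)) + (b - 1) * ((1 + q ^+ 2) / D)) * q * D =
  c * ((q^-1 * q) * D - q ^+ 2 * D + 2 * (1 - b) * ((q / D * D)) * q) +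
  (b - 1) * q * ((1 + q ^+ 2) / D * D) by lra.
by rewrite h1 h2 h3 /D; lra.
Qed.

(** The factor 1 - c, that is z, compensates the singular denominator, which is why 1 is the initial
    value. The sign, that of b - 1, tells on which side of 1 the profile lies. *)
Lemma slope1 b c : 0 < b -> slope b c 1 = 2 * (1 - c) * ((b - 1) / (1 + b)).
Proof.
move=> b0; rewrite /slope invr1 subrr add0r expr1n mulr1 mul1r.
by move: ((1 + b)^-1) => i; lra.
Qed.

(** The opposite of the divided difference of [slope b c] in q. Its sign gives the monotonicity, its
    size the Lipschitz constant demanded by the singular equation. *)
Let kap b c u v := c * (1 + (u * v)^-1 - 2 * (1 - b) * ((1 - b * (u * v)) /
   ((1 + b * u ^+ 2) * (1 + b * v ^+ 2)))) +
  (b - 1) ^+ 2 * ((u + v) / ((1 + b * u ^+ 2) * (1 + b * v ^+ 2))).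

Let slopeB b c u v : 0 < b -> 0 < u -> 0 < v ->
  slope b c u - slope b c v = (v - u) * kap b c u v.
Proof.
move=> b0 u0 v0; have Du := lt0r_neq0 (den_gt0 u b0); have Dv := lt0r_neq0 (den_gt0 v b0).
have un := lt0r_neq0 u0; have vn := lt0r_neq0 v0.
have e1 := subr_invV un vn.
have e2 : u / (1 + b * u ^+ 2) - v / (1 + b * v ^+ 2) =
    (u - v) * ((1 - b * (u * v)) / ((1 + b * u ^+ 2) * (1 + b * v ^+ 2))).
  by rewrite -mulNr addf_div// [RHS]mulrA; congr (_ / _); lra.
have e3 : (1 + u ^+ 2) / (1 + b * u ^+ 2) - (1 + v ^+ 2) / (1 + b * v ^+ 2) =
    (1 - b) * (u - v) * ((u + v) / ((1 + b * u ^+ 2) * (1 + b * v ^+ 2))).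
  by rewrite -mulNr addf_div// [RHS]mulrA; congr (_ / _); lra.
rewrite /slope /kap invfM; move: e1 e2 e3.
move: (u / _) (v / (1 + b * v ^+ 2)) ((1 + u ^+ 2) / _) ((1 + v ^+ 2) / _)
  ((1 - b * (u * v)) / _) ((u + v) / _) (u^-1) (v^-1) => A1 A2 B1 B2 E G iu iv e1 e2 e3.
have -> : c * (iu - u + 2 * (1 - b) * A1) + (b - 1) * B1 -
  (c * (iv - v + 2 * (1 - b) * A2) + (b - 1) * B2) =
  c * ((iu - iv) - (u - v) + 2 * (1 - b) * (A1 - A2)) + (b - 1) * (B1 - B2) by lra.
by rewrite e1 e2 e3; lra.
Qed.

(** The denominator D is at least (1 + b u v)^2, by Cauchy-Schwarz, so (1 - b u v) / D is at most 1
    in absolute value. For b < 1 and u, v <= 1 the bracket is then at least 2 - 2 (1 - b). The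
    constant 101 comes from 1 + 1 / (u v) with u, v >= 1/10. *)
Let kap_bounds b c u v (M : R) : 0 < b -> 0 <= c <= 1 ->
  10^-1 <= u <= M -> 10^-1 <= v <= M ->
  (b < 1 /\ M = 1) \/ (1 <= b /\ 1 <= u /\ 1 <= v) ->
  0 <= kap b c u v <= 101 + 2 * (1 + b) + (b - 1) ^+ 2 * (2 * M).
Proof.
move=> b0 /andP[c0 c1] /andP[um uM] /andP[vm vM] cases.
have u0 : 0 < u by lra.
have v0 : 0 < v by lra.
set w := u * v; have w0 : 0 < w by rewrite mulr_gt0.
set D := (1 + b * u ^+ 2) * (1 + b * v ^+ 2).
have D1 : (1 + b * w) ^+ 2 <= D.
  have : 0 <= b * (u - v) ^+ 2 by rewrite mulr_ge0 ?sqr_ge0// ltW.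
  by rewrite /D /w; lra.
have t0 : 0 < b * w by rewrite mulr_gt0.
have D2 : 1 + b * w <= D by apply: le_trans D1; nra.
have D0 : 0 < D by lra.
have iD0 : 0 < D^-1 by rewrite invr_gt0.
have iD1 : D^-1 <= 1 by rewrite invf_le1//; lra.
have iDD : D^-1 * D = 1 by rewrite mulVf// gt_eqF.
have E1 : `|(1 - b * w) / D| <= 1.
  by rewrite normrM normfV (gtr0_norm D0) ler_pdivrMr// mul1r ler_norml; lra.
have G0 : 0 <= (u + v) / D by rewrite divr_ge0//; lra.
have G1 : (u + v) / D <= 2 * M.
  by rewrite ler_pdivrMr//; nra.
have w1 : w^-1 <= 100.
  rewrite -[100]invrK lef_pV2 ?posrE ?invr_gt0//.
  by have : (100^-1 : R) = 10^-1 * 10^-1 by [rewrite -invfM -natrM|]; rewrite /w => ->; nra.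
have iw0 : 0 < w^-1 by rewrite invr_gt0.
have br : 0 <= 1 + w^-1 - 2 * (1 - b) * ((1 - b * w) / D).
  case: cases => [[b1 M1]|[b1 [u1 v1]]].
    have : 1 <= w^-1 by rewrite -[1]invr1 lef_pV2 ?posrE// /w; nra.
    by move: E1; rewrite ler_norml; nra.
  (* For b >= 1 put t = b w, so that 1 <= w <= t; after clearing denominators, 2 (t - w) (t - 1) <=
     2 (t - 1)^2 <= 2 (1 + t)^2 <= (w + 1) D. *)
  have : 2 * (1 - b) * ((1 - b * w) / D) <= 1 + w^-1; last by lra.
  rewrite mulrA ler_pdivrMr// -(ler_pM2l w0).
  have -> : w * ((1 + w^-1) * D) = (w + 1) * D.
    by rewrite mulrA mulrDr mulr1 mulfV ?gt_eqF.
  have w1' : 1 <= w by rewrite /w; nra.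
  have h1 : (1 + b * w) ^+ 2 * (w + 1) <= (w + 1) * D by rewrite mulrC ler_wpM2l//; lra.
  apply: le_trans h1; set t := b * w in t0 *.
  have -> : w * (2 * (1 - b) * (1 - t)) = 2 * (t - w) * (t - 1) by rewrite /t; lra.
  have tw : w <= t by rewrite /t; nra.
  have : (t - w) * (t - 1) <= (t - 1) * (t - 1) by rewrite ler_wpM2r//; lra.
  have : (1 + t) ^+ 2 * 2 <= (1 + t) ^+ 2 * (w + 1) by rewrite ler_wpM2l ?sqr_ge0//; lra.
  by rewrite !expr2; nra.
rewrite /kap -/w -/D; apply/andP; split.
  by apply: addr_ge0; rewrite mulr_ge0 ?sqr_ge0.
apply: lerD; last by rewrite ler_wpM2l ?sqr_ge0.
have h : 1 + w^-1 - 2 * (1 - b) * ((1 - b * w) / D) <= 101 + 2 * (1 + b).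
  by move: E1; rewrite ler_norml; nra.
by apply: le_trans h; rewrite ler_piMl.
Qed.

(** Comparison principle: after the last point where f <= 0 the function is positive, hence
    nonincreasing, and cannot reach a positive value. The sign of f' is asked only where f > 0, that
    is where the solution has crossed its barrier. *)
Lemma nonpos_of_derive_le0 (f f' : R -> R) : continuous f -> f 0 <= 0 ->
  (forall z, 0 < z < 1 -> is_derive z 1 f (f' z)) ->
  (forall z, 0 < z < 1 -> 0 < f z -> f' z <= 0) ->
  forall z, 0 <= z <= 1 -> f z <= 0.
Proof.
move=> fc f0 df f'0 z1 /andP[z10 z11]; rewrite leNgt; apply/negP => fz1.
pose K := `[0, z1]%classic `&` [set x | f x <= 0].
have cK : compact K.
  apply: (@subclosed_compact _ _ `[0, z1]%classic).
  - apply: closedI; first exact: interval_closed.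
    rewrite (_ : [set x | f x <= 0] = f @^-1` `]-oo, 0]%classic).
      by apply: closed_comp => [x _|]; [exact: fc|exact: interval_closed].
    by apply/seteqP; split => x /=; rewrite in_itv.
  - exact: segment_compact.
  - by move=> x [].
have K0 : K !=set0 by exists 0; split => //=; rewrite in_itv /= lexx.
have [s sK smax] := @compact_EVT_max _ R id K K0 cK (fun x => @continuous_subspaceT _ _ K id (fun y => cvg_id) x).
have {sK}[] : K s by move: sK; rewrite inE.
rewrite /= in_itv /= => /andP[s0 sz] fs.
have {}sz : s < z1.
  by rewrite lt_neqAle sz andbT; apply/eqP => sz1; move: fs; rewrite sz1 leNgt fz1.
have pos x : s < x <= z1 -> 0 < f x.
  move=> /andP[sx xz]; rewrite ltNge; apply/negP => fx.
  have : x \in K by rewrite inE; split => //=; rewrite in_itv /= xz (le_trans s0 (ltW sx)).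
  by move=> /smax; rewrite leNgt sx.
have [c cs fE] : exists2 c, c \in `]s, z1[%R & f z1 - f s = f' c * (z1 - s).
  apply: MVT => //; last exact: continuous_subspaceT.
  move=> x; rewrite in_itv /= => /andP[sx xz]; apply: df.
  by rewrite (le_lt_trans s0 sx) (lt_le_trans xz z11).
move: cs; rewrite in_itv /= => /andP[sc cz].
have fc0 : f' c <= 0.
  apply: f'0; first by rewrite (le_lt_trans s0 sc) (lt_le_trans cz z11).
  by apply: pos; rewrite sc ltW.
have : f z1 - f s <= 0 by rewrite fE mulr_le0_ge0// subr_ge0 ltW.
by rewrite leNgt subr_gt0 (le_lt_trans fs fz1).
Qed.

Definition clamp (m M q : R) := Num.max m (Num.min q M).

Let clamp_bounds (m M q : R) : m <= M -> m <= clamp m M q <= M.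
Proof. by move=> mM; rewrite /clamp le_max lexx ge_max mM ge_min lexx orbT. Qed.

Let clamp_id (m M q : R) : m <= q <= M -> clamp m M q = q.
Proof. by move=> /andP[mq qM]; rewrite /clamp min_l// max_r. Qed.

Let clamp_lip (m M u v : R) : u <= v -> 0 <= clamp m M v - clamp m M u <= v - u.
Proof. by move=> uv; rewrite /clamp /Num.max /Num.min; do ![case: ifPn]; rewrite -?leNgt; lra. Qed.

Lemma continuous_maxr (f g : R -> R) : continuous f -> continuous g ->
  continuous (fun x => Num.max (f x) (g x)).
Proof. by move=> fc gc x; apply: continuous_max; [exact: fc|exact: gc]. Qed.

Lemma continuous_minr (f g : R -> R) : continuous f -> continuous g ->
  continuous (fun x => Num.min (f x) (g x)).
Proof. by move=> fc gc x; apply: continuous_min; [exact: fc|exact: gc]. Qed.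

Lemma continuous_slope b (f g : R -> R) : 0 < b -> (forall x, 0 < g x) ->
  continuous f -> continuous g -> continuous (fun x => slope b (f x) (g x)).
Proof.
move=> b0 g0 fc gc x.
have cst (y : R) : {for x, continuous (fun _ : R => y)} by exact: cvg_cst.
have cg2 : {for x, continuous (fun x => g x ^+ 2)}.
  by apply: (@continuous_comp _ _ _ g (fun x => x ^+ 2)); [exact: gc|exact: exprn_continuous].
have cD : {for x, continuous (fun x => (1 + b * g x ^+ 2)^-1)}.
  apply: cvgV; first by rewrite gt_eqF// den_gt0.
  by apply: (@cvgD _ R); [exact: cst|apply: cvgM; [exact: cst|exact: cg2]].
apply: (@cvgD _ R); apply: cvgM; [exact: fc| |exact: cst|].
  apply: (@cvgD _ R).
    by apply: (@cvgB _ R); [apply: cvgV; [rewrite gt_eqF//|exact: gc]|exact: gc].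
  by apply: cvgM; [exact: cst|apply: cvgM; [exact: gc|exact: cD]].
by apply: cvgM; [apply: (@cvgD _ R); [exact: cst|exact: cg2]|exact: cD].
Qed.

(** This transfers the differential inequality of a barrier to the solution: past the barrier, the
    right-hand side is ordered the favourable way. *)
Lemma slope_decreasing b c u v : 0 < b -> 0 <= c <= 1 ->
  (b < 1 /\ 10^-1 <= u <= 1 /\ 10^-1 <= v <= 1) \/ (1 <= b /\ 1 <= u /\ 1 <= v) ->
  u <= v -> slope b c v <= slope b c u.
Proof.
move=> b0 c01 cases uv.
have h10 : (10^-1 : R) <= 1 by rewrite invf_le1// ler1n.
have [u0 v0] : 0 < u /\ 0 < v.
  have i10 : 0 < (10^-1 : R) by rewrite invr_gt0.
  by case: cases => [[_ [/andP[h1 _] /andP[h2 _]]]|[_ [h1 h2]]]; lra.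
rewrite -subr_ge0 slopeB// mulr_ge0 ?subr_ge0//.
have [] : exists M, (10^-1 <= u <= M) /\ (10^-1 <= v <= M) /\ ((b < 1 /\ M = 1) \/ (1 <= b /\ 1 <= u /\ 1 <= v)).
  case: cases => [[b1 [h1 h2]]|[b1 [h1 h2]]]; first by exists 1; do !split => //; left.
  by exists v; rewrite lexx uv !(le_trans h10)//; do !split => //; right.
by move=> M [h1 [h2 h3]]; have /andP[] := kap_bounds b0 c01 h1 h2 h3.
Qed.

(* The barrier W, with W(1) = 1, is a subsolution uniformly in b < 1 and stays away from 0. *)
Let subsolution b c : 0 < b -> 0 <= c <= 1 ->
  let W := (1 + 11 * c - 2 * c ^+ 2) / 10 in
  10^-1 <= W <= 1 /\
  - (11 - 4 * c) / 10 * ((1 - c) * (1 + c)) * W * (1 + b * W ^+ 2) <=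
    (1 + W ^+ 2) * (c * (1 - b * W ^+ 2) + (b - 1) * W).
Proof.
move=> b0 /andP[c0 c1] W.
have c1' : 0 <= 1 - c by lra.
have h1 : 0 <= c * (11 - 2 * c) by rewrite mulr_ge0//; lra.
have h2 : 0 <= (1 - c) * (9 - 2 * c) by rewrite mulr_ge0//; lra.
have h3 : 0 <= c * (1 - c) by rewrite mulr_ge0.
have h4 : 0 <= c ^+ 2 * (1 - c) by rewrite mulr_ge0 ?sqr_ge0.
have h5 := sqr_ge0 c.
have WE : W = (1 + 11 * c - 2 * c ^+ 2) / 10 by [].
have W0 : 10^-1 <= W by rewrite WE; lra.
have W1 : W <= 1 by rewrite WE; lra.
split; first by rewrite W0.
have Wl : (1 + 9 * c) / 10 <= W by rewrite WE; lra.
have Wc : W - c = (1 - c) * (1 + 2 * c) / 10 by rewrite WE; lra.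
move: W WE W0 W1 Wl Wc => W _ W0 W1 Wl Wc.
have Wp : 0 <= W by lra.
have W2 : W ^+ 2 <= W by rewrite expr2 ler_piMl.
have cW : c * W <= 1 by rewrite mulr_ile1.
have D0 : 0 <= 10 + 5 * c - 4 * c ^+ 2 by lra.
have key : (1 + W ^+ 2) * (1 + 2 * c) <= (1 + c) * (11 - 4 * c) * W.
  apply: (@le_trans _ _ ((1 + W) * (1 + 2 * c))); first by rewrite ler_wpM2r//; lra.
  have := ler_wpM2r D0 Wl.
  by move: h3 h4 h5; lra.
(* The bracket is c - W plus the nonnegative term b W (1 - c W). Dropping the latter removes [b]
   from the right-hand side, and on the left [b] has the favourable sign. *)
have r1 : (1 + W ^+ 2) * (c - W) <= (1 + W ^+ 2) * (c * (1 - b * W ^+ 2) + (b - 1) * W).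
  rewrite ler_wpM2l//; first by have := sqr_ge0 W; lra.
  have -> : c * (1 - b * W ^+ 2) + (b - 1) * W = c - W + b * W * (1 - c * W) by lra.
  by rewrite lerDl mulr_ge0 ?subr_ge0// mulr_ge0// ltW.
apply: le_trans r1.
have p0 : 0 <= (1 - c) * ((1 + c) * (11 - 4 * c) * W) by rewrite !mulr_ge0//; lra.
have p1 : 0 <= b * W ^+ 2 by rewrite mulr_ge0 ?sqr_ge0// ltW.
have p2 := mulr_ge0 p0 p1.
have p3 := ler_wpM2l c1' key.
have -> : c - W = - ((1 - c) * (1 + 2 * c) / 10) by rewrite -Wc; lra.
by move: p2 p3; lra.
Qed.

Let clamp_ge (m M a u : R) : m <= a <= M -> a <= u -> a <= clamp m M u.
Proof.
move=> ab au; rewrite -[leLHS](clamp_id ab).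
by have /andP[+ _] := @clamp_lip m M _ _ au; rewrite subr_ge0.
Qed.

Let clamp_le (m M a u : R) : m <= a <= M -> u <= a -> clamp m M u <= a.
Proof.
move=> ab au; rewrite -[leRHS](clamp_id ab).
by have /andP[+ _] := @clamp_lip m M _ _ au; rewrite subr_ge0.
Qed.

Let profile_bounds b (m M : R) (cl q : R -> R) : 0 < b ->
  (b < 1 /\ m = 10^-1 /\ M = 1) \/ (1 <= b /\ m = 1 /\ M = 1 + b) ->
  (forall u, m <= cl u <= M) ->
  (forall a u, m <= a <= M -> a <= u -> a <= cl u) ->
  (forall a u, m <= a <= M -> u <= a -> cl u <= a) ->
  continuous q -> q 0 = 1 ->
  (forall z, 0 < z < 1 ->
    is_derive z 1 q (slope b (1 - z) (cl (q z)) / (z * (2 - z)))) ->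
  [/\ (forall z, 0 <= z <= 1 -> m <= q z <= M),
      (b <= 1 -> forall z, 0 <= z <= 1 -> q z <= 1) &
      (1 <= b -> forall z, 0 <= z <= 1 -> 1 <= q z)].
Proof.
move=> b0 mM clb clge clle qc q00 derq.
have h10 : 0 < (10^-1 : R) <= 1 by rewrite invr_gt0 ltr0n/= invf_le1// ler1n.
have ib : 0 < (1 + b)^-1 <= 1 by rewrite invr_gt0 invf_le1; lra.
have m1M : m <= 1 <= M by case: mM => [[? [-> ->]]|[? [-> ->]]]; lra.
have dec c u v : 0 <= c <= 1 -> m <= u <= M -> m <= v <= M -> u <= v ->
    slope b c v <= slope b c u.
  move=> c01 um vm uv; apply: slope_decreasing => //.
  by case: mM um vm => [[b1 [-> ->]]|[b1 [-> ->]]] um vm; [left|right]; lra.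
have zz z : 0 < z < 1 -> 0 < z * (2 - z) by move=> ?; rewrite mulr_gt0; lra.
have c01 z : 0 < z < 1 -> 0 <= 1 - z <= 1 by lra.
have cq1 (a : R) : continuous (fun z => q z - a).
  by move=> z; apply: (@cvgB _ R); [exact: qc|exact: cvg_cst].
have upper1 : b <= 1 -> forall z, 0 <= z <= 1 -> q z <= 1.
  move=> b1 z z01; rewrite -subr_le0.
  apply: (@nonpos_of_derive_le0 (fun z => q z - 1) _ _ _ (fun z zz => is_derive_funB (derq z zz) (is_derive_cst (1 : R) z 1))) => //.
    by rewrite q00 subrr.
  move=> x x01 qx; rewrite subr0 pmulr_lle0 ?invr_gt0 ?zz//.
  apply: (@le_trans _ _ (slope b (1 - x) 1)).
    by apply: (dec _ _ _ (c01 _ x01) m1M (clb _)); apply: clge => //; lra.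
  rewrite slope1// mulr_ge0_le0//; first by lra.
  by rewrite pmulr_lle0; lra.
have lower1 : 1 <= b -> forall z, 0 <= z <= 1 -> 1 <= q z.
  move=> b1 z z01; rewrite -subr_le0.
  have cf : continuous (fun z => 1 - q z).
    by move=> x; apply: (@cvgB _ R); [exact: cvg_cst|exact: qc].
  apply: (@nonpos_of_derive_le0 (fun z => 1 - q z) _ cf _ (fun z zz => is_derive_funB (is_derive_cst (1 : R) z 1) (derq z zz))) => //.
    by rewrite q00 subrr.
  move=> x x01 qx; rewrite sub0r oppr_le0 divr_ge0 ?(ltW (zz _ _))//.
  have -> : cl (q x) = 1.
    have m1 : m = 1 by case: mM => [[b1' _]|[_ []]]//; lra.
    have /andP[+ _] := clb (q x); rewrite m1 => cl1.
    by apply/le_anti; rewrite cl1 clle//; lra.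
  rewrite slope1// mulr_ge0//; first by lra.
  by rewrite divr_ge0//; lra.
have bounds z : 0 <= z <= 1 -> m <= q z <= M.
  have [b1|b1] := ltP b 1.
    move=> z01; have [mE ME] : m = 10^-1 /\ M = 1 by case: mM => [[_ []]|[b1' _]]//; lra.
    rewrite ME (upper1 (ltW b1))// andbT mE.
    pose bar z : R := - 1 * z + 1 + 10^-1 * (z * (- 2 * z + 3)).
    pose dbar z : R := - 1 + 10^-1 * (3 - 4 * z).
    have dbarE (x : R) : is_derive x 1 bar (dbar x).
      have d1 := is_derive_affine (- 1) 1 x; have d2 := is_derive_affine (- 2) 3 x.
      have := is_derive_funD d1 (is_derive_funM (is_derive_cst (10^-1 : R) x 1) (is_derive_funM (is_derive_id x 1) d2)).
      move=> H; apply: (is_derive_eqr H).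
      by rewrite /dbar /=; lra.
    have cbar : continuous (fun z => bar z - q z).
      by move=> x; apply: (@cvgB _ R); [exact: is_derive_continuous (dbarE x)|exact: qc].
    have barE x : bar x = (1 + 11 * (1 - x) - 2 * (1 - x) ^+ 2) / 10 by rewrite /bar; lra.
    have : bar z - q z <= 0.
      apply: (@nonpos_of_derive_le0 (fun z => bar z - q z) _ cbar _ (fun z zz => is_derive_funB (dbarE z) (derq z zz))) => //.
        by rewrite q00 /bar; lra.
      move=> x x01 qx; rewrite subr_le0 ler_pdivlMr ?zz//.
      have [] := subsolution b0 (c01 _ x01); rewrite -barE => barb key.
      apply: (@le_trans _ _ (slope b (1 - x) (bar x))); last first.
        have barb' : m <= bar x <= M by rewrite mE ME.
        by apply: (dec _ _ _ (c01 _ x01) (clb _) barb'); apply: clle => //; lra.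
      have bar0 : 0 < bar x by lra.
      rewrite -(ler_pM2r bar0) slopeM ?gt_eqF// /slope_num ler_pdivlMr ?den_gt0//.
      apply: le_trans key; rewrite le_eqVlt; apply/orP; left; apply/eqP.
      by rewrite /dbar; move: (bar x) => W; lra.
    have [] := @subsolution b (1 - z) b0 (_ : 0 <= 1 - z <= 1); first by lra.
    rewrite -barE => /andP[+ _] _.
    by lra.
  move=> z01; have [mE ME] : m = 1 /\ M = 1 + b by case: mM => [[b1' _]|[_ []]]//; lra.
  rewrite mE lower1//= ME.
  have cf : continuous (fun z => q z - (b * z + 1)).
    move=> x; apply: (@cvgB _ R); first exact: qc.
    exact: is_derive_continuous (is_derive_affine b 1 x).
  have : q z - (b * z + 1) <= 0.
    apply: (@nonpos_of_derive_le0 (fun z => q z - (b * z + 1)) _ cf _ (fun z zz => is_derive_funB (derq z zz) (is_derive_affine b 1 z))) => //.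
      by rewrite q00; lra.
    move=> x x01 qx; rewrite subr_le0 ler_pdivrMr ?zz//.
    set W := b * x + 1 in qx *.
    have [x0 x1] : 0 <= x /\ x <= 1 by lra.
    have bx : 0 <= b * x <= b by rewrite mulr_ge0 ?ler_piMr ?(ltW b0).
    have Wb : 1 <= W <= 1 + b by rewrite /W; lra.
    apply: (@le_trans _ _ (slope b (1 - x) W)).
      have Wb' : m <= W <= M by rewrite mE ME.
      by apply: (dec _ _ _ (c01 _ x01) Wb' (clb _)); apply: clge => //; lra.
    have W0 : 0 < W by lra.
    rewrite -(ler_pM2r W0) slopeM ?gt_eqF// /slope_num ler_pdivrMr ?den_gt0//.
    have -> : (1 - x) * (1 - b * W ^+ 2) + (b - 1) * W =
      x * (- b - 1 + b * W * (1 - b * (1 - x))) by rewrite /W; lra.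
    have r1 : - b - 1 + b * W * (1 - b * (1 - x)) <= b * W.
      have : 0 <= b * W * (b * (1 - x)) by rewrite !mulr_ge0 ?subr_ge0 ?(ltW b0) ?(ltW W0).
      lra.
    apply: (@le_trans _ _ ((1 + W ^+ 2) * (x * (b * W)))).
      by rewrite ler_wpM2l ?addr_ge0 ?sqr_ge0// ler_wpM2l.
    have W2 : 1 + W ^+ 2 <= (2 - x) * (1 + b * W ^+ 2).
      have h1 : W ^+ 2 <= b * W ^+ 2 by rewrite ler_peMl ?sqr_ge0.
      have h2 : 1 + b * W ^+ 2 <= (2 - x) * (1 + b * W ^+ 2).
        by rewrite ler_peMl ?(ltW (den_gt0 _ b0))//; lra.
      by lra.
    have : (1 + W ^+ 2) * (x * (b * W)) <= (2 - x) * (1 + b * W ^+ 2) * (x * (b * W)).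
      by rewrite ler_wpM2r// !mulr_ge0 ?(ltW b0) ?(ltW W0).
    lra.
  have : b * z <= b by rewrite ler_piMr; lra.
  lra.
by split.
Qed.

(** Two functions agreeing on [0, 1] are exported: q is differentiable up to and including z = 1,
    the value that corresponds to the angle pi/2, while [qh] is bounded away from 0 on the whole
    line, so that quotients by it are continuous everywhere. *)
Lemma profile_exists b : 0 < b -> exists (q qh : R -> R) (m M C : R),
  [/\ [/\ 0 < m, continuous qh, (forall z, m <= qh z <= M) &
        (forall z, 0 <= z -> `|qh z - 1| <= C * z)],
      [/\ (forall z, 0 <= z <= 1 -> qh z = q z), continuous q &
          (forall z, 0 < z <= 1 ->
            is_derive z 1 q (slope b (1 - z) (q z) / (z * (2 - z))))] &
      (b = 1 -> forall z, 0 <= z <= 1 -> q z = 1)].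
Proof.
move=> b0.
pose m : R := if b < 1 then 10^-1 else 1.
pose M : R := if b < 1 then 1 else 1 + b.
have h10 : 0 < (10^-1 : R) <= 1 by rewrite invr_gt0 ltr0n/= invf_le1// ler1n.
have [m0 m10] : 0 < m /\ 10^-1 <= m by rewrite /m; case: ifPn => _; lra.
have m1M : m <= 1 <= M by rewrite /m /M; case: ifPn => _; lra.
have mM : m <= M by lra.
have cases u v : m <= u <= M -> m <= v <= M ->
    (b < 1 /\ M = 1) \/ (1 <= b /\ 1 <= u /\ 1 <= v).
  by rewrite /m /M; case: ltP => b1; [left|right]; lra.
(* Clamping q makes the right-hand side Lipschitz; the solution of the clamped
   equation is then seen to stay in [m, M] on [0, 1]. *)
pose cp z := Num.max (1 - z) 0.
pose w z := Num.max (2 - z) 1.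
(* The truncations of 1 - z and 2 - z change nothing on [0, 1] and extend the equation to all z >=
   0; the point z = 1 becomes interior, and q gets a two-sided derivative there. *)
pose Psi z q := slope b (cp z) (clamp m M q) / w z.
have cp01 z : 0 <= z -> 0 <= cp z <= 1.
  by move=> z0; rewrite /cp le_max lexx orbT ge_max; lra.
have w1 z : 1 <= w z by rewrite /w le_max lexx orbT.
pose K0 := 101 + 2 * (1 + b) + (b - 1) ^+ 2 * (2 * M).
have K00 : 0 <= K0 by rewrite /K0; have := sqr_ge0 (b - 1); nra.
pose k := Num.bound K0.
have K0k : K0 <= k.+1%:R.
  by rewrite (le_trans (ltW (archi_boundP K00)))// ler_nat.
have cl c := clamp_bounds c mM.
have Psi_lip z u v : 0 <= z -> u <= v -> 0 <= Psi z u - Psi z v <= k.+1%:R * (v - u).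
  move=> z0 uv; rewrite /Psi -mulrBl.
  have [lu lv] := (cl u, cl v).
  have /andP[c1 c2] := @clamp_lip m M _ _ uv.
  have pu : 0 < clamp m M u by lra.
  have pv : 0 < clamp m M v by lra.
  have lu' : 10^-1 <= clamp m M u <= M by lra.
  have lv' : 10^-1 <= clamp m M v <= M by lra.
  have /andP[k1 k2] := kap_bounds b0 (cp01 _ z0) lu' lv' (cases _ _ lu lv).
  rewrite slopeB//; have wz := w1 z; have w0 : 0 < w z by lra.
  apply/andP; split; first by rewrite divr_ge0 ?mulr_ge0// ltW.
  rewrite ler_pdivrMr//; set kk := kap _ _ _ _ in k1 k2 *.
  have h1 : (clamp m M v - clamp m M u) * kk <= (v - u) * k.+1%:R.
    by rewrite ler_pM// (le_trans k2).
  apply: (le_trans h1); rewrite mulrC ler_peMr// mulr_ge0 ?subr_ge0//.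
have ccl (u : R -> R) : continuous u -> continuous (fun z => clamp m M (u z)).
  move=> uc; apply: continuous_maxr; first exact: cst_continuous.
  by apply: continuous_minr => //; exact: cst_continuous.
have csub (a : R) : continuous (fun z : R => a - z).
  by move=> z; apply: (@cvgB _ R); [exact: cvg_cst|exact: cvg_id].
have cw : continuous w by apply: continuous_maxr; [exact: csub|exact: cst_continuous].
have cPsi (u : R -> R) : continuous u -> continuous (fun z => Psi z (u z)).
  move=> uc z; apply: cvgM.
    apply: (@continuous_slope b cp (fun z => clamp m M (u z))) => //.
    - by move=> x; have := cl (u x); lra.
    - by apply: continuous_maxr; [exact: csub|exact: cst_continuous].
    - exact: ccl.
  apply: cvgV; first by rewrite gt_eqF//; have := w1 z; lra.
  exact: cw.
have ib : 0 < (1 + b)^-1 <= 1 by rewrite invr_gt0 invf_le1; lra.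
(* By [slope1] the right-hand side at q = 1 is O(z), the compatibility condition at the singular
   point. *)
pose C := 2 * (1 + b).
have Psi0 z : 0 <= z -> `|Psi z 1| <= C * z.
  move=> z0; rewrite /Psi clamp_id; last by lra.
  have wz := w1 z; have w0 : 0 < w z by lra.
  rewrite normrM normfV (gtr0_norm w0) ler_pdivrMr// slope1//.
  have cz : 0 <= 1 - cp z <= z by rewrite /cp /Num.max; case: ifPn; rewrite -?leNgt; lra.
  apply: (@le_trans _ _ (C * z)); last by rewrite ler_peMr// mulr_ge0// /C; lra.
  rewrite normrM (ger0_norm (_ : 0 <= 2 * (1 - cp z))); last by lra.
  have : `|(b - 1) / (1 + b)| <= 1 + b.
    rewrite normrM normfV (gtr0_norm (_ : 0 < 1 + b)); last by lra.
    rewrite ler_pdivrMr; last by lra.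
    by rewrite ler_norml; nra.
  by have := normr_ge0 ((b - 1) / (1 + b)); rewrite /C; nra.
have C0 : 0 <= C by rewrite /C; lra.
have [q [C' [qc q0 qC dq]]] := @fuchsian_ode_solution R Psi k C 1 C0 cPsi Psi0 Psi_lip.
have q00 : q 0 = 1 by exact: q0.
have derq z : 0 < z < 1 -> is_derive z 1 q (slope b (1 - z) (clamp m M (q z)) / (z * (2 - z))).
  move=> /andP[z0 z1]; apply: is_derive_eqr (dq z z0) _.
  rewrite /Psi /cp /w !max_l; [|lra|lra].
  by rewrite -mulrA -invfM [z * _]mulrC.
have mMc : (b < 1 /\ m = 10^-1 /\ M = 1) \/ (1 <= b /\ m = 1 /\ M = 1 + b).
  by rewrite /m /M; case: ltP; [left|right].
have [bounds upper1 lower1] := profile_bounds b0 mMc cl (@clamp_ge m M) (@clamp_le m M) qc q00 derq.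
clear derq Psi0 Psi_lip cPsi K00 K0k cp01 cases mMc.
exists q, (fun z => clamp m M (q z)), m, M, C'; split.
- split => //; first exact: ccl.
  move=> z z0; apply: le_trans (qC z z0).
  have [q1|/ltW q1] := leP 1 (q z).
    have := @clamp_lip m M _ _ q1; rewrite (@clamp_id m M 1); last by lra.
    by move=> H; rewrite !ger0_norm; lra.
  have := @clamp_lip m M _ _ q1; rewrite (@clamp_id m M 1); last by lra.
  by move=> H; rewrite ![`|_ - 1|]distrC !ger0_norm; lra.
- split => //; first by move=> z z01; rewrite clamp_id// bounds.
  move=> z /andP[z0 z1]; apply: is_derive_eqr (dq z z0) _.
  rewrite /Psi clamp_id; last by rewrite bounds// z1 ltW.
  rewrite /cp /w !max_l; [|lra|lra].
  by rewrite -mulrA -invfM [z * _]mulrC.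
- move=> b1 z z01; apply/eqP; rewrite eq_le upper1 ?lower1//; lra.
Qed.

End profile.

(** * The minimizer *)

Section scaling_function.
Context {R : realType}.
Implicit Types (x y z r t l : R).
Variables (qh : R -> R) (m M C : R).
Hypothesis m0 : 0 < m.
Hypothesis cqh : continuous qh.
Hypothesis qhb : forall z, m <= qh z <= M.
Hypothesis qh1 : forall z, 0 <= z -> `|qh z - 1| <= C * z.

Let w z := Num.max (2 - z) 1.

Let w1 z : 1 <= w z.
Proof. by rewrite /w le_max lexx orbT. Qed.

Let cw : continuous w.
Proof.
apply: continuous_maxr; last exact: cst_continuous.
by move=> z; apply: (@cvgB _ R); [exact: cvg_cst|exact: cvg_id].
Qed.

Let wq_gt0 z : 0 < w z * qh z.
Proof.
have /andP[h _] := qhb z; apply: mulr_gt0; last exact: lt_le_trans h.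
exact: lt_le_trans (w1 z).
Qed.

(* F satisfies z (2 - z) q F' = 2 F on [0, 1], so that F (1 - cos h) / r^2 is
   constant along the solutions of r h' = q(1 - cos h) sin h. *)
Lemma scaling_function_exists : exists F F1 L : R -> R, exists B : R,
  [/\ continuous F1, continuous L, (forall z, F z = z * expR (L z)),
      (forall z, 0 <= z -> `|L z| <= B * z) &
      (forall z, 0 < z -> is_derive z 1 F (F1 z)) /\
      (forall z, F1 z = expR (L z) * (2 / (w z * qh z)))].
Proof.
(* Writing F = z exp L divides out the zero of F: L satisfies z L' = N z with N 0 = 0, since q(0) =
   1, and the right-hand side does not involve L. In the model case q = 1 this gives F = 2 z / (2 -
   z), that is 2 tan^2 (h / 2). *)
pose N z := 2 / (w z * qh z) - 1.
have cN : continuous N.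
  move=> z; apply: (@cvgB _ R); last exact: cvg_cst.
  apply: cvgM; first exact: cvg_cst.
  apply: cvgV; first by rewrite gt_eqF.
  by apply: cvgM; [exact: cw|exact: cqh].
have C0 : 0 <= C by have := qh1 ler01; rewrite mulr1; apply: le_trans.
pose B := (1 + 2 * C) / m.
have B0 : 0 <= B by rewrite divr_ge0 ?(ltW m0)//; lra.
have NB z : 0 <= z -> `|N z| <= B * z.
  move=> z0; have wz := w1 z; have /andP[mq _] := qhb z; have q1 := qh1 z0.
  have W0 := wq_gt0 z.
  have -> : N z = (2 - w z * qh z) / (w z * qh z) by rewrite /N mulrBl mulfV ?gt_eqF.
  rewrite normrM normfV (gtr0_norm W0) ler_pdivrMr//.
  have [/andP[w20 w2z] w2] : 0 <= 2 - w z <= z /\ w z <= 2.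
    by rewrite /w /Num.max; case: ifPn; rewrite -?leNgt; lra.
  have n1 : `|2 - w z * qh z| <= (1 + 2 * C) * z.
    have -> : 2 - w z * qh z = (2 - w z) - w z * (qh z - 1) by lra.
    have w0 : 0 <= w z by lra.
    rewrite (le_trans (ler_normB _ _))// normrM (ger0_norm w20) (ger0_norm w0).
    have := ler_pM w0 (normr_ge0 _) w2 q1; lra.
  apply: (le_trans n1).
  have -> : B * z * (w z * qh z) = ((1 + 2 * C) * z) * (w z * (qh z / m)).
    by rewrite /B; move: (m^-1) => i; lra.
  rewrite ler_peMr//; first by rewrite mulr_ge0//; lra.
  have : 1 <= qh z / m by rewrite ler_pdivlMr// mul1r.
  by nra.
have Nlip z (a b : R) : 0 <= z -> a <= b -> 0 <= N z - N z <= 1%:R * (b - a).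
  by move=> z0 ab; rewrite subrr lexx mul1r subr_ge0.
have [L [B' [cL L0 LB dL]]] := @fuchsian_ode_solution R (fun z _ => N z) 0 B 0 B0
  (fun u _ => cN) NB Nlip.
exists (fun z => z * expR (L z)), (fun z => expR (L z) * (2 / (w z * qh z))), L, B'.
have cE : continuous (fun z => expR (L z)).
  by move=> z; apply: (continuous_comp (cL z)); exact: continuous_expR.
split=> //.
- move=> z; apply: cvgM; first exact: cE.
  apply: cvgM; first exact: cvg_cst.
  apply: cvgV; first by rewrite gt_eqF.
  by apply: cvgM; [exact: cw|exact: cqh].
- by move=> z z0; have := LB z z0; rewrite subr0.
split=> // z z0.
apply: is_derive_eqr (is_derive_funM (is_derive_id z 1)
  (is_derive_funcomp (is_derive_expR _) (dL z z0))) _.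
rewrite /= mul1r mulrCA [z * _]mulrC divfK ?gt_eqF// /N.
by move: (expR _) (2 / _) => E d; lra.
Qed.

End scaling_function.

Section minimizer.
Context {R : realType}.
Implicit Types (x y z r t : R).

Lemma cos_lt1 y : 0 < y <= pi -> cos y < 1.
Proof. by move=> /andP[y0 ypi]; rewrite -cos0 ltr_cos// in_itv /= ?(ltW y0) ?lexx ?pi_ge0. Qed.

Lemma sin_sqrE y : sin y ^+ 2 = (1 - cos y) * (2 - (1 - cos y)).
Proof. have := cos2Dsin2 y; lra. Qed.

Lemma minimizer_exists (b l : R) : 0 < b -> 0 < l <= pi / 2 ->
  exists q F F1 h dh : R -> R, exists B : R,
  [/\ [/\ (forall z, 0 <= z <= 1 -> 0 < q z), continuous q,
          (forall z, 0 < z <= 1 ->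
             is_derive z 1 q (slope b (1 - z) (q z) / (z * (2 - z)))) &
          (b = 1 -> forall z, 0 <= z <= 1 -> q z = 1)],
      [/\ continuous F, continuous F1,
          (forall z, 0 < z <= 1 -> is_derive z 1 F (F1 z)),
          (forall z, 0 <= z <= 1 -> z * (2 - z) * q z * F1 z = 2 * F z) &
          (forall z t, 0 <= z -> z < t -> F z < F t)],
      [/\ h 0 = 0, h 1 = l, (forall r, 0 < r <= 1 -> 0 < h r <= l),
          (forall r, 0 <= r <= 1 -> F (1 - cos (h r)) = F (1 - cos l) * r ^+ 2) &
          (forall r t, 0 <= r -> r < t -> t <= 1 -> h r < h t)] &
      [/\ {within `[0, 1], continuous h},
          (forall r, 0 < r <= 1 -> is_derive r 1 h (dh r) /\
             r * dh r = sin (h r) * q (1 - cos (h r))),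
          (forall r, 0 <= r <= 1 -> is_derive_within `[0, 1] h r (dh r)),
          {within `[0, 1], continuous dh} &
          (forall r, 0 <= r <= 1 -> 0 <= 1 - cos (h r) <= B * r ^+ 2)]].
Proof.
move=> b0 /andP[l0 lpi].
have [q [qh [m [M [C [[m0 cqh qhb qh1] [qhq cq dq] qb1]]]]]] := profile_exists b0.
have [F [F1 [L [B [cF1 cL FE LB [dF F1E]]]]]] := scaling_function_exists m0 cqh qhb qh1.
have pi0 : 0 < pi :> R := pi_gt0 R.
have q0 z : 0 <= z <= 1 -> 0 < q z.
  by move=> z01; rewrite -qhq//; have /andP[h _] := qhb z; exact: lt_le_trans h.
pose w z : R := Num.max (2 - z) 1.
have w0 z : 0 < w z by rewrite /w lt_max ltr01 orbT.
have F10 z : 0 < F1 z.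
  rewrite F1E mulr_gt0 ?expR_gt0// divr_gt0// mulr_gt0 ?w0//.
  by have /andP[h _] := qhb z; exact: lt_le_trans h.
have cF : continuous F.
  move=> z; rewrite (_ : F = fun z => z * expR (L z)); last exact/funext.
  apply: cvgM; first exact: cvg_id.
  by apply: (continuous_comp (cL z)); exact: continuous_expR.
have F0 : F 0 = 0 by rewrite FE mul0r.
have Fmono z t : 0 <= z -> z < t -> F z < F t.
  move=> z0 zt; have [||c _ E] := @MVT_segment R F F1 z t (ltW zt).
  - by move=> x; rewrite in_itv /= => /andP[zx _]; apply: dF; exact: le_lt_trans zx.
  - exact: continuous_subspaceT.
  - by rewrite -subr_gt0 E mulr_gt0// subr_gt0.
pose G y := F (1 - cos y).
have cosb y : 0 <= 1 - cos y by rewrite subr_ge0 cos_le1.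
have Gmono x y : 0 <= x -> x < y -> y <= pi -> G x < G y.
  move=> x0 xy ypi; apply: Fmono => //.
  rewrite ltrD2l ltrN2 ltr_cos// in_itv /=; lra.
have Ginj x y : 0 <= x <= pi -> 0 <= y <= pi -> G x = G y -> x = y.
  move=> /andP[x0 xpi] /andP[y0 ypi] E.
  have [xy|yx|//] := ltgtP x y.
    by have := Gmono _ _ x0 xy ypi; rewrite E ltxx.
  by have := Gmono _ _ y0 yx xpi; rewrite E ltxx.
have cG : continuous G.
  move=> y; apply: (@continuous_comp _ _ _ (fun y => 1 - cos y)); last exact: cF.
  by apply: (@cvgB _ R); [exact: cvg_cst|exact: continuous_cos].
have G0 : G 0 = 0 by rewrite /G cos0 subrr F0.
have dG y : 0 < y < pi -> is_derive y 1 G (F1 (1 - cos y) * sin y).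
  move=> ypi; have d1 := is_derive_funB (is_derive_cst (1 : R) y 1) (is_derive_cos y).
  have z0 : 0 < 1 - cos y.
    by rewrite subr_gt0 cos_lt1//; lra.
  apply: is_derive_eqr (@is_derive_funcomp R F (fun y => 1 - cos y) _ _ _ (dF _ z0) d1) _.
  by rewrite sub0r opprK.
(* The inverse of G is taken on all of [0, pi], although only angles up to l <= pi/2 matter in the
   end: the map h is then defined slightly beyond r = 1 and has a two-sided derivative at 1. *)
pose g t := xget 0 [set y : R | 0 <= y <= pi /\ G y = t].
have gG y : 0 <= y <= pi -> g (G y) = y.
  move=> ypi; rewrite /g; case: xgetP => [x _ [xpi E]|/(_ y) []//].
  exact: Ginj.
have Gg t : 0 <= t <= G pi -> 0 <= g t <= pi /\ G (g t) = t.
  move=> tb; have [|y] := @IVT R G 0 pi t (ltW pi0) (@continuous_subspaceT _ _ _ _ cG).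
    by rewrite G0 min_l ?max_r//; case/andP: tb; exact: le_trans.
  by rewrite in_itv /= => ypi <-; rewrite gG.
have Gl0 : 0 < G l by rewrite -G0; apply: Gmono => //; lra.
have Glpi : G l < G pi by apply: Gmono; lra.
pose h r := g (G l * r ^+ 2).
have argb r : 0 <= r <= 1 -> 0 <= G l * r ^+ 2 <= G l.
  move=> /andP[r0 r1]; rewrite mulr_ge0 ?sqr_ge0 ?(ltW Gl0)//=.
  by rewrite ler_piMr ?(ltW Gl0)// expr_le1.
have hG r : 0 <= r <= 1 -> 0 <= h r <= pi /\ G (h r) = G l * r ^+ 2.
  by move=> /argb rb; apply: Gg; lra.
have h1 : h 1 = l by rewrite /h expr1n mulr1 gG//; lra.
have h0 : h 0 = 0 by rewrite /h expr0n mulr0 -G0 gG//; lra.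
have hmono r t : 0 <= r -> r < t -> t <= 1 -> h r < h t.
  move=> r0 rt t1.
  have [/andP[hr0 hrpi] hr] : 0 <= h r <= pi /\ G (h r) = G l * r ^+ 2 by apply: hG; lra.
  have [/andP[ht0 htpi] ht] : 0 <= h t <= pi /\ G (h t) = G l * t ^+ 2 by apply: hG; lra.
  rewrite ltNge; apply/negP; rewrite le_eqVlt => /predU1P[E|lt].
    have : G l * r ^+ 2 < G l * t ^+ 2 by rewrite ltr_pM2l// ltr_pXn2r ?nnegrE//; lra.
    by rewrite -hr -ht E ltxx.
  have := Gmono _ _ ht0 lt hrpi; rewrite hr ht ltr_pM2l// ltr_pXn2r ?nnegrE//; lra.
have hl r : 0 < r <= 1 -> 0 < h r <= l.
  move=> /andP[r0 r1]; rewrite -{1}h0 hmono//=.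
  move: r1; rewrite le_eqVlt => /predU1P[->|r1]; first by rewrite h1.
  by rewrite -h1 ltW// hmono// ltW.
have cosl y : 0 <= y <= l -> 0 <= 1 - cos y <= 1.
  by move=> yl; rewrite cosb/= lerBlDl lerDr; apply: cos_ge0_pihalf; lra.
have wE z : 0 <= z <= 1 -> w z = 2 - z by move=> z01; rewrite /w max_l//; lra.
have FF1 z : 0 <= z <= 1 -> z * (2 - z) * q z * F1 z = 2 * F z.
  move=> z01; rewrite F1E -/(w z) (wE _ z01) (qhq _ z01) FE.
  have D0 : (2 - z) * q z != 0 by rewrite gt_eqF// mulr_gt0 ?q0//; lra.
  have := divfK D0 2; move: (2 / _) (expR _) => d E dE.
  have -> : z * (2 - z) * q z * (E * d) = z * E * (d * ((2 - z) * q z)) by lra.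
  by rewrite dE; lra.
have dh r : 0 < r <= 1 -> is_derive r 1 h (sin (h r) * q (1 - cos (h r)) / r).
  move=> /andP[r0 r1]; have rb : 0 <= r <= 1 by rewrite r1 ltW.
  have /andP[hr0 hrl] : 0 < h r <= l by apply: hl; rewrite r0.
  have [hrpi hE] := hG r rb.
  have hpi : 0 < h r < pi by lra.
  have sh0 : 0 < sin (h r) by apply: sin_gt0_pi.
  have z01 : 0 <= 1 - cos (h r) <= 1 by apply: cosl; lra.
  have dg : is_derive (G (h r)) 1 g (F1 (1 - cos (h r)) * sin (h r))^-1.
    apply: (@is_derive_inverse R G g); last 1 first.
    - by rewrite gt_eqF// mulr_gt0.
    - near=> y; apply: gG; apply/andP; split; apply: ltW.
        by near: y; apply: lt_nbhsr; case/andP: hpi.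
      by near: y; apply: lt_nbhsl; case/andP: hpi.
    - by near=> y; exact: cG.
    - exact: dG.
  have dr : is_derive r 1 (fun r => G l * r ^+ 2) (G l * (2 * r)).
    apply: is_derive_eqr (is_derive_funM (is_derive_cst (G l) r 1) (is_derive_funX 2 (is_derive_id r 1))) _.
    by rewrite /= expr1 mul0r add0r mulr1.
  rewrite hE in dg.
  apply: is_derive_eqr (@is_derive_funcomp R g (fun r => G l * r ^+ 2) _ _ _ dg dr) _.
  have F1n := F10 (1 - cos (h r)).
  rewrite mulrC; apply: (mulIf (_ : F1 (1 - cos (h r)) * sin (h r) != 0)).
    by rewrite gt_eqF// mulr_gt0.
  rewrite divfK; last by rewrite gt_eqF// mulr_gt0.
  have e1 := FF1 _ z01.
  have e3 : F (1 - cos (h r)) = G l * r ^+ 2 by exact: hE.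
  have rn : r != 0 by rewrite gt_eqF.
  have e4 : (G l * (2 * r)) * r = 2 * F (1 - cos (h r)) by rewrite e3 mulrCA -!mulrA -expr2.
  apply: (mulIf rn); rewrite e4 -e1.
  rewrite -sin_sqrE.
  have e5 := mulVf rn; move: (r^-1) e5 => i e5.
  have -> : sin (h r) * q (1 - cos (h r)) * i * (F1 (1 - cos (h r)) * sin (h r)) * r =
    sin (h r) * q (1 - cos (h r)) * (F1 (1 - cos (h r)) * sin (h r)) * (i * r).
    by rewrite (mulrAC _ i) -[LHS]mulrA.
  by rewrite e5; lra.
have hcos r : 0 <= r <= 1 -> 0 <= 1 - cos (h r) <= 1.
  move=> /andP[]; rewrite le_eqVlt => /predU1P[<- _|r0 r1].
    by rewrite h0 cos0 subrr lexx ler01.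
  by apply: cosl; have : 0 < h r <= l by [apply: hl; rewrite r0|]; lra.
have B0 : 0 <= B by have := LB 1 ler01; rewrite mulr1; apply: le_trans.
pose B' := G l * expR B.
have zB r : 0 <= r <= 1 -> 0 <= 1 - cos (h r) <= B' * r ^+ 2.
  move=> rb; have [_ hE] := hG r rb; have /andP[z0 z1] := hcos r rb.
  have LB0 : 0 <= L (1 - cos (h r)) + B.
    have := ler_wpM2l B0 z1; have := LB _ z0; rewrite ler_norml; lra.
  rewrite z0 /= /B' mulrAC -hE /G FE -mulrA -expRD ler_peMr//.
  by rewrite -[leLHS]expR0 ler_expR.
have ch : {within `[0, 1], continuous h}.
  apply/subspace_continuousP => r; rewrite /= in_itv /= => /andP[].
  rewrite le_eqVlt => /predU1P[<- _|r0 r1]; last first.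
    apply: cvg_within_filter; apply: is_derive_continuous (dh r _).
    by rewrite r0.
  apply/cvgrPdist_lt => e e0; rewrite /from_subspace h0.
  (* Capping by l keeps e' in the range where G increases; then y < G e' / G l forces G (h y) = G l
     y^2 < G e', because y^2 <= y. *)
  pose e' := Num.min e l.
  have e'0 : 0 < e' by rewrite lt_min e0.
  have e'l : e' <= l by rewrite ge_min lexx orbT.
  have Ge' : 0 < G e' by rewrite -G0; apply: Gmono => //; lra.
  have H : \forall y \near (0 : R), `|y| < Num.min 1 (G e' / G l).
    by apply: nbhs0_lt; rewrite lt_min ltr01 divr_gt0.
  have H' : \forall y \near (0 : R), `[0, 1]%classic y -> `|0 - h y| < e.
    apply: filterS H => y; rewrite lt_min => /andP[_ rG].
    rewrite /= in_itv /= => /andP[r0 r1].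
    have [/andP[hr0 hrpi] hE] : 0 <= h y <= pi /\ G (h y) = G l * y ^+ 2 by apply: hG; rewrite r0.
    rewrite sub0r normrN ger0_norm//; apply: (@lt_le_trans _ _ e'); last by rewrite ge_min lexx.
    rewrite ltNge; apply/negP => e'h.
    have : G (h y) < G e'.
      rewrite hE; move: rG; rewrite ger0_norm// ltr_pdivlMr// => rG.
      by apply: le_lt_trans rG; rewrite mulrC ler_wpM2r ?(ltW Gl0)// expr2 ler_piMl.
    rewrite ltNge => /negP; apply; move: e'h; rewrite le_eqVlt => /predU1P[->//|e'h].
    by apply/ltW/Gmono => //; exact: ltW.
  exact: H'.
(* The square of h' in a form regular at 0: (r h')^2 = z (2 - z) q^2, and z = F exp (- L) = G l r^2
   exp (- L), so that r^2 cancels. *)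
pose E z := G l * expR (- L z) * (2 - z) * q z ^+ 2.
have cE : continuous E.
  move=> z; apply: cvgM.
    apply: cvgM; last by apply: (@cvgB _ R); [exact: cvg_cst|exact: cvg_id].
    apply: cvgM; first exact: cvg_cst.
    apply: (@continuous_comp _ _ _ (fun z => - L z)); last exact: continuous_expR.
    exact: cvgN (cL z).
  by apply: (@continuous_comp _ _ _ q (fun x => x ^+ 2)); [exact: cq|exact: exprn_continuous].
pose d r : R := Num.sqrt (E (1 - cos (h r))).
have cd : {within `[0, 1], continuous d}.
  have cpsi : continuous (fun y : R => Num.sqrt (E (1 - cos y)) : R).
    move=> y; apply: (@continuous_comp _ _ _ (fun y => E (1 - cos y))); last exact: sqrt_continuous.
    apply: (@continuous_comp _ _ _ (fun y => 1 - cos y)); last exact: cE.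
    by apply: (@cvgB _ R); [exact: cvg_cst|exact: continuous_cos].
  apply/subspace_continuousP => r r01; move/subspace_continuousP/(_ r r01) : ch => chr.
  exact: (cvg_comp h (fun y : R => Num.sqrt (E (1 - cos y)) : R) chr (cpsi _)).
have dE r : 0 < r <= 1 -> sin (h r) * q (1 - cos (h r)) / r = d r.
  move=> /andP[r0 r1]; have rb : 0 <= r <= 1 by rewrite r1 ltW.
  have [_ hE] := hG r rb; have z01 := hcos r rb.
  have /andP[hr0 hrl] : 0 < h r <= l by apply: hl; rewrite r0.
  have sh0 : 0 < sin (h r) by apply: sin_gt0_pi; lra.
  have p0 : 0 <= sin (h r) * q (1 - cos (h r)) / r.
    by rewrite divr_ge0 ?mulr_ge0 ?(ltW sh0) ?(ltW r0)// ltW// q0.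
  rewrite /d -[LHS]ger0_norm// -sqrtr_sqr; congr Num.sqrt.
  rewrite /E /G in hE *.
  have rn : r ^+ 2 != 0 by rewrite expf_neq0// gt_eqF.
  rewrite exprMn exprVn; apply: (mulIf rn); rewrite divfK// exprMn.
  rewrite sin_sqrE; move: hE; rewrite FE => hE.
  have e3 := expRxMexpNx_1 (L (1 - cos (h r))).
  move: e3 hE; move: (cos (h r)) (q (1 - cos (h r))) (F (1 - cos l)) (expR (- L (1 - cos (h r)))) (expR (L (1 - cos (h r)))) => c u y i x e3 e4.
  have -> : y * i * (2 - (1 - c)) * u ^+ 2 * r ^+ 2 = (y * r ^+ 2) * i * (2 - (1 - c)) * u ^+ 2.
    by rewrite !(mulrAC _ _ (r ^+ 2)).
  rewrite -e4.
  have -> : (1 - c) * x * i * (2 - (1 - c)) * u ^+ 2 = (1 - c) * (x * i) * (2 - (1 - c)) * u ^+ 2.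
    by rewrite (mulrA (1 - c)).
  by rewrite e3 mulr1.
exists q, F, F1, h, d, B'; split; split => //.
- by move=> z /andP[z0 _]; exact: dF.
- by move=> r rb; have [_] := hG r rb.
- move=> r r01; rewrite -dE//; split; first exact: dh.
  by rewrite mulrC divfK// gt_eqF//; case/andP: r01.
- move=> r /andP[]; rewrite le_eqVlt => /predU1P[<- _|r0 r1]; last first.
    by rewrite -dE ?r0//; apply: is_derive_is_derive_within; apply: dh; rewrite r0.
  (* At the end point 0 the mean value theorem converts the continuity of [d] into a one-sided
     derivative. *)
  rewrite /is_derive_within; apply/cvgrPdist_lt => e e0.
  have /subspace_continuousP/(_ 0) := cd.
  rewrite /= in_itv /= lexx ler01 => /(_ isT)/cvgrPdist_lt/(_ _ e0) cd0.
  have {}cd0 : \forall t \near (0 : R), `[0, 1]%classic t -> `|d 0 - d t| < e := cd0.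
  have [del /= del0 cdel] := cd0.
  apply/near_within_dnbhs; near=> y => y0; rewrite /= in_itv /= => /andP[y0' y1].
  have {y0 y0'}y0 : 0 < y by rewrite lt_neqAle eq_sym y0.
  rewrite h0 !subr0.
  have dy (x : R) : x \in `]0, y[%R -> is_derive x 1 h (d x).
    rewrite in_itv /= => /andP[x0 xy]; rewrite -dE; last by lra.
    by apply: dh; lra.
  have cy : {within `[0, y], continuous h}.
    by apply: continuous_subspaceW ch => x /=; rewrite !in_itv /=; lra.
  have [c cy'] := @MVT R h d 0 y y0 dy cy; rewrite h0 !subr0 => ->.
  move: cy'; rewrite in_itv /= => /andP[c0 cy'].
  rewrite mulfK ?gt_eqF//; apply: cdel; last by rewrite /= in_itv /=; lra.
  rewrite /ball_ /= sub0r normrN gtr0_norm//; apply: lt_trans cy' _.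
  by near: y; exact: lt_nbhsl.
Unshelve. all: by end_near. Qed.

End minimizer.

(** * The calibration *)

Section calibration.
Context {R : realType}.
Implicit Types (a b q z t e v x y A B : R).

Let powR_split x (r s u : R) : 0 < x -> u = r + s -> x `^ u = x `^ r * x `^ s.
Proof. by move=> x0 ->; rewrite powRD//; apply/implyP => _; rewrite gt_eqF. Qed.

(** Conjugate exponents b + 1 and (b + 1) / b. *)
Let young a b A B : 0 < b -> a = (b + 1) / 2 -> 0 <= A -> 0 < B ->
  (b + 1) * (A `^ 2^-1 * B `^ (b / 2)) <= A `^ a + b * B `^ a.
Proof.
move=> b0 aE A0 B0; have b1 : 0 < b + 1 by lra.
have bn : b != 0 by rewrite gt_eqF.
have b1n : b + 1 != 0 by rewrite gt_eqF.
have conj : (b + 1)^-1 + ((b + 1) / b)^-1 = 1.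
  by rewrite invf_div -{1}[(b + 1)^-1]mul1r -mulrDl [1 + b]addrC mulfV.
have := conjugate_powR (powR_ge0 A 2^-1) (powR_ge0 B (b / 2)) b1 (divr_gt0 b1 b0) conj.
rewrite -!powRrM [2^-1 * _]mulrC -aE.
have -> : b / 2 * ((b + 1) / b) = a.
  have bb := mulfV bn; rewrite aE; move: (b^-1) bb => i bb.
  have -> : b / 2 * ((b + 1) * i) = (b + 1) / 2 * (b * i) by lra.
  by rewrite bb mulr1.
rewrite invf_div => h; rewrite -(ler_pM2l b1) in h; apply: (le_trans h).
rewrite mulrDr mulrCA mulfV// mulr1 lerD2l.
by rewrite mulrCA [X in B `^ a * X]mulrCA mulfV// mulr1 mulrC.
Qed.

(* With x = e v / t: Cauchy-Schwarz, (1 + q x)^2 <= (1 + q^2) (1 + x^2), followed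
   by Young's inequality; equality forces x = q. *)
Lemma calibration_ineq a b q t e v : 0 < b -> a = (b + 1) / 2 -> 0 < q -> 0 <= t -> e ^+ 2 <= t ->
  let l := t `^ a * (1 + q ^+ 2) `^ (a - 1) * (1 - b * q ^+ 2) +
    (b + 1) * t `^ (a - 1) * q * (1 + q ^+ 2) `^ (a - 1) * (e * v) in
  l <= (v ^+ 2 + t) `^ a /\
  (l = (v ^+ 2 + t) `^ a -> (0 < t -> e * v = t * q) /\ (t = 0 -> v = 0)).
Proof.
move=> b0 aE q0 t0 et; have a_gt0 : 0 < a by lra.
have an : a != 0 by rewrite gt_eqF.
move: t0; rewrite le_eqVlt => /predU1P[tE|t0].
  move: et; rewrite -tE => et l.
  have e0 : e = 0 by apply/eqP; rewrite -sqrf_eq0 eq_le et sqr_ge0.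
  have lE : l = 0 by rewrite /l e0 mul0r mulr0 powR0// !mul0r addr0.
  rewrite lE addr0 powR_ge0; split=> // /esym/eqP; rewrite powR_eq0 => /andP[+ _].
  by rewrite sqrf_eq0 => /eqP ->; split => //; rewrite ltxx.
have tn : t != 0 by rewrite gt_eqF.
pose x := e * v / t; have evE : e * v = t * x by rewrite /x mulrCA mulfV// mulr1.
rewrite evE; set A := 1 + x ^+ 2; set B := 1 + q ^+ 2; set K := B `^ (a - 1).
have A0 : 0 < A by rewrite /A ltr_pwDl// sqr_ge0.
have B0 : 0 < B by rewrite /B ltr_pwDl// sqr_ge0.
have K0 : 0 < K by rewrite powR_gt0.
have ta0 : 0 < t `^ a by rewrite powR_gt0.
have KB : K * B = B `^ a.
  by rewrite /K (@powR_split B (a - 1) 1 a B0) ?powRr1 ?(ltW B0)//; lra.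
have tta : t `^ (a - 1) * t = t `^ a.
  by rewrite (@powR_split t (a - 1) 1 a t0) ?powRr1 ?(ltW t0)//; lra.
have vt : t * A <= v ^+ 2 + t.
  have : t * (x ^+ 2 * t) <= t * v ^+ 2.
    have -> : t * (x ^+ 2 * t) = (e * v) ^+ 2 by rewrite evE; lra.
    by rewrite exprMn ler_wpM2r ?sqr_ge0.
  by rewrite ler_pM2l// /A; lra.
pose sA := A `^ 2^-1; pose sB := B `^ 2^-1.
have sA2 : sA * sA = A.
  by rewrite /sA -[RHS](powRr1 (ltW A0)) (@powR_split A 2^-1 2^-1 1 A0)//; lra.
have sB2 : sB * sB = B.
  by rewrite /sB -[RHS](powRr1 (ltW B0)) (@powR_split B 2^-1 2^-1 1 B0)//; lra.
have sA0 : 0 <= sA := powR_ge0 _ _.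
have sB0 : 0 <= sB := powR_ge0 _ _.
have KsB : K * sB = B `^ (b / 2).
  by rewrite /K /sB -(@powR_split B (a - 1) 2^-1 (b / 2) B0)//; lra.
have cs2 : (sA * sB) ^+ 2 - (1 + q * x) ^+ 2 = (q - x) ^+ 2.
  have -> : (sA * sB) ^+ 2 = (sA * sA) * (sB * sB) by lra.
  by rewrite sA2 sB2 /A /B; lra.
have cs : 1 + q * x <= sA * sB.
  apply: le_trans (ler_norm _) _; rewrite -ler_sqr ?nnegrE ?mulr_ge0//.
  by rewrite real_normK ?num_real// -subr_ge0 cs2 sqr_ge0.
have yng : (b + 1) * (sA * (K * sB)) <= A `^ a + b * (K * B).
  by rewrite KsB KB; exact: (young b0 aE (ltW A0) B0).
have -> : t `^ a * K * (1 - b * q ^+ 2) + (b + 1) * t `^ (a - 1) * q * K * (t * x) =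
    t `^ a * ((b + 1) * (K * (1 + q * x)) - b * (K * B)).
  have -> : (b + 1) * t `^ (a - 1) * q * K * (t * x) =
    (b + 1) * (t `^ (a - 1) * t) * q * K * x by lra.
  by rewrite tta /B; lra.
have s1 : K * (1 + q * x) <= sA * (K * sB) by rewrite [leRHS]mulrCA ler_pM2l.
have s2 : t `^ a * A `^ a <= (v ^+ 2 + t) `^ a.
  rewrite -powRM ?(ltW t0) ?(ltW A0)//; apply: ge0_ler_powR => //; first exact: ltW.
  - by rewrite nnegrE mulr_ge0 ?(ltW t0) ?(ltW A0).
  - by rewrite nnegrE addr_ge0 ?sqr_ge0 ?(ltW t0).
have b1 : 0 < b + 1 by lra.
have s3 : (b + 1) * (K * (1 + q * x)) <= (b + 1) * (sA * (K * sB)) by rewrite ler_pM2l.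
have s4 : (b + 1) * (K * (1 + q * x)) - b * (K * B) <= A `^ a by lra.
split; first by apply: le_trans s2; rewrite ler_pM2l.
move=> E; split => [_|t0']; last by move: t0; rewrite t0' ltxx.
have : A `^ a <= (b + 1) * (K * (1 + q * x)) - b * (K * B).
  by rewrite -(ler_pM2l ta0) E.
move=> h; have : (b + 1) * (sA * (K * sB)) <= (b + 1) * (K * (1 + q * x)) by lra.
rewrite ler_pM2l// mulrCA ler_pM2l// => cs'.
have qx : 1 + q * x = sA * sB by apply/le_anti; rewrite cs cs'.
have : (q - x) ^+ 2 = 0 by rewrite -cs2 -qx subrr.
by move=> /eqP; rewrite sqrf_eq0 subr_eq0 => /eqP <-.
Qed.

(** The velocity v = e q of the field makes both Cauchy-Schwarz and Young equalities; this turns the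
    density of the minimizer into an exact derivative. *)
Lemma calibration_eq a b q t e : 0 < b -> a = (b + 1) / 2 -> 0 < q -> 0 <= t -> e ^+ 2 = t ->
  t `^ a * (1 + q ^+ 2) `^ (a - 1) * (1 - b * q ^+ 2) +
    (b + 1) * t `^ (a - 1) * q * (1 + q ^+ 2) `^ (a - 1) * (e * (e * q)) =
  ((e * q) ^+ 2 + t) `^ a.
Proof.
move=> b0 aE q0 t0 et; have a_gt0 : 0 < a by lra.
have an : a != 0 by rewrite gt_eqF.
have B0 : 0 < 1 + q ^+ 2 by rewrite ltr_pwDl// sqr_ge0.
have -> : e * (e * q) = t * q by rewrite mulrA -expr2 et.
have -> : (e * q) ^+ 2 + t = t * (1 + q ^+ 2) by rewrite exprMn et; lra.
rewrite powRM// ?(ltW B0)//.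
move: t0; rewrite le_eqVlt => /predU1P[<-|t0].
  by rewrite powR0// !mul0r mulr0 addr0.
have tta : t `^ (a - 1) * t = t `^ a.
  by rewrite (@powR_split t (a - 1) 1 a t0) ?powRr1 ?(ltW t0)//; lra.
rewrite (@powR_split (1 + q ^+ 2) (a - 1) 1 a B0); last by lra.
rewrite powRr1 ?(ltW B0)//; set K := _ `^ (a - 1).
have -> : (b + 1) * t `^ (a - 1) * q * K * (t * q) = (b + 1) * (t `^ (a - 1) * t) * q * K * q by lra.
by rewrite tta; lra.
Qed.

(** The last two formulas are the Hamilton-Jacobi prescriptions, with 1 - b = 2 - p. The bound on W
    by t^a compares the boundary term at 0 with the energy density, and the bound on W' has the form
    accepted by [folded_chain_rule]. *)
Lemma calibration_exists a b (q : R -> R) : 0 < b -> a = (b + 1) / 2 -> (forall z, 0 <= z <= 1 -> 0 < q z) -> continuous q ->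
  (forall z, 0 < z <= 1 ->
    is_derive z 1 q (slope b (1 - z) (q z) / (z * (2 - z)))) ->
  (b = 1 -> forall z, 0 <= z <= 1 -> q z = 1) ->
  exists W W' : R -> R, exists C : R,
  [/\ 0 <= C,
      {within `[0, 1], continuous W},
      (forall z, 0 < z < 1 -> [/\ is_derive z 1 W (W' z), {for z, continuous W'} &
         `|W' z| <= C / Num.sqrt z]),
      (forall z, 0 <= z <= 1 -> `|W z| <= C * (z * (2 - z)) `^ a) &
      (forall z, W' z = (b + 1) * (z * (2 - z)) `^ (a - 1) * q z * (1 + q z ^+ 2) `^ (a - 1)) /\
      (forall z, 0 <= z <= 1 -> (1 - b) * W z =
         (z * (2 - z)) `^ a * (1 + q z ^+ 2) `^ (a - 1) * (1 - b * q z ^+ 2))].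
Proof.
move=> b0 aE q0 cq dq qb1; have a_gt0 : 0 < a by lra.
pose t z := z * (2 - z).
have tpos z : 0 < z < 1 -> 0 < t z by move=> ?; rewrite /t mulr_gt0; lra.
have t01 z : 0 <= z <= 1 -> 0 <= t z <= 1.
  move=> z01; rewrite /t mulr_ge0/=; [|lra|lra].
  by have := sqr_ge0 (1 - z); lra.
have zt z : 0 <= z <= 1 -> z <= t z by move=> z01; rewrite /t ler_peMr; lra.
have dt z : is_derive z 1 t (2 * (1 - z)).
  have -> : t = fun z => z * (- 1 * z + 2) by apply/funext => y; rewrite /t; lra.
  by apply: is_derive_eqr (is_derive_funM (is_derive_id z 1) (is_derive_affine (- 1) 2 z)) _; lra.
pose k z := (b + 1) * q z * (1 + q z ^+ 2) `^ (a - 1).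
pose W' z := (b + 1) * (t z) `^ (a - 1) * q z * (1 + q z ^+ 2) `^ (a - 1).
have W'k z : W' z = (t z) `^ (a - 1) * k z by rewrite /W' /k; lra.
have B0 z : 0 < 1 + q z ^+ 2 by rewrite ltr_pwDl// sqr_ge0.
have cpow (f : R -> R) (r : R) z : {for z, continuous f} -> 0 < f z ->
    {for z, continuous (fun z => f z `^ r)}.
  move=> fc fz; apply: (cvg_comp f (fun y : R => y `^ r) fc).
  exact: is_derive_continuous (is_derive1_powR r fz).
have cB : continuous (fun z => 1 + q z ^+ 2).
  move=> z; apply: (@cvgD _ R); first exact: cvg_cst.
  by apply: (@continuous_comp _ _ _ q (fun x => x ^+ 2)); [exact: cq|exact: exprn_continuous].
have ck : continuous k.
  move=> z; apply: cvgM.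
    by apply: cvgM; [exact: cvg_cst|exact: cq].
  by apply: (cpow (fun z => 1 + q z ^+ 2)); [exact: cB|exact: B0].
have [C1 C10 kC] : exists2 C, 0 <= C & forall z, 0 <= z <= 1 -> `|k z| <= C.
  by apply: within_itv_bounded; [exact: ler01|exact: continuous_subspaceT].
(* As b > 0 gives a > 1/2 and z <= t <= 1, one has t^(a-1) <= t^(-1/2) <= z^(-1/2). *)
have a1 : - 2^-1 <= a - 1 by lra.
have tpow z : 0 < z < 1 -> (t z) `^ (a - 1) <= (Num.sqrt z)^-1.
  move=> z01; have tz := tpos z z01; have tb : 0 < t z <= 1.
    by rewrite tz; have /t01/andP[] : 0 <= z <= 1 by lra.
  apply: (@le_trans _ _ (t z `^ (- 2^-1))); first exact: ger_powR.
  have z0 : 0 < z by lra.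
  rewrite powRN powR12_sqrt ?(ltW tz)// lef_pV2 ?posrE ?sqrtr_gt0//.
  by rewrite ler_wsqrtr// zt//; lra.
have cW' z : 0 < z < 1 -> {for z, continuous W'}.
  move=> z01; rewrite (_ : W' = fun z => (t z) `^ (a - 1) * k z); last exact/funext.
  apply: cvgM; last exact: ck.
  by apply: (cpow t); [exact: is_derive_continuous (dt z)|exact: tpos].
have W'C z C : C1 <= C -> 0 < z < 1 -> `|W' z| <= C / Num.sqrt z.
  move=> CC z01; rewrite W'k normrM mulrC ler_pM//.
    by apply: (le_trans (kC _ _)) => //; lra.
  by rewrite ger0_norm ?powR_ge0// tpow.
have ct : continuous t by move=> z; exact: is_derive_continuous (dt z).
have cW (W : R -> R) (C : R) : 0 <= C -> (forall z, 0 <= z <= 1 -> `|W z| <= C * t z `^ a) ->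
    (forall z, 0 < z <= 1 -> {for z, continuous W}) -> {within `[0, 1], continuous W}.
  move=> C0 WC Wc; apply/subspace_continuousP => z; rewrite /= in_itv /= => /andP[].
  rewrite le_eqVlt => /predU1P[<- _|z0 z1]; last by apply: cvg_within_filter; apply: Wc; rewrite z0.
  have W0 : W 0 = 0.
    have := WC 0; rewrite lexx ler01 /t mul0r powR0 ?mulr0 ?gt_eqF// => /(_ isT).
    by rewrite normr_le0 => /eqP.
  have st : Num.sqrt (t z) @[z --> (0 : R)] --> Num.sqrt (t 0).
    by apply: (continuous_comp (ct 0)); exact: sqrt_continuous.
  rewrite /from_subspace W0; apply/cvgrPdist_lt => e e0.
  have C1' : 0 < C + 1 by lra.
  have /cvgrPdist_lt/(_ _ (divr_gt0 e0 C1')) H := st.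
  have H' : \forall z \near (0 : R), `[0, 1]%classic z -> `|0 - W z| < e.
    apply: filterS H => y; rewrite /t mul0r sqrtr0 !sub0r !normrN -/(t y) => yE.
    rewrite /= in_itv /= => y01.
    apply: (le_lt_trans (WC _ y01)).
    have ty : t y `^ a <= Num.sqrt (t y).
      have /andP[ty0 ty1] := t01 _ y01.
      rewrite -powR12_sqrt//; move: ty0; rewrite le_eqVlt => /predU1P[<-|ty0].
        by rewrite !powR0 ?gt_eqF// invr_gt0.
      by apply: ger_powR; [rewrite ty0|lra].
    rewrite ltr_pdivlMr// in yE; rewrite ger0_norm ?sqrtr_ge0// in yE.
    apply: le_lt_trans yE; rewrite mulrC ler_pM ?powR_ge0//; lra.
  exact: H'.
(* For b = 1 the formula for (1 - b) W is void; then q = 1 and W z = 2 z. *)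
have [bE|bn] := eqVneq b 1.
  have q1 := qb1 bE.
  have a1E : a = 1 by rewrite aE bE; lra.
  pose C := C1 + 2; have C0 : 0 <= C by rewrite /C; lra.
  have W0C z : 0 <= z <= 1 -> `|2 * z| <= C * t z `^ a.
    move=> z01; have /andP[t0 _] := t01 z z01; have := zt z z01.
    rewrite a1E powRr1// ger0_norm; last by lra.
    by move=> h; have := mulr_ge0 C10 t0; rewrite /C; lra.
  exists (fun z => 2 * z), W', C; split => //.
  - by apply: (cW _ C) => // z _; apply: cvgM; [exact: cvg_cst|exact: cvg_id].
  - move=> z z01; split; [|exact: cW'|by apply: W'C => //; rewrite /C; lra].
    apply: is_derive_eqr (is_derive_funM (is_derive_cst (2 : R) z 1) (is_derive_id z 1)) _.
    have tz := tpos z z01.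
    by rewrite W'k /k a1E subrr !powRr0 q1 ?bE /=; lra.
  - split => // z z01; rewrite bE subrr mul0r q1// expr1n mulr1 subrr mulr0//.
(* For b different from 1 the last formula defines W; that its derivative is W' is equivalent to the
   equation of the profile. *)
pose c := (1 - b)^-1; have cb : c * (1 - b) = 1 by rewrite mulVf// subr_eq0 eq_sym.
pose W z := t z `^ a * ((1 + q z ^+ 2) `^ (a - 1) * (1 - b * q z ^+ 2)) * c.
pose j z := (1 + q z ^+ 2) `^ (a - 1) * (1 - b * q z ^+ 2) * c.
have cj : continuous j.
  move=> z; apply: cvgM; last exact: cvg_cst.
  apply: cvgM; first by apply: (cpow (fun z => 1 + q z ^+ 2)); [exact: cB|exact: B0].
  apply: (@cvgB _ R); first exact: cvg_cst.
  apply: cvgM; first exact: cvg_cst.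
  by apply: (@continuous_comp _ _ _ q (fun x => x ^+ 2)); [exact: cq|exact: exprn_continuous].
have [C2 C20 jC] : exists2 C, 0 <= C & forall z, 0 <= z <= 1 -> `|j z| <= C.
  by apply: within_itv_bounded; [exact: ler01|exact: continuous_subspaceT].
pose C := C1 + C2; have C0 : 0 <= C by rewrite /C; lra.
have WE z : W z = t z `^ a * j z by rewrite /W /j; lra.
have WC z : 0 <= z <= 1 -> `|W z| <= C * t z `^ a.
  move=> z01; rewrite WE normrM (ger0_norm (powR_ge0 _ _)) mulrC ler_wpM2r ?powR_ge0//.
  by apply: (le_trans (jC _ z01)); rewrite /C; lra.
have dW z : 0 < z < 1 -> is_derive z 1 W (W' z).
  move=> z01; have tz := tpos z z01.
  have z01' : 0 < z <= 1 by lra.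
  have d1 := is_derive_funcomp (is_derive1_powR a tz) (dt z).
  have dB := is_derive_funD (is_derive_cst (1 : R) z 1) (is_derive_funX 2 (dq z z01')).
  have d2 := @is_derive_funcomp R (fun y : R => y `^ (a - 1)) (fun z => 1 + q z ^+ 2) _ _ _ (is_derive1_powR (a - 1) (B0 z)) dB.
  have d3 := is_derive_funB (is_derive_cst (1 : R) z 1) (is_derive_funM (is_derive_cst b z 1) (is_derive_funX 2 (dq z z01'))).
  apply: is_derive_eqr (is_derive_funM (is_derive_funM d1 (is_derive_funM d2 d3)) (is_derive_cst c z 1)) _.
  have qz : 0 < q z by apply: q0; lra.
  have tn : t z != 0 by rewrite gt_eqF.
  have Sq := slopeM (1 - z) b0 (lt0r_neq0 qz).
  have D0 : 0 < 1 + b * q z ^+ 2 by rewrite ltr_pwDl// mulr_ge0 ?sqr_ge0// ltW.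
  have {}Sq : slope b (1 - z) (q z) * q z * (1 + b * q z ^+ 2) =
      (1 + q z ^+ 2) * ((1 - z) * (1 - b * q z ^+ 2) + (b - 1) * q z).
    by rewrite Sq /slope_num divfK// gt_eqF.
  rewrite /= W'k /k expr1.
  have ta : t z `^ a = t z `^ (a - 1) * t z.
    by rewrite (@powR_split (t z) (a - 1) 1 a tz) ?powRr1 ?(ltW tz)//; lra.
  have Ba : (1 + q z ^+ 2) `^ (a - 1) = (1 + q z ^+ 2) `^ (a - 1 - 1) * (1 + q z ^+ 2).
    rewrite (@powR_split (1 + q z ^+ 2) (a - 1 - 1) 1 (a - 1) (B0 z)) ?powRr1 ?(ltW (B0 z))//; lra.
  rewrite ta Ba -/(t z).
  have tinv : (t z)^-1 * t z = 1 by rewrite mulVf.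
  have a2E : 2 * a = b + 1 by lra.
  move: Sq tinv cb.
  move: (q z) (t z) (slope b (1 - z) (q z)) ((1 + q z ^+ 2) `^ (a - 1 - 1)) (t z `^ (a - 1)) ((t z)^-1) => u tt S Q T ti Sq tinv cb'.
  set Bu := 1 + u ^+ 2 in Sq *.
  have E1 : (ti * tt) * S * u = S * u by rewrite tinv mul1r.
  transitivity (T * Q * c * (a * (2 * (1 - z)) * Bu * (1 - b * u ^+ 2) +
    (ti * tt * S * u) * (2 * (a - 1) * (1 - b * u ^+ 2) - 2 * b * Bu))).
    by rewrite /Bu /=; lra.
  rewrite E1.
  (* The bracket is a multiple of 1 + b u^2, the denominator of [slope_num], so the equation of q
     can be substituted free of division. *)
  have -> : 2 * (a - 1) * (1 - b * u ^+ 2) - 2 * b * Bu = - (b + 1) * (1 + b * u ^+ 2).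
    have -> : 2 * (a - 1) = b - 1 by lra.
    by rewrite /Bu; lra.
  have -> : a * (2 * (1 - z)) = (b + 1) * (1 - z) by rewrite -a2E; lra.
  have -> : S * u * (- (b + 1) * (1 + b * u ^+ 2)) = - (b + 1) * (S * u * (1 + b * u ^+ 2)) by lra.
  rewrite Sq.
  transitivity (T * Q * Bu * (b + 1) * u * (c * (1 - b))); first by rewrite /Bu; lra.
  by rewrite cb'; lra.
exists W, W', C; split => //.
- apply: (cW _ C) => // z /andP[z0 z1].
  rewrite (_ : W = fun z => t z `^ a * j z); last exact/funext.
  apply: cvgM; last exact: cj.
  by apply: (cpow t); [exact: ct|rewrite /t mulr_gt0//; lra].
- by move=> z z01; split; [exact: dW|exact: cW'|apply: W'C => //; rewrite /C; lra].
- by split => // z z01; rewrite /W mulrC -!mulrA cb mulr1 mulrA.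
Qed.

End calibration.

(** * Regular competitors *)

Section weak_derivative_regular.
Context {R : realType}.
Implicit Types (a b p r x y : R) (f g h k d : R -> R).
Let mu := @lebesgue_measure R.

Lemma ae_mono (P Q : R -> Prop) : (forall x, P x -> Q x) ->
  (\forall x \ae mu, P x) -> \forall x \ae mu, Q x.
Proof. by move=> PQ; apply: filterS; first exact: (ae_filter_ringOfSetsType mu). Qed.

(** Lebesgue differentiation: the extension of f by 0 is almost everywhere the derivative of its
    primitive, which is constant here. *)
Lemma ae_eq0_of_primitive f a b : a < b -> mu.-integrable `[a, b] (EFin \o f) ->
  (forall x, a <= x <= b -> \int[mu]_(y in `[a, x]) f y = 0) ->
  \forall x \ae mu, a < x < b -> f x = 0.
Proof.
move=> ab fi f0; pose G := f \_ `[a, b].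
have iG : mu.-integrable setT (EFin \o G).
  by rewrite /G -restrict_EFin; apply: (integrable_mkcond _ _).1.
have lG : locally_integrable setT G by apply: open_integrable_locally; [exact: openT|exact: iG].
have iGy y : mu.-integrable [set` Interval (BLeft a) (BRight y)] (EFin \o G).
  by apply: integrableS iG.
apply: ae_mono (FTC1 iGy lG) => x H /andP[ax xb].
have [dx xE] := H ax; pose F y := \int[mu]_(t in `[a, y]) G t.
have dF : is_derive x 1 F (G x) by rewrite -xE derive1E; apply: DeriveDef.
have F0 : \near x, (0 : R) = F x.
  near=> y; have ya : a <= y by apply: ltW; near: y; exact: lt_nbhsr.
  have yb : y <= b by apply: ltW; near: y; exact: lt_nbhsl.
  rewrite -(f0 y) ?ya// /F; apply: eq_Rintegral => t; rewrite inE /= in_itv /= => /andP[at_ ty].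
  by rewrite /G patchE mem_set//= in_itv /= at_ (le_trans ty yb).
have d0 : is_derive x 1 F 0 := near_eq_is_derive F0 (is_derive_cst 0 x 1).
have : G x = 0 by rewrite -[LHS](@derive_val _ _ _ _ _ _ _ dF) (@derive_val _ _ _ _ _ _ _ d0).
by rewrite /G patchE mem_set//= in_itv /= !ltW.
Unshelve. all: by end_near. Qed.

(** [weak_derivative] picks an arbitrary representative; this is what allows the energy of a C^1
    function to be computed with its classical derivative. *)
Lemma weak_derivative_ae_unique h g d : {in `]0, 1[%R, continuous h} ->
  is_weak_derivative `]0, 1[ h g -> is_weak_derivative `]0, 1[ h d ->
  \forall x \ae mu, 0 < x < 1 -> g x = d x.
Proof.
(* The offset 3 keeps [e n] below 1/2, so that the intervals [e n, 1 - e n], which exhaust ]0, 1[,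
   are nondegenerate. *)
move=> hc hg hd; pose e n : R := n.+3%:R^-1.
have e0 n : 0 < e n by rewrite invr_gt0.
have e1 n : e n < 2^-1 by rewrite ltf_pV2 ?posrE// ltr_nat.
have H n : \forall x \ae mu, e n < x < 1 - e n -> g x - d x = 0.
  have ab : e n < 1 - e n by have := e1 n; lra.
  have b1 : 1 - e n < 1 by have := e0 n; lra.
  have [ig _] := weak_derivative_primitive hc hg (e0 n) ab b1.
  have [id_ _] := weak_derivative_primitive hc hd (e0 n) ab b1.
  apply: (@ae_eq0_of_primitive (fun x => g x - d x)) => //; first exact: integrable_funB.
  move=> x /andP[]; rewrite le_eqVlt => /predU1P[<- _|ex xb].
    by rewrite set_itv1 Rintegral_set1.
  have x1 : x < 1 by exact: le_lt_trans b1.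
  have [ig' Eg] := weak_derivative_primitive hc hg (e0 n) ex x1.
  have [id' Ed] := weak_derivative_primitive hc hd (e0 n) ex x1.
  by rewrite RintegralB// -Eg -Ed subrr.
have := ae_foralln H; apply: filterS => x Hx /andP[x0 x1].
have : \forall n \near \oo, e n < Num.min x (1 - x).
  have : @GRing.inv R \o (fun n => n.+3%:R) @ \oo --> (0 : R).
    apply: (@gtr0_cvgV0 _ _ _ _ _ _).2.
      by near=> n; rewrite ltr0n.
    apply/cvgryPge => M; near=> n; rewrite (@le_trans _ _ n%:R)// ?ler_nat//.
      by near: n; exact: nbhs_infty_ger.
    by rewrite -addn3 leq_addr.
  by move=> /cvgr_lt; apply; rewrite lt_min x0 subr_gt0.
move=> [n _ /(_ n (leqnn n))] /=; rewrite lt_min => /andP[nx n1].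
by apply/eqP; rewrite -subr_eq0; apply/eqP; apply: (Hx n); lra.
Unshelve. all: by end_near. Qed.

Lemma compact_integrable_within (K : set R) f : compact K -> K `<=` `]0, 1[ ->
  {within `[0, 1], continuous f} -> mu.-integrable K (EFin \o f).
Proof.
move=> cK K01 fc; apply: (integrableS _ _ _ (continuous_integrable_itv fc)) => //.
  by apply: compact_measurable.
by move=> x /K01 /=; rewrite !in_itv /= => /andP[/ltW -> /ltW ->].
Qed.

Lemma measurable_within_itvoo f : {within `[0, 1], continuous f} ->
  measurable_fun `](0 : R), 1[ f.
Proof.
move=> fc; apply: measurable_funS (measurable_within_itv fc) => //.
by move=> x /=; rewrite !in_itv /= => /andP[/ltW -> /ltW ->].
Qed.

Lemma integrable_within_itvoo f : {within `[0, 1], continuous f} ->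
  mu.-integrable `]0, 1[ (EFin \o f).
Proof.
move=> fc; apply: (integrableS _ _ _ (continuous_integrable_itv fc)) => //.
by move=> x /=; rewrite !in_itv /= => /andP[/ltW -> /ltW ->].
Qed.

Lemma within_continuous_powR_norm f p : 0 < p -> {within `[0, 1], continuous f} ->
  {within `[0, 1], continuous (fun x => `|f x| `^ p)}.
Proof.
move=> p0 /subspace_continuousP fc; apply/subspace_continuousP => x x01.
have cp : (fun y : R => `|y| `^ p) y @[y --> f x] --> `|f x| `^ p.
  have [->|fx] := eqVneq (f x) 0; last first.
    apply: (@continuous_comp _ _ _ (fun y : R => `|y|) (fun y : R => y `^ p)).
      exact: norm_continuous.
    by apply: is_derive_continuous (is_derive1_powR p _); rewrite normr_gt0.
  rewrite normr0 powR0 ?gt_eqF//; apply/cvgrPdist_lt => e e0.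
  have H : \forall y \near (0 : R), `|y| < e `^ p^-1 by apply: nbhs0_lt; rewrite powR_gt0.
  apply: filterS H => y yE; rewrite sub0r normrN ger0_norm ?powR_ge0//.
  have -> : e = (e `^ p^-1) `^ p by rewrite -powRrM mulVf ?gt_eqF// powRr1// ltW.
  apply: gt0_ltr_powR => //; rewrite ?nnegrE ?powR_ge0//.
exact: (cvg_comp f (fun y : R => `|y| `^ p) (fc x x01) cp).
Qed.

Lemma within_Lp_loc p f : 0 < p -> {within `[0, 1], continuous f} ->
  Lp_loc `]0, 1[ p f.
Proof.
move=> p0 fc; split; first exact: measurable_within_itvoo.
move=> K cK K01.
have /integrableP[_] := compact_integrable_within cK K01 (within_continuous_powR_norm p0 fc).
by under eq_integral do rewrite /= ger0_norm ?powR_ge0//.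
Qed.

Lemma within_locally_integrable f : {within `[0, 1], continuous f} ->
  locally_integrable `]0, 1[ f.
Proof.
move=> fc; apply: open_integrable_locally; first exact: interval_open.
exact: integrable_within_itvoo.
Qed.

Lemma regular_is_weak_derivative k d : {within `[0, 1], continuous k} ->
  (forall r, 0 < r < 1 -> is_derive r 1 k (d r)) -> {within `[0, 1], continuous d} ->
  is_weak_derivative `]0, 1[ k d.
Proof.
move=> kc dk dc; split; [exact: within_locally_integrable..|].
move=> phi [Cphi [K [cK K01 phi0]]].
have [phi' [dphi /= /continuous_within_setT cphi']] := Cphi 1%N.
have {}dphi x : is_derive x 1 phi (phi' x) by apply/is_derive_withinT; exact: dphi.
have cphi : continuous phi by move=> x; exact: is_derive_continuous (dphi x).
have dE : derive1 phi = phi' by apply/funext => x; rewrite derive1E; have [_ ->] := dphi x.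
rewrite dE.
have out (x : R) : ~ (0 < x < 1) -> phi x = 0.
  by move=> x01; apply: phi0 => /K01 /=; rewrite in_itv.
have c1 : {within `[0, 1], continuous (fun x => k x * phi' x)}.
  by move=> x; apply: (@cvgM R); [exact: kc|move: x; exact: continuous_subspaceT].
have c2 : {within `[0, 1], continuous (fun x => d x * phi x)}.
  by move=> x; apply: (@cvgM R); [exact: dc|move: x; exact: continuous_subspaceT].
have c3 : {within `[0, 1], continuous (fun x => k x * phi x)}.
  by move=> x; apply: (@cvgM R); [exact: kc|move: x; exact: continuous_subspaceT].
have : \int[mu]_(x in `[0, 1]) (d x * phi x + k x * phi' x) = k 1 * phi 1 - k 0 * phi 0.
  apply: (@Rintegral_FTC2 R 0 1 (fun x => k x * phi x)) => //.
    by move=> x; apply: (@cvgD _ R); [exact: c2|exact: c1].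
  by move=> x x01; exact: (is_derive_funM (dk x x01) (dphi x)).
have phi00 : phi 0 = 0 by apply: out; rewrite ltxx.
have phi10 : phi 1 = 0 by apply: out; rewrite ltxx andbF.
rewrite phi00 phi10 !mulr0 subrr RintegralD//; [|exact: continuous_integrable_itv..].
rewrite -!(@Rintegral_itv_bndo_bndc _ _ 1) -?(@Rintegral_itv_obnd_cbnd _ 0).
- by move=> E; apply/eqP; rewrite -addr_eq0 addrC E.
- exact: integrable_within_itvoo.
- exact: integrable_within_itvoo.
- apply: (integrableS _ _ _ (continuous_integrable_itv c1)) => //.
  by move=> x /=; rewrite !in_itv /= => /andP[-> /ltW ->].
- apply: (integrableS _ _ _ (continuous_integrable_itv c2)) => //.
  by move=> x /=; rewrite !in_itv /= => /andP[-> /ltW ->].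
Qed.

Lemma within_itv_in_continuous f : {within `[0, 1], continuous f} ->
  {in `]0, 1[%R, continuous f}.
Proof. by move=> /(continuous_within_itvP f ltr01)[]. Qed.

Lemma regular_admissible p k d : 0 < p -> {within `[0, 1], continuous k} ->
  (forall r, 0 < r < 1 -> is_derive r 1 k (d r)) -> {within `[0, 1], continuous d} ->
  admissible p k.
Proof.
move=> p0 kc dk dc; have wd := regular_is_weak_derivative kc dk dc.
split; [split => //|]; split.
- exact: integrable_within_itvoo.
- by exists d => //; exact: integrable_within_itvoo.
- exact: within_Lp_loc.
- by exists d => //; exact: within_Lp_loc.
Qed.

Lemma weak_derivativeP p k : admissible p k ->
  is_weak_derivative `]0, 1[ k (weak_derivative `]0, 1[ k).
Proof.
move=> [[_ [_ [g wg _]]] _]; rewrite /weak_derivative; case: xgetP => [//|/(_ g)].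
by [].
Qed.

Definition density p k g r :=
  r `^ (1 - p) * ((r * g r) ^+ 2 + sin (k r) ^+ 2) `^ (p / 2).

Lemma density_ge0 p k g r : 0 <= density p k g r.
Proof. by rewrite mulr_ge0 ?powR_ge0. Qed.

Lemma energy_density p k : 1 < p -> energy p k =
  (\int[mu]_(r in `]0%R, 1%R[) (density p k (weak_derivative `]0, 1[ k) r)%:E)%E.
Proof.
move=> p1; rewrite (energyE _ p1); apply: eq_integral => r.
rewrite inE /= in_itv /= => /andP[r0 _]; congr (_%:E); rewrite /density.
set g := weak_derivative _ _ _.
have -> : (r * g) ^+ 2 + sin (k r) ^+ 2 = r ^+ 2 * (g ^+ 2 + sin (k r) ^+ 2 / r ^+ 2).
  by rewrite mulrDr -exprMn [r ^+ 2 * (_ / _)]mulrCA mulfV ?mulr1// expf_neq0// gt_eqF.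
rewrite powRM ?sqr_ge0 ?addr_ge0 ?divr_ge0 ?sqr_ge0//.
rewrite mulrA -(powR_mulrn 2 (ltW r0)) -powRrM -powRD; last by apply/implyP => _; rewrite gt_eqF.
rewrite (_ : 1 - p + _ = 1) ?powRr1 ?(ltW r0)//.
by rewrite mulrCA mulfV// mulr1 subrK.
Qed.

Lemma measurable_density p k g : measurable_fun `](0 : R), 1[ k -> measurable_fun `](0 : R), 1[ g ->
  measurable_fun `](0 : R), 1[ (density p k g).
Proof.
move=> mk mg; apply: measurable_funM.
  by apply: measurable_funTS; exact: measurable_powR.
apply: (measurableT_comp (measurable_powR _)); apply: measurable_funD.
  by apply: measurable_funX; apply: measurable_funM.
apply: measurable_funX; apply: (measurableT_comp _ mk).
by apply: continuous_measurable_fun; exact: continuous_sin.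
Qed.

Lemma energy_regular p k d : 1 < p -> {within `[0, 1], continuous k} ->
  (forall r, 0 < r < 1 -> is_derive r 1 k (d r)) -> {within `[0, 1], continuous d} ->
  energy p k = (\int[mu]_(r in `]0%R, 1%R[) (density p k d r)%:E)%E.
Proof.
move=> p1 kc dk dc; rewrite (energy_density _ p1).
have p0 : 0 < p by exact: lt_trans p1.
have wg := weak_derivativeP (regular_admissible p0 kc dk dc).
have [_ [mg _ _] _] := wg; have mk := measurable_within_itvoo kc.
apply: ge0_ae_eq_integral => //.
- by apply/measurable_EFinP; exact: measurable_density.
- by apply/measurable_EFinP; apply: measurable_density => //; exact: measurable_within_itvoo.
- by move=> r _; rewrite lee_fin density_ge0.
- by move=> r _; rewrite lee_fin density_ge0.
apply: ae_mono (weak_derivative_ae_unique (within_itv_in_continuous kc) wg (regular_is_weak_derivative kc dk dc)).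
by move=> r H; rewrite /= in_itv /= => /H; rewrite /density => ->.
Qed.

End weak_derivative_regular.

(** * The lower bound and its equality case *)

Section lower_bound.
Context {R : realType}.
Implicit Types (p r x y z t : R) (f g h k : R -> R).
Let mu := @lebesgue_measure R.

Lemma integrable_ge0_small f : mu.-integrable `](0 : R), 1[ (EFin \o f) ->
  (forall r, 0 < r < 1 -> 0 <= f r) ->
  forall e x, 0 < e -> 0 < x <= 1 -> exists2 r, 0 < r < x & r * f r <= e.
Proof.
move=> fi f0 e x e0 /andP[x0 x1]; apply: contrapT => nH.
pose I := \int[mu]_(r in `](0 : R), 1[) f r.
(* Otherwise f r >= e / r near 0, which is not integrable. *)
have H r : 0 < r < x -> e / r <= f r.
  move=> /andP[r0 rx]; rewrite ler_pdivrMr//; rewrite leNgt; apply/negP => h.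
  by apply: nH; exists r; [rewrite r0|rewrite mulrC ltW].
pose y := x / 2; have y0 : 0 < y by rewrite divr_gt0.
have yx : y < x by rewrite /y; lra.
(* Chosen so that the integral of e / r over [a, y] is I + 1, more than the whole integral of f. *)
pose a := y * expR (- ((I + 1) / e)).
have I0 : 0 <= I by apply: Rintegral_ge0 => r /=; rewrite in_itv /=; exact: f0.
have Ie : 0 < (I + 1) / e by rewrite divr_gt0//; lra.
have a0 : 0 < a by rewrite mulr_gt0 ?expR_gt0.
have ay : a < y by rewrite /a gtr_pMr// -[ltRHS]expR0 ltr_expR oppr_lt0.
have sub : `[a, y] `<=` `](0 : R), 1[.
  move=> r /=; rewrite !in_itv /= => /andP[ar ry].
  by rewrite (lt_le_trans a0 ar) (le_lt_trans ry)// (lt_le_trans yx).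
have cinv : {within `[a, y], continuous (fun r : R => e / r)}.
  apply: continuous_in_subspaceT => r; rewrite inE /= in_itv /= => /andP[ar _].
  apply: cvgM; first exact: cvg_cst.
  by apply: cvgV; [rewrite gt_eqF// (lt_le_trans a0)|exact: cvg_id].
have cln : {within `[a, y], continuous (fun r : R => e * ln r)}.
  apply: continuous_in_subspaceT => r; rewrite inE /= in_itv /= => /andP[ar _].
  apply: cvgM; first exact: cvg_cst.
  by apply: continuous_ln; rewrite (lt_le_trans a0).
have : \int[mu]_(r in `[a, y]) (e / r) = e * ln y - e * ln a.
  apply: (@Rintegral_FTC2 R a y (fun r => e * ln r)) => // r /andP[ar _].
  have r0 : 0 < r by exact: lt_trans ar.
  by apply: is_derive_eqr (is_derive_funM (is_derive_cst e r 1) (is_derive1_ln r0)) _; rewrite mul0r add0r.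
rewrite -mulrBr -ln_div ?posrE// /a invfM -expRN opprK mulrA mulfV ?gt_eqF// mul1r expRK.
rewrite mulrCA mulfV ?gt_eqF// mulr1 => E.
have : I + 1 <= I.
  rewrite -[leLHS]E; apply: (@le_trans _ _ (\int[mu]_(r in `[a, y]) f r)).
    apply: le_Rintegral => //; first exact: continuous_integrable_itv.
      by apply: integrableS fi => //.
    move=> r /=; rewrite in_itv /= => /andP[ar ry]; apply: H.
    by rewrite (lt_le_trans a0 ar) (le_lt_trans ry).
  by apply: le_Rintegral_subset => // r /=; rewrite in_itv /=; exact: f0.
by lra.
Qed.

Variables (p l : R) (q W W' : R -> R) (C : R).
Hypothesis p1 : 1 < p.
Hypothesis q0 : forall z, 0 <= z <= 1 -> 0 < q z.
Hypothesis C0 : 0 <= C.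
Hypothesis cW : {within `[0, 1], continuous W}.
Hypothesis dW : forall z, 0 < z < 1 -> [/\ is_derive z 1 W (W' z),
  {for z, continuous W'} & `|W' z| <= C / Num.sqrt z].
Hypothesis WC : forall z, 0 <= z <= 1 -> `|W z| <= C * (z * (2 - z)) `^ (p / 2).
Hypothesis W'E : forall z, W' z = p * (z * (2 - z)) `^ (p / 2 - 1) * q z *
  (1 + q z ^+ 2) `^ (p / 2 - 1).
Hypothesis WE : forall z, 0 <= z <= 1 -> (2 - p) * W z =
  (z * (2 - z)) `^ (p / 2) * (1 + q z ^+ 2) `^ (p / 2 - 1) * (1 - (p - 1) * q z ^+ 2).

Definition folded k r := 1 - `|cos (k r)|.

(* The derivative of r |-> r^(2-p) W (folded k r) when g is the derivative of k. *)
Definition calibration W W' k g r :=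
  (2 - p) * r `^ (1 - p) * W (folded k r) +
  r `^ (2 - p) * (W' (folded k r) * (Num.sg (cos (k r)) * sin (k r)) * g r).

Lemma folded01 k r : 0 <= folded k r <= 1.
Proof.
rewrite /folded; have := normr_ge0 (cos (k r)); have := cos_max (k r); lra.
Qed.

Lemma folded_sin k r : folded k r * (2 - folded k r) = sin (k r) ^+ 2.
Proof.
have := cos2Dsin2 (k r); have := real_normK (num_real (cos (k r))).
by rewrite /folded; lra.
Qed.

(** Factoring out r^(1-p) leaves the left member of [calibration_ineq], with t = sin^2, e = sg cos *
    sin and v = r g. *)
Lemma calibrationE k g r : 0 < r ->
  let t := sin (k r) ^+ 2 in let z := folded k r in
  calibration W W' k g r = r `^ (1 - p) *
   (t `^ (p / 2) * (1 + q z ^+ 2) `^ (p / 2 - 1) * (1 - (p - 1) * q z ^+ 2) +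
    (p - 1 + 1) * t `^ (p / 2 - 1) * q z * (1 + q z ^+ 2) `^ (p / 2 - 1) *
    (Num.sg (cos (k r)) * sin (k r) * (r * g r))).
Proof.
move=> r0 t z; have z01 : 0 <= z <= 1 by exact: folded01.
rewrite /calibration -/z W'E (folded_sin k r) -/t.
have -> : r `^ (2 - p) = r `^ (1 - p) * r.
  rewrite -[X in _ * X](powRr1 (ltW r0)) -powRD; last by apply/implyP => _; rewrite gt_eqF.
  by congr (_ `^ _); lra.
have WEz : (2 - p) * W z = t `^ (p / 2) * (1 + q z ^+ 2) `^ (p / 2 - 1) * (1 - (p - 1) * q z ^+ 2).
  by rewrite WE// (folded_sin k r).
have -> : (2 - p) * r `^ (1 - p) * W z = r `^ (1 - p) * ((2 - p) * W z) by rewrite mulrAC mulrC.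
rewrite WEz subrK.
move: (q z) ((1 + _) `^ _) (t `^ (p / 2 - 1)) (t `^ (p / 2)) (r `^ _) (Num.sg _) => a1 a2 a3 a4 a5 a6.
by lra.
Qed.

(** Strict exactly where the cosine vanishes, the sign being 0 there; hence the inequality between
    e^2 and t in [calibration_ineq]. *)
Lemma sin_fold_sqr k r : (Num.sg (cos (k r)) * sin (k r)) ^+ 2 <= sin (k r) ^+ 2.
Proof.
rewrite exprMn ler_piMl ?sqr_ge0//.
by case: sgrP => _; rewrite ?expr0n ?expr1n ?sqrrN ?expr1n ?ler01.
Qed.

Lemma calibration_le k g r : 0 < r -> calibration W W' k g r <= density p k g r.
Proof.
move=> r0; have b0 : 0 < p - 1 by rewrite subr_gt0.
have aE : p / 2 = (p - 1 + 1) / 2 by rewrite subrK.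
have [H _] := @calibration_ineq R _ _ _ _ _ (r * g r) b0 aE (q0 (folded01 k r)) (sqr_ge0 _) (sin_fold_sqr k r).
by rewrite (calibrationE k g r0) /density ler_wpM2l ?powR_ge0.
Qed.

Lemma calibration_eq_density k g r : 0 < r -> calibration W W' k g r = density p k g r ->
  (sin (k r) != 0 -> Num.sg (cos (k r)) * sin (k r) * (r * g r) =
     sin (k r) ^+ 2 * q (folded k r)) /\ (sin (k r) = 0 -> g r = 0).
Proof.
move=> r0; have b0 : 0 < p - 1 by rewrite subr_gt0.
have aE : p / 2 = (p - 1 + 1) / 2 by rewrite subrK.
have [_ H] := @calibration_ineq R _ _ _ _ _ (r * g r) b0 aE (q0 (folded01 k r)) (sqr_ge0 _) (sin_fold_sqr k r).
rewrite (calibrationE k g r0) /density => /(mulfI _) E.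
have {H E}[H1 H2] := H (E (lt0r_neq0 (powR_gt0 _ r0))).
split => [s0|s0]; first by apply: H1; rewrite exprn_even_gt0.
have := H2 _; rewrite s0 expr0n /= => /(_ erefl)/eqP.
by rewrite mulf_eq0 gt_eqF//= => /eqP.
Qed.

Section competitor.
Variable k : R -> R.
Hypothesis kadm : admissible p k.
Hypothesis kl : k 1 = l.
Hypothesis Efin : (energy p k < +oo)%E.
Let g := weak_derivative `]0, 1[ k.
Let d := density p k g.
Let cal := calibration W W' k g.
Let Phi r := r `^ (2 - p) * W (folded k r).
Let E := fine (energy p k).

Let ck : {within `[0, 1], continuous k}.
Proof. by case: kadm => -[]. Qed.

Let wg : is_weak_derivative `]0, 1[ k g.
Proof. exact: weak_derivativeP kadm. Qed.

Let id_ : mu.-integrable `](0 : R), 1[ (EFin \o d).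
Proof.
have [_ [mg _ _] _] := wg.
apply/integrableP; split.
  by apply/measurable_EFinP; apply: measurable_density => //; exact: measurable_within_itvoo.
under eq_integral => r _ do rewrite /= ger0_norm ?density_ge0//.
by rewrite -energy_density.
Qed.

Let EE : E = \int[mu]_(r in `](0 : R), 1[) d r.
Proof. by rewrite /E (energy_density _ p1). Qed.

Let cfold : {within `[0, 1], continuous (folded k)}.
Proof.
have cc : continuous (fun y : R => 1 - `|cos y|).
  move=> y; apply: (@cvgB _ R); first exact: cvg_cst.
  by apply: (@continuous_comp _ _ _ cos (fun y : R => `|y|)); [exact: continuous_cos|exact: norm_continuous].
apply/subspace_continuousP => x x01; move/subspace_continuousP/(_ x x01) : ck => ckx.
exact: (cvg_comp k (fun y : R => 1 - `|cos y|) ckx (cc _)).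
Qed.

Let folded_chain (A A' f f' : R -> R) C1 x y : 0 < x -> x < y -> y < 1 ->
  (forall r, x <= r <= y -> is_derive r 1 A (A' r)) ->
  {within `[x, y], continuous A'} ->
  {within `[0, 1], continuous f} ->
  (forall z, 0 < z < 1 -> is_derive z 1 f (f' z)) ->
  (forall z, 0 < z < 1 -> {for z, continuous f'}) ->
  (forall z, 0 < z < 1 -> `|f' z| <= C1 / Num.sqrt z) ->
  let G r := A' r * f (folded k r) +
    A r * (f' (folded k r) * (Num.sg (cos (k r)) * sin (k r)) * g r) in
  mu.-integrable `[x, y] (EFin \o G) /\
  \int[mu]_(r in `[x, y]) G r = A y * f (folded k y) - A x * f (folded k x).
Proof.
move=> x0 xy y1 dA cA cf df cf' f'C.
have kc := within_itv_in_continuous ck.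
have [ig _] := weak_derivative_primitive kc wg x0 xy y1.
apply: (folded_chain_rule xy ig _ dA cA cf df cf' f'C) => r /andP[].
rewrite le_eqVlt => /predU1P[<- _|xr ry]; first by rewrite set_itv1 Rintegral_set1 addr0.
have [_ <-] := weak_derivative_primitive kc wg x0 xr (le_lt_trans ry y1).
by rewrite addrC subrK.
Qed.

Lemma calibration_integral x y : 0 < x -> x < y -> y < 1 ->
  mu.-integrable `[x, y] (EFin \o cal) /\
  \int[mu]_(r in `[x, y]) cal r = Phi y - Phi x.
Proof.
move=> x0 xy y1.
apply: (folded_chain (A := fun r => r `^ (2 - p)) (A' := fun r => (2 - p) * r `^ (1 - p)) x0 xy y1 _ _ cW) => //.
- move=> r /andP[xr _]; have r0 : 0 < r by exact: lt_le_trans xr.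
  apply: is_derive_eqr (is_derive1_powR (2 - p) r0) _.
  by congr (_ * _ `^ _); lra.
- apply: continuous_in_subspaceT => r; rewrite inE /= in_itv /= => /andP[xr _].
  have r0 : 0 < r by exact: lt_le_trans xr.
  apply: cvgM; first exact: cvg_cst.
  exact: is_derive_continuous (is_derive1_powR (1 - p) r0).
- by move=> z /dW[].
- by move=> z /dW[].
- by move=> z /dW[_ _]; exact.
Qed.

Let subI x y : 0 < x -> y < 1 -> `[x, y] `<=` `](0 : R), 1[.
Proof.
move=> x0 y1 r /=; rewrite !in_itv /= => /andP[xr ry].
by rewrite (lt_le_trans x0 xr) (le_lt_trans ry).
Qed.

Let defect r := d r - cal r.

Let defect_ge0 r : 0 < r -> 0 <= defect r.
Proof. by move=> r0; rewrite subr_ge0 calibration_le. Qed.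

Let idefect x y : 0 < x -> x < y -> y < 1 -> mu.-integrable `[x, y] (EFin \o defect).
Proof.
move=> x0 xy y1; have [ic _] := calibration_integral x0 xy y1.
apply: integrable_funB => //; apply: integrableS id_ => //; exact: subI.
Qed.

Let defect_le x y : 0 < x -> x < y -> y < 1 ->
  \int[mu]_(r in `[x, y]) defect r <= E - Phi y + Phi x.
Proof.
move=> x0 xy y1; have [ic Ec] := calibration_integral x0 xy y1.
have idx : mu.-integrable `[x, y] (EFin \o d) by apply: integrableS id_ => //; exact: subI.
rewrite RintegralB// Ec.
have : \int[mu]_(r in `[x, y]) d r <= E.
  rewrite EE; apply: le_Rintegral_subset => //; first exact: subI.
  by move=> r _; exact: density_ge0.
by move: (\int[mu]_(r in `[x, y]) d r) (Phi x) (Phi y) => u v w; lra.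
Qed.

Let Phi1 : Phi x @[x --> (1 : R)^'-] --> W (1 - `|cos l|).
Proof.
have -> : W (1 - `|cos l|) = 1 `^ (2 - p) * W (folded k 1) by rewrite powR1 mul1r /folded kl.
apply: cvgM.
  apply: cvg_within_filter; exact: is_derive_continuous (is_derive1_powR (2 - p) ltr01).
have cc : {within `[0, 1], continuous (W \o folded k)}.
  apply/subspace_continuousP => x x01.
  move/subspace_continuousP/(_ x x01) : cfold => cx.
  move/subspace_continuousP/(_ (folded k x)) : cW; rewrite /= in_itv /= => /(_ (folded01 k x)) cWx.
  have c' : folded k y @[y --> within `[0, 1] (nbhs x)] --> within `[0, 1] (nbhs (folded k x)).
    move=> U HU.
    have H : \forall y \near within `[0, 1] (nbhs x), (fun z => `[0, 1] z -> U z) (folded k y) := cx _ HU.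
    apply: filterS H => y; apply.
    by rewrite /= in_itv /=; exact: folded01.
  exact: (cvg_comp (folded k) W c' cWx).
by have [_ _ +] := (continuous_within_itvP _ ltr01).1 cc.
Qed.

(** The bound on W by sin^p gives Phi r <= C r d r, and r d r gets small at suitable radii by
    integrability of d. An upper bound suffices, since Phi x enters [defect_le] with a plus sign. *)
Let Phi_small e x : 0 < e -> 0 < x <= 1 -> exists2 r, 0 < r < x & Phi r <= e.
Proof.
move=> e0 x01; have C1 : 0 < C + 1 by rewrite ltr_wpDl.
have [|r rx rE] := integrable_ge0_small id_ _ (divr_gt0 e0 C1) x01.
  by move=> r _; exact: density_ge0.
exists r => //; have /andP[r0 _] := rx.
apply: (@le_trans _ _ (C * (r * d r))); last first.
  apply: (@le_trans _ _ (C * (e / (C + 1)))); first by rewrite ler_wpM2l.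
  by rewrite mulrCA ger_pMr// ler_pdivrMr// mul1r lerDl.
have -> : C * (r * d r) = r `^ (2 - p) * (C * ((r * g r) ^+ 2 + sin (k r) ^+ 2) `^ (p / 2)).
  have -> : r `^ (2 - p) = r `^ (1 - p) * r.
    rewrite -[X in _ * X](powRr1 (ltW r0)) -powRD; last by apply/implyP => _; rewrite gt_eqF.
    by congr (_ `^ _); lra.
  by rewrite /d /density; move: (_ `^ (1 - p)) (_ `^ (p / 2)) => u v; lra.
rewrite ler_wpM2l ?powR_ge0// (le_trans (ler_norm _))// (le_trans (WC (folded01 k r)))//.
rewrite ler_wpM2l// folded_sin; apply: ge0_ler_powR.
- by rewrite divr_ge0// ltW// (lt_trans ltr01).
- by rewrite nnegrE sqr_ge0.
- by rewrite nnegrE addr_ge0 ?sqr_ge0.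
- by rewrite lerDr sqr_ge0.
Qed.

(** The defect is nonnegative, so [x, y] may be enlarged: its left end moves to a radius where Phi
    is small, its right end towards 1, where Phi tends to W (1 - |cos l|). This one estimate serves
    both the lower bound and its equality case. *)
Let defect_le_gap x y : 0 < x -> x < y -> y < 1 ->
  \int[mu]_(r in `[x, y]) defect r <= E - W (1 - `|cos l|).
Proof.
move=> x0 xy y1; apply/ler_addgt0Pr => e e0.
have e2 : 0 < e / 2 by rewrite divr_gt0.
have [|x' /andP[x'0 x'x] Px] := Phi_small e2 (x := x) _.
  by rewrite x0 ltW// (lt_trans xy).
have [y' [/andP[yy' y'1] Py]] : exists y', y < y' < 1 /\ W (1 - `|cos l|) - e / 2 < Phi y'.
  have H : \forall y' \near (1 : R)^'-, y < y' < 1 /\ W (1 - `|cos l|) - e / 2 < Phi y'.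
    near=> z; split.
      by apply/andP; split; near: z; [exact: nbhs_left_gt|exact: nbhs_left_lt].
    near: z; move: Phi1 => /cvgr_gt; apply; lra.
  have [z Hz] := @filter_ex _ _ (at_left_proper_filter (1 : R)) _ H; by exists z.
have x'y' : x' < y' by apply: lt_trans yy'; exact: lt_trans xy.
apply: (@le_trans _ _ (\int[mu]_(r in `[x', y']) defect r)).
  apply: le_Rintegral_subset => //.
  - by move=> r /=; rewrite !in_itv /= => /andP[xr ry]; rewrite (le_trans (ltW x'x) xr) (le_trans ry (ltW yy')).
  - exact: idefect.
  - by move=> r /=; rewrite in_itv /= => /andP[xr _]; apply: defect_ge0; exact: lt_le_trans xr.
have := defect_le x'0 x'y' y'1.
by move: (W _) Px Py => w; lra.
Unshelve. all: by end_near. Qed.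

Lemma energy_lower_bound : W (1 - `|cos l|) <= E.
Proof.
rewrite -subr_ge0; have h2 : 0 < (2^-1 : R) by rewrite invr_gt0.
(* Any compact subinterval of ]0, 1[ would do. *)
apply: (@le_trans _ _ (\int[mu]_(r in `[(4^-1 : R), 2^-1]) defect r)); last first.
  apply: defect_le_gap; lra.
apply: Rintegral_ge0 => r /=; rewrite in_itv /= => /andP[xr _]; apply: defect_ge0; lra.
Qed.

(** A zero gap makes the defect vanish almost everywhere on each [x, y], so the velocity of k is
    that of the field. The folded chain rule for r^-2 F then has an integrand that is almost
    everywhere 0 by the equation of F, and the constant is read off from the left limit at 1. *)
Lemma minimal_folded_relation (F F1 : R -> R) : E = W (1 - `|cos l|) ->
  continuous F -> continuous F1 ->
  (forall z, 0 < z <= 1 -> is_derive z 1 F (F1 z)) ->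
  (forall z, 0 <= z <= 1 -> z * (2 - z) * q z * F1 z = 2 * F z) ->
  forall r, 0 < r < 1 -> F (folded k r) = F (1 - `|cos l|) * r ^+ 2.
Proof.
move=> EW cF cF1 dF FF1.
have F0 : F 0 = 0 by have := FF1 0; rewrite lexx ler01 !mul0r => /(_ isT); lra.
have [C1 C10 F1C] : exists2 C, 0 <= C & forall z, 0 <= z <= 1 -> `|F1 z| <= C.
  by apply: within_itv_bounded; [exact: ler01|exact: continuous_subspaceT].
have key x y : 0 < x -> x < y -> y < 1 ->
    y ^- 2 * F (folded k y) = x ^- 2 * F (folded k x).
  move=> x0 xy y1.
  have [] := folded_chain (A := fun r => r ^- 2) (A' := fun r => - (2 * r) * (r ^- 2 * r ^- 2))
    (f := F) (f' := F1) (C1 := C1) x0 xy y1.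
  - move=> r /andP[xr _]; have r0 : r != 0 by rewrite gt_eqF// (lt_le_trans x0).
    have r2 : (fun r : R => r ^+ 2) r != 0 by rewrite expf_neq0.
    apply: is_derive_eqr (@is_derive_funV R (fun r => r ^+ 2) r _ r2 (is_derive_funX 2 (is_derive_id r 1))) _.
    by rewrite /= expr1 mulr1.
  - apply: continuous_in_subspaceT => r; rewrite inE /= in_itv /= => /andP[xr _].
    have r0 : r != 0 by rewrite gt_eqF// (lt_le_trans x0).
    have cr : {for r, continuous (fun r : R => r ^- 2)}.
      apply: (cvgV (f := fun r : R => r ^+ 2)); first by rewrite expf_neq0.
      exact: exprn_continuous.
    apply: cvgM; last exact: cvgM.
    by apply: (@cvgN _ R); apply: cvgM; [exact: cvg_cst|exact: cvg_id].
  - exact: continuous_subspaceT.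
  - by move=> z z01; apply: dF; lra.
  - by move=> z _; exact: cF1.
  - move=> z /andP[z0 z1]; apply: (@le_trans _ _ C1); first by apply: F1C; lra.
    have s0 : 0 < Num.sqrt z by rewrite sqrtr_gt0.
    by rewrite ler_pdivlMr// ler_piMr// -sqrtr1 ler_wsqrtr// ltW.
  move=> iG EG.
  have D0 : \forall r \ae mu, `[x, y] r -> defect r = 0.
    have h : (\int[mu]_(r in `[x, y]) (`|defect r|%:E) = 0)%E.
      have i0 := integrable_norm (idefect x0 xy y1).
      have : \int[mu]_(r in `[x, y]) `|defect r| = 0.
        apply/le_anti/andP; split; last by apply: Rintegral_ge0.
        have := defect_le_gap x0 xy y1; rewrite EW subrr; apply: le_trans.
        rewrite le_eqVlt; apply/orP; left; apply/eqP; apply: eq_Rintegral => r.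
        by rewrite inE /= in_itv /= => /andP[xr _]; rewrite ger0_norm// defect_ge0// (lt_le_trans x0).
      rewrite /Rintegral => h; rewrite -[LHS]fineK ?h//.
      by apply: integrable_fin_num => //.
    have mdef : measurable_fun (`[x, y] : set R) (EFin \o defect).
      by case/integrableP: (idefect x0 xy y1).
    have [+ _] := ae_eq_integral_abs mu (measurable_itv _) mdef.
    by move=> H; apply: ae_mono (H h) => r Hr rxy; apply: EFin_inj (Hr rxy).
  have : y ^- 2 * F (folded k y) - x ^- 2 * F (folded k x) = 0; last by move/eqP; rewrite subr_eq0 => /eqP.
  rewrite -EG /Rintegral (@ae_eq_integral _ _ _ mu _ (cst 0%E)) ?integral0//.
  - by case/integrableP: iG.
  apply: ae_mono D0 => r Hr rxy; have {Hr}/eqP := Hr rxy.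
  rewrite subr_eq0 eq_sym => /eqP H.
  have r0 : 0 < r by move: rxy; rewrite /= in_itv /= => /andP[xr _]; exact: lt_le_trans xr.
  have [H1 H2] := calibration_eq_density r0 H.
  have z01 := folded01 k r; have zs := folded_sin k r; have Fz := FF1 _ z01.
  rewrite /=; congr (_%:E).
  (* Where the sine vanishes the fold is 0, as it is at most 1, and F 0 = 0. *)
  have [s0|s0] := eqVneq (sin (k r)) 0.
    have /eqP : folded k r * (2 - folded k r) = 0 by rewrite zs s0 expr0n.
    rewrite mulf_eq0 => /orP[/eqP ->|/eqP]; last by lra.
    by rewrite F0 s0 !(mulr0, mul0r) addr0.
  have {}H1 := H1 s0.
  have rn : r != 0 by rewrite gt_eqF.
  apply: (mulfI rn); rewrite mulr0 mulrDr.
  rewrite zs in Fz; have i2 := mulVf (expf_neq0 2 rn); move: (r ^- 2) i2 => i i2.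
  transitivity (- (i * r ^+ 2) * i * (2 * F (folded k r)) +
     i * F1 (folded k r) * (Num.sg (cos (k r)) * sin (k r) * (r * g r))).
    by move: (Num.sg _) => sg; lra.
  by rewrite H1 i2 -Fz; lra.
move=> r /andP[r0 r1].
have lim : (fun y => F (folded k y)) y @[y --> (1 : R)^'-] --> F (1 - `|cos l|).
  have [_ _ c1] := (continuous_within_itvP _ ltr01).1 cfold.
  have -> : 1 - `|cos l| = folded k 1 by rewrite /folded kl.
  exact: (cvg_comp (folded k) F c1 (cF _)).
have lim2 : (fun y => F (folded k y)) y @[y --> (1 : R)^'-] --> 1 ^+ 2 * (r ^- 2 * F (folded k r)).
  have : (fun y => y ^+ 2 * (r ^- 2 * F (folded k r))) y @[y --> (1 : R)^'-] --> 1 ^+ 2 * (r ^- 2 * F (folded k r)).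
    by apply: cvgM; [apply: cvg_within_filter; exact: exprn_continuous|exact: cvg_cst].
  apply: cvg_trans; apply: near_eq_cvg; near=> y.
  have ry : r < y by near: y; exact: nbhs_left_gt.
  have y1 : y < 1 by near: y; exact: nbhs_left_lt.
  by rewrite -(key _ _ r0 ry y1) mulVKf// expf_neq0// gt_eqF// (lt_trans r0).
have := cvg_unique (@Rhausdorff R) lim lim2.
by rewrite expr1n mul1r => ->; rewrite mulrAC mulVf ?mul1r// expf_neq0// gt_eqF.
Unshelve. all: by end_near. Qed.

End competitor.
End lower_bound.

(** * Recovering the map from its folding *)

Section unfolding.
Context {R : realType}.
Implicit Types (l r s v x y : R) (f g h k : R -> R).

Lemma within_continuous_eq0 f g : {within `[0, 1], continuous f} ->
  {within `[0, 1], continuous g} -> (forall r, 0 < r < 1 -> f r = g r) -> f 0 = g 0.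
Proof.
move=> /(continuous_within_itvP _ ltr01)[_ cf _] /(continuous_within_itvP _ ltr01)[_ cg _] fg.
apply: (cvg_unique (@Rhausdorff R) cf); apply: cvg_trans cg; apply: near_eq_cvg.
near=> r; rewrite fg//; apply/andP; split; near: r; first exact: nbhs_right_gt.
exact: nbhs_right_lt.
Unshelve. all: by end_near. Qed.

(** On ]0, 1[ the value |cos k| lies strictly between 0 and 1, so k avoids 0, pi/2 and pi and, by
    the intermediate value theorem, stays on one side of each. The end value l decides the side of 0
    and pi, and that of pi/2 when l < pi/2; for l = pi/2 the value of k at 1/2 decides, and both
    cases occur. *)
Lemma unfold_unique h k l : 0 < l <= pi / 2 ->
  {within `[0, 1], continuous h} -> {within `[0, 1], continuous k} ->
  h 1 = l -> k 1 = l -> (forall r, 0 < r < 1 -> 0 < h r < l) ->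
  (forall r, 0 < r < 1 -> `|cos (k r)| = cos (h r)) ->
  eq_on01 k h \/ (l = pi / 2 /\ eq_on01 k (fun r => pi - h r)).
Proof.
move=> /andP[l0 lpi] ch ck h1 k1 hl kh; have pi0 : 0 < pi :> R := pi_gt0 R.
have cosh r : 0 < r < 1 -> 0 < cos (h r) < 1.
  move=> /hl hr; rewrite cos_gt0_pihalf; last by lra.
  by rewrite cos_lt1//; lra.
have avoid v r : `|cos v| = 0 \/ `|cos v| = 1 -> 0 < r < 1 -> k r <> v.
  by move=> cv r01 kv; have := cosh r r01; rewrite -kh// kv; case: cv => ->; rewrite ltxx ?andbF.
have side v r s : `|cos v| = 0 \/ `|cos v| = 1 -> 0 < r < 1 -> 0 < s <= 1 -> k s != v ->
    (k r < v) = (k s < v).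
  move=> cv r01 s01 ksv; have krv := avoid v r cv r01.
  have nb : ~~ (Num.min (k r) (k s) <= v <= Num.max (k r) (k s)).
    apply/negP => kv; have mM : Num.min r s <= Num.max r s by rewrite ge_min !le_max lexx.
    have cM : {within `[Num.min r s, Num.max r s], continuous k}.
      by apply: continuous_subspaceW ck => c; rewrite /= !in_itv /= ge_min le_max; lra.
    have kM : Num.min (k (Num.min r s)) (k (Num.max r s)) <= v <=
        Num.max (k (Num.min r s)) (k (Num.max r s)).
      by have [rs|sr] := leP r s; rewrite // minC maxC.
    have [c cc kc] := IVT mM cM kM.
    apply: (avoid v c) => //; move: cc; rewrite in_itv /= ge_min le_max.
    have cn1 : c != s by apply/eqP => cs; move: ksv; rewrite -cs kc eqxx.
    lra.
  move: nb; rewrite ge_min le_max negb_and !negb_or -!ltNge.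
  by move=> /orP[] /andP[krv' ksv']; [rewrite !ltNge !ltW|rewrite krv' ksv'].
have one01 : 0 < (1 : R) <= 1 by rewrite ltr01 lexx.
have k0 r : 0 < r < 1 -> 0 < k r.
  move=> r01; have c0 : `|cos (0 : R)| = 0 \/ `|cos (0 : R)| = 1 by right; rewrite cos0 normr1.
  have l0' : k 1 != 0 by rewrite k1 gt_eqF.
  have := side 0 r 1 c0 r01 one01 l0'; rewrite k1 (ltNge l) (ltW l0) /= => /negbT.
  by rewrite -leNgt le_eqVlt => /predU1P[/esym/(avoid 0 r c0 r01)//|].
have kpi r : 0 < r < 1 -> k r < pi.
  move=> r01; have cpi' : `|cos (pi : R)| = 0 \/ `|cos (pi : R)| = 1 by right; rewrite cospi normrN1.
  by rewrite (side pi r 1) ?k1//; [lra|rewrite lt_eqF//; lra].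
have cpihalf : `|cos (pi / 2 : R)| = 0 \/ `|cos (pi / 2 : R)| = 1 by left; rewrite cos_pihalf normr0.
have small : (forall r, 0 < r < 1 -> k r < pi / 2) -> eq_on01 k h.
  move=> kl2.
  have kE r : 0 < r < 1 -> k r = h r.
    move=> r01; have := kh r r01; have k0r := k0 r r01; have kr := kl2 r r01.
    have hr := hl r r01.
    rewrite ger0_norm; last by apply: cos_ge0_pihalf; lra.
    by apply: cos_inj; rewrite in_itv /=; lra.
  move=> r; rewrite in_itv /= => /andP[]; rewrite le_eqVlt => /predU1P[<- _|r0].
    exact: within_continuous_eq0.
  by rewrite le_eqVlt => /predU1P[->|r1]; [rewrite h1 k1|apply: kE; rewrite r0].
have [lE|ln] := eqVneq l (pi / 2); last first.
  by left; apply: small => r r01; rewrite (side _ r 1 cpihalf r01 one01) k1//; lra.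
have h2 : 0 < (2^-1 : R) < 1 by lra.
have h2' : 0 < (2^-1 : R) <= 1 by lra.
have kh2 : k 2^-1 != pi / 2 by apply/eqP; exact: avoid.
have [lt2|ge2] := ltP (k 2^-1) (pi / 2).
  by left; apply: small => r r01; rewrite (side _ r _ cpihalf r01 h2' kh2).
right; split => //.
have kE r : 0 < r < 1 -> k r = pi - h r.
  move=> r01; have := kh r r01; have k0r := kpi r r01.
  have hr := hl r r01.
  have kr : pi / 2 <= k r.
    by rewrite leNgt (side _ r _ cpihalf r01 h2' kh2) -leNgt.
  have cpk : cos (pi - k r) = - cos (k r) by rewrite addrC cosDpi cosN.
  rewrite ler0_norm; last first.
    by rewrite -oppr_ge0 -cpk; apply: cos_ge0_pihalf; lra.
  rewrite -cpk => E; have : pi - k r = h r by apply: cos_inj; rewrite ?in_itv//=; lra.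
  by move=> <-; rewrite opprB addrC subrK.
move=> r; rewrite in_itv /= => /andP[]; rewrite le_eqVlt => /predU1P[<- _|r0].
  apply: (@within_continuous_eq0 k (fun r => pi - h r)) => // x.
  by apply: (@cvgB _ R); [exact: cvg_cst|exact: ch].
rewrite le_eqVlt => /predU1P[->|r1]; last by apply: kE; rewrite r0.
by rewrite h1 k1 lE; lra.
Qed.

(** Meant for products with a power of r, whose factors may have no limit at 0 although the product
    is O(r). *)
Lemma within_continuous_linear_bound f M :
  (forall r, 0 < r <= 1 -> f x @[x --> within `[0, 1] (nbhs r)] --> f r) ->
  (forall r, 0 <= r <= 1 -> `|f r| <= M * r) -> {within `[0, 1], continuous f}.
Proof.
move=> fc fM; apply/subspace_continuousP => r; rewrite /= in_itv /= => /andP[].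
rewrite le_eqVlt => /predU1P[<- _|r0 r1]; last by apply: fc; rewrite r0.
have f0 : f 0 = 0 by have := fM 0; rewrite lexx ler01 mulr0 normr_le0 => /(_ isT)/eqP.
have M0 : 0 <= M by have := fM 1; rewrite lexx ler01 mulr1 => /(_ isT); apply: le_trans.
have M1 : 0 < M + 1 by lra.
rewrite /from_subspace f0; apply/cvgrPdist_lt => e e0.
have H : \forall y \near (0 : R), `|y| < e / (M + 1) by apply: nbhs0_lt; rewrite divr_gt0.
have H' : \forall y \near (0 : R), `[0, 1]%classic y -> `|0 - f y| < e.
  apply: filterS H => y yE; rewrite /= in_itv /= => y01.
  rewrite sub0r normrN; apply: (le_lt_trans (fM y y01)).
  move: yE; have y0 : 0 <= y by lra.
  rewrite ger0_norm// ltr_pdivlMr// => yE; apply: le_lt_trans yE.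
  by rewrite mulrC ler_wpM2l//; lra.
exact: H'.
Qed.

End unfolding.

(** * The energy of the minimizer *)

Section minimal_energy.
Context {R : realType}.
Implicit Types (r z : R).
Let mu := @lebesgue_measure R.

(** By [calibration_eq] the density along h is the derivative of r^(2-p) W. The estimate 1 - cos h =
    O(r^2) makes this primitive and the density O(r), so both are continuous up to r = 0 and the
    fundamental theorem of calculus applies on [0, 1]. *)
Lemma minimizer_energy (p l : R) (q W W' h dh : R -> R) (C B : R) : 1 < p -> 0 < l <= pi / 2 ->
  (forall z, 0 <= z <= 1 -> 0 < q z) -> continuous q -> 0 <= C ->
  {within `[0, 1], continuous W} ->
  (forall z, 0 < z < 1 -> is_derive z 1 W (W' z)) ->
  (forall z, 0 <= z <= 1 -> `|W z| <= C * (z * (2 - z)) `^ (p / 2)) ->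
  (forall z, W' z = p * (z * (2 - z)) `^ (p / 2 - 1) * q z *
     (1 + q z ^+ 2) `^ (p / 2 - 1)) ->
  (forall z, 0 <= z <= 1 -> (2 - p) * W z =
     (z * (2 - z)) `^ (p / 2) * (1 + q z ^+ 2) `^ (p / 2 - 1) * (1 - (p - 1) * q z ^+ 2)) ->
  h 0 = 0 -> h 1 = l -> (forall r, 0 < r <= 1 -> 0 < h r <= l) ->
  (forall r, 0 < r < 1 -> h r < l) ->
  {within `[0, 1], continuous h} -> {within `[0, 1], continuous dh} ->
  (forall r, 0 < r <= 1 -> is_derive r 1 h (dh r) /\
     r * dh r = sin (h r) * q (1 - cos (h r))) ->
  (forall r, 0 <= r <= 1 -> 0 <= 1 - cos (h r) <= B * r ^+ 2) ->
  (\int[mu]_(r in `](0 : R)%R, 1%R[) (density p h dh r)%:E)%E = (W (1 - cos l))%:E.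
Proof.
move=> p1 /andP[l0 lpi] q0 cq C0 cW dW WC W'E WE h0 h1 hl hlt ch cdh hD hB.
have p0 : 0 < p by exact: lt_trans p1.
have p2 : 0 < p / 2 by rewrite divr_gt0.
have pi0 : 0 < pi :> R := pi_gt0 R.
have e21 : 2 - p - 1 = 1 - p by lra.
have cosh r : 0 <= r <= 1 -> 0 <= cos (h r).
  move=> /andP[]; rewrite le_eqVlt => /predU1P[<- _|r0 r1]; first by rewrite h0 cos0.
  by have : 0 < h r <= l by [apply: hl; rewrite r0|]; move=> hr; apply: cos_ge0_pihalf; lra.
have z01 r : 0 <= r <= 1 -> 0 <= 1 - cos (h r) <= 1.
  by move=> r01; have := cosh r r01; have := cos_le1 (h r); lra.
have zs r : (1 - cos (h r)) * (2 - (1 - cos (h r))) = sin (h r) ^+ 2.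
  by rewrite -sin_sqrE.
have [N N0 dhN] := within_itv_bounded ler01 cdh.
have B0 : 0 <= B by have := hB 1; rewrite lexx ler01 expr1n mulr1 => /(_ isT); lra.
(* N^2 bounds h'^2, and sin^2 h = z (2 - z) <= 2 z <= 2 B r^2. *)
pose K := N ^+ 2 + 2 * B; have K0 : 0 <= K by rewrite addr_ge0 ?sqr_ge0//; lra.
have sB r : 0 <= r <= 1 -> sin (h r) ^+ 2 <= 2 * B * r ^+ 2.
  move=> r01; rewrite -zs; have := z01 r r01; have := hB r r01 => z1 z2.
  have : 0 <= (1 - cos (h r)) * (1 - cos (h r)) by rewrite -expr2 sqr_ge0.
  lra.
have sK r : 0 <= r <= 1 -> sin (h r) ^+ 2 <= K * r ^+ 2.
  move=> r01; apply: (le_trans (sB r r01)); rewrite ler_wpM2r ?sqr_ge0// /K.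
  by rewrite lerDr sqr_ge0.
have dK r : 0 <= r <= 1 -> (r * dh r) ^+ 2 + sin (h r) ^+ 2 <= K * r ^+ 2.
  move=> r01; have := sB r r01.
  have : (r * dh r) ^+ 2 <= N ^+ 2 * r ^+ 2.
    by rewrite exprMn mulrC ler_wpM2r ?sqr_ge0// -(ger0_norm (sqr_ge0 (dh r))) normrX ler_pXn2r ?nnegrE// dhN.
  by rewrite /K; lra.
have KX r : 0 < r -> (K * r ^+ 2) `^ (p / 2) = K `^ (p / 2) * r `^ p.
  move=> r0; rewrite powRM ?sqr_ge0//; congr (_ * _).
  rewrite -(powR_mulrn 2 (ltW r0)) -powRrM; congr (_ `^ _); lra.
pose Phi r := r `^ (2 - p) * W (1 - cos (h r)).
have W0 : W 0 = 0.
  by have := WC 0; rewrite lexx ler01 mul0r powR0 ?gt_eqF// mulr0 normr_le0 => /(_ isT)/eqP.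
have cz : {within `[0, 1], continuous (fun r => 1 - cos (h r))}.
  apply/subspace_continuousP => x x01; move/subspace_continuousP/(_ x x01) : ch => chx.
  apply: (cvg_comp h (fun y : R => 1 - cos y) chx).
  by apply: (@cvgB _ R); [exact: cvg_cst|exact: continuous_cos].
have cpow (e : R) r : 0 < r -> x `^ e @[x --> within `[0, 1] (nbhs r)] --> r `^ e.
  by move=> r0; apply: cvg_within_filter; exact: is_derive_continuous (is_derive1_powR e r0).
have cPhi : {within `[0, 1], continuous Phi}.
  apply: (@within_continuous_linear_bound _ _ (C * K `^ (p / 2))).
    move=> r /andP[r0 r1]; apply: cvgM; first exact: cpow.
    have r01 : `[0, 1]%classic r by rewrite /= in_itv /= r1 ltW.
    move/subspace_continuousP/(_ r r01) : cz => cx.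
    have := z01 r; rewrite r1 (ltW r0) => /(_ isT) zr.
    move/subspace_continuousP/(_ (1 - cos (h r))) : cW; rewrite /= in_itv /= => /(_ zr) cWx.
    have c' : 1 - cos (h y) @[y --> within `[0, 1] (nbhs r)] --> within `[0, 1] (nbhs (1 - cos (h r))).
      move=> U HU.
      have H : \forall y \near within `[0, 1] (nbhs r), (fun z => `[0, 1] z -> U z) (1 - cos (h y)) := cx _ HU.
      have H2 : \forall y \near within `[0, 1] (nbhs r), `[0, 1]%classic y by exact: withinT.
      apply: filterS2 H H2 => y Hy; rewrite /= in_itv /= => y01; apply: Hy.
      by rewrite /= in_itv /=; exact: z01.
    exact: (cvg_comp (fun r => 1 - cos (h r)) W c' cWx).
  move=> r /andP[]; rewrite le_eqVlt => /predU1P[<- _|r0 r1].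
    by rewrite /Phi h0 cos0 subrr W0 !mulr0 normr0.
  have r01 : 0 <= r <= 1 by rewrite r1 ltW.
  rewrite /Phi normrM (ger0_norm (powR_ge0 _ _)).
  apply: (@le_trans _ _ (r `^ (2 - p) * (C * (K * r ^+ 2) `^ (p / 2)))).
    rewrite ler_wpM2l ?powR_ge0// (le_trans (WC _ (z01 r r01)))// ler_wpM2l//.
    apply: ge0_ler_powR; first exact: ltW.
    - by rewrite nnegrE zs sqr_ge0.
    - by rewrite nnegrE mulr_ge0 ?sqr_ge0.
    - by rewrite zs; exact: sK.
  rewrite KX// mulrCA -mulrA ler_wpM2l// mulrCA ler_wpM2l ?powR_ge0//.
  rewrite -powRD; last by apply/implyP => _; rewrite gt_eqF.
  by rewrite subrK powR_mulrn ?(ltW r0)// expr2 ler_piMl// ltW.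
have cD : {within `[0, 1], continuous (density p h dh)}.
  apply: (@within_continuous_linear_bound _ _ (K `^ (p / 2))).
    move=> r /andP[r0 r1]; rewrite /density.
    have r01 : `[0, 1]%classic r by rewrite /= in_itv /= r1 ltW.
    move/subspace_continuousP/(_ r r01) : ch => chx.
    move/subspace_continuousP/(_ r r01) : cdh => cdx.
    apply: cvgM; first exact: cpow.
    pose bs x := (x * dh x) ^+ 2 + sin (h x) ^+ 2.
    have cb : bs x @[x --> within `[0, 1] (nbhs r)] --> bs r.
      apply: (@cvgD _ R).
        apply: (cvg_comp (fun x => x * dh x) (fun y : R => y ^+ 2)); last exact: exprn_continuous.
        by apply: cvgM; [apply: cvg_within_filter; exact: cvg_id|exact: cdx].
      apply: (cvg_comp h (fun y : R => sin y ^+ 2) chx).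
      by apply: (@continuous_comp _ _ _ sin (fun y : R => y ^+ 2)); [exact: continuous_sin|exact: exprn_continuous].
    have hr : 0 < h r <= l by apply: hl; rewrite r0.
    have b0 : 0 < bs r.
      rewrite /bs ltr_wpDl ?sqr_ge0// exprn_gt0//; apply: sin_gt0_pi; lra.
    exact: (cvg_comp bs (fun y : R => y `^ (p / 2)) cb (is_derive_continuous (is_derive1_powR (p / 2) b0))).
  move=> r /andP[]; rewrite le_eqVlt => /predU1P[<- _|r0 r1].
    by rewrite /density h0 sin0 mul0r expr0n /= addr0 (powR0 (lt0r_neq0 p2)) !mulr0 normr0.
  have r01 : 0 <= r <= 1 by rewrite r1 ltW.
  rewrite ger0_norm ?density_ge0// /density.
  apply: (@le_trans _ _ (r `^ (1 - p) * (K * r ^+ 2) `^ (p / 2))).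
    rewrite ler_wpM2l ?powR_ge0//; apply: ge0_ler_powR; first exact: ltW.
    - by rewrite nnegrE addr_ge0 ?sqr_ge0.
    - by rewrite nnegrE mulr_ge0 ?sqr_ge0.
    - exact: dK.
  rewrite KX// mulrCA -powRD; last by apply/implyP => _; rewrite gt_eqF.
  by rewrite subrK powRr1// ltW.
have iD := continuous_integrable_itv cD.
have EI : \int[mu]_(r in `[0, 1]) density p h dh r = W (1 - cos l).
  have <- : Phi 1 - Phi 0 = W (1 - cos l).
    by rewrite /Phi h1 h0 cos0 subrr W0 mulr0 subr0 powR1 mul1r.
  apply: (@Rintegral_FTC2 R 0 1 Phi) => // r /andP[r0 r1].
  have r01 : 0 < r <= 1 by rewrite r0 ltW.
  have r01' : 0 <= r <= 1 by rewrite !ltW.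
  have [dhr rdh] := hD r r01; have hr := hl r r01; have hlr : h r < l by apply: hlt; rewrite r0.
  have cr0 : 0 < cos (h r) by apply: cos_gt0_pihalf; lra.
  have cr1 : cos (h r) < 1 by apply: cos_lt1; lra.
  have dz := is_derive_funB (is_derive_cst (1 : R) r 1) (is_derive_funcomp (is_derive_cos (h r)) dhr).
  have zr : 0 < 1 - cos (h r) < 1 by rewrite subr_gt0 cr1 gtrBl.
  have dWz := @is_derive_funcomp R W (fun r => 1 - cos (h r)) _ _ _ (dW _ zr) dz.
  have dPhi := is_derive_funM (is_derive1_powR (2 - p) r0) dWz.
  apply: is_derive_eqr dPhi _.
  have fE : folded h r = 1 - cos (h r) by rewrite /folded gtr0_norm.
  have cE := @calibrationE R p q W W' W'E WE h dh r r0.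
  have b0 : 0 < p - 1 by rewrite subr_gt0.
  have aE : p / 2 = (p - 1 + 1) / 2 by rewrite subrK.
  have := @calibration_eq R _ _ _ _ (sin (h r)) b0 aE (q0 _ (z01 r r01')) (sqr_ge0 _) erefl.
  rewrite -rdh; move: cE; rewrite /= fE gtr0_sg// mul1r => cE qE.
  rewrite /density -qE -cE /calibration fE gtr0_sg// mul1r sub0r mulNr opprK.
  by rewrite e21 !mulrA.
have iI : mu.-integrable `](0 : R), 1[ (EFin \o density p h dh).
  exact: integrable_within_itvoo.
rewrite -EI -(@Rintegral_itv_bndo_bndc _ _ 1); last first.
  apply: (integrableS _ _ _ iD) => // r /=; rewrite !in_itv /= => /andP[-> /ltW ->] //.
rewrite -(@Rintegral_itv_obnd_cbnd _ 0)// /Rintegral fineK//.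
exact: integrable_fin_num.
Qed.

End minimal_energy.

(** * Smoothness and the Euler-Lagrange equation *)

Section smoothness.
Context {R : realType}.
Implicit Types (r z : R).

Variables (b : R) (q h dh : R -> R).
Hypothesis b0 : 0 < b.
Hypothesis q0 : forall z, 0 <= z <= 1 -> 0 < q z.
Hypothesis dq : forall z, 0 < z <= 1 ->
  is_derive z 1 q (slope b (1 - z) (q z) / (z * (2 - z))).
Hypothesis hz : forall r, 0 < r <= 1 -> 0 < 1 - cos (h r) <= 1.
Hypothesis hD : forall r, 0 < r <= 1 -> is_derive r 1 h (dh r) /\
  r * dh r = sin (h r) * q (1 - cos (h r)).

Let S r := sin (h r).
Let C r := cos (h r).
Let Q r := q (1 - cos (h r)).
Let T r := slope_num b (C r) (Q r).

Let dhE r : 0 < r <= 1 -> is_derive r 1 h (r^-1 * (S r * Q r)).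
Proof.
move=> r01; have [dhr e] := hD r01; apply: is_derive_eqr dhr _.
by rewrite -e mulKf// gt_eqF//; case/andP: r01.
Qed.

Let dS r : 0 < r <= 1 -> is_derive r 1 S (r^-1 * (C r * (S r * Q r))).
Proof.
move=> r01; apply: is_derive_eqr (is_derive_funcomp (is_derive_sin (h r)) (dhE r01)) _.
by rewrite mulrCA.
Qed.

Let dC r : 0 < r <= 1 -> is_derive r 1 C (r^-1 * (- (S r * (S r * Q r)))).
Proof.
move=> r01; apply: is_derive_eqr (is_derive_funcomp (is_derive_cos (h r)) (dhE r01)) _.
by rewrite mulrN mulNr mulrCA.
Qed.

(** The singular denominator z (2 - z) of q' is sin^2 h and cancels against the factor sin^2 h in
    the derivative of 1 - cos h. What remains is rational in C and Q, with a positive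
    denominator. *)
Let dQ r : 0 < r <= 1 -> is_derive r 1 Q (r^-1 * T r).
Proof.
move=> r01; have z0 := hz r01.
have dz := is_derive_funB (is_derive_cst (1 : R) r 1) (dC r01).
apply: is_derive_eqr (@is_derive_funcomp R q (fun r => 1 - cos (h r)) _ _ _ (dq z0) dz) _.
have zs : (1 - cos (h r)) * (2 - (1 - cos (h r))) = S r ^+ 2.
  by rewrite /S; have := cos2Dsin2 (h r); lra.
have s0 : S r ^+ 2 != 0.
  by rewrite -zs mulf_neq0 ?gt_eqF//; lra.
have Q0 : Q r != 0 by rewrite gt_eqF// q0//; lra.
rewrite zs (_ : 1 - (1 - cos (h r)) = C r); last by rewrite opprB addrC subrK.
rewrite -/(Q r) /T -(slopeM (C r) b0 Q0) sub0r !mulrN opprK.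
have si := mulVf s0; move: (S r ^- 2) si => i si.
transitivity (slope b (C r) (Q r) * (i * S r ^+ 2) * (r^-1 * Q r)).
  by move: (slope b _ _) (r^-1) => u v; lra.
by rewrite si mulr1 mulrCA.
Qed.

(** Up to the factor 1/r, the derivatives of S, C and Q are smooth expressions in S, C and Q
    themselves, so each gain of one derivative yields the next. *)
Lemma Ck_profile k : [/\ Ck_on `]0, 1] k S, Ck_on `]0, 1] k C & Ck_on `]0, 1] k Q].
Proof.
have dw (f f' : R -> R) : (forall r, 0 < r <= 1 -> is_derive r 1 f (f' r)) ->
    forall x, `]0, 1]%classic x -> is_derive_within `]0, 1] f x (f' x).
  by move=> df x; rewrite /= in_itv /= => /df; exact: is_derive_is_derive_within.
have dS' := dw _ _ dS; have dC' := dw _ _ dC; have dQ' := dw _ _ dQ.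
elim: k => [|k [IS IC IQ]].
  by split; apply: derive_within_continuous => x x01; eexists; [exact: dS'|exact: dC'|exact: dQ'].
have IV : Ck_on `]0, 1] k (fun r : R => r^-1).
  apply: CkV; last exact: Ck_id.
  by move=> y; rewrite /= in_itv /= => /andP[y0 _]; rewrite gt_eqF.
have IT : Ck_on `]0, 1] k T.
  have IQ2 := CkX 2 IQ.
  have IbQ := CkM (Ck_cst _ k b) IQ2.
  apply: CkM.
    apply: CkM; first exact: CkD (Ck_cst _ _ _) IQ2.
    apply: CkD; last exact: CkM (Ck_cst _ _ _) IQ.
    exact: CkM IC (CkB (Ck_cst _ _ _) IbQ).
  apply: CkV; last exact: CkD (Ck_cst _ _ _) IbQ.
  by move=> y _; rewrite gt_eqF// ltr_pwDl// mulr_ge0 ?sqr_ge0 ?(ltW b0).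
split; eexists; split; [exact: dS'| |exact: dC'| |exact: dQ'|]; apply: CkM => //.
- exact: CkM IC (CkM IS IQ).
- exact: CkN (CkM IS (CkM IS IQ)).
Qed.

Lemma Cinfty_profile : Cinfty_on `]0, 1] h.
Proof.
have dw x : `]0, 1]%classic x -> is_derive_within `]0, 1] h x (x^-1 * (S x * Q x)).
  by rewrite /= in_itv /= => /dhE; exact: is_derive_is_derive_within.
case=> [|k]; first by apply: derive_within_continuous => x x01; eexists; exact: dw.
have [IS _ IQ] := Ck_profile k.
eexists; split; first exact: dw.
apply: CkM; last exact: CkM.
apply: CkV; last exact: Ck_id.
by move=> y; rewrite /= in_itv /= => /andP[y0 _]; rewrite gt_eqF.
Qed.

Lemma profile_ode r : 0 < r < 1 ->
  let h' := derive1 h r in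
  let h'' := derive1n 2 h r in
  b * h' ^+ 2 * h''
  + (b - 2) * (h' ^+ 2 * (sin (h r) * cos (h r) / r ^+ 2)
               - h' * (sin (h r) ^+ 2 / r ^+ 3))
  + h' ^+ 3 / r
  + h'' * sin (h r) ^+ 2 / r ^+ 2
  - sin (h r) ^+ 3 * cos (h r) / r ^+ 4 = 0.
Proof.
move=> /andP[r0 r1] h' h''; have r01 : 0 < r <= 1 by rewrite r0 ltW.
have d1 x : 0 < x <= 1 -> derive1 h x = x^-1 * (S x * Q x).
  by move=> /dhE[_ e]; rewrite derive1E.
have rn : r != 0 by rewrite gt_eqF.
have d2 : is_derive r 1 (derive1 h) (r^-1 ^+ 2 * (S r * (C r * Q r ^+ 2 + T r - Q r))).
  have near1 : \near r, r^-1 * (S r * Q r) = derive1 h r.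
    near=> x; rewrite d1//; apply/andP; split; first by near: x; exact: lt_nbhsr.
    by apply: ltW; near: x; exact: lt_nbhsl.
  apply: near_eq_is_derive near1 _.
  apply: is_derive_eqr (is_derive_funM (is_derive_funV rn (is_derive_id r 1))
    (is_derive_funM (dS r01) (dQ r01))) _.
  by move: (r^-1) (S r) (C r) (Q r) (T r) => i s c u t; lra.
have h1E : h' = r^-1 * (S r * Q r) by rewrite /h' d1.
have h2E : h'' = r^-1 ^+ 2 * (S r * (C r * Q r ^+ 2 + T r - Q r)).
  by rewrite /h'' /derive1n /= derive1E; case: d2.
have D0 : 1 + b * Q r ^+ 2 != 0.
  by rewrite gt_eqF// ltr_pwDl// mulr_ge0 ?sqr_ge0 ?(ltW b0).
have TE : T r * (1 + b * Q r ^+ 2) =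
    (1 + Q r ^+ 2) * (C r * (1 - b * Q r ^+ 2) + (b - 1) * Q r).
  by rewrite /T /slope_num divfK.
rewrite h1E h2E -/(S r) -/(C r) -!exprVn.
move: (r^-1) (S r) TE => i s; move: (C r) (Q r) (T r) => c u t TE.
(* Every term carries sin^3 h / r^4; the remaining bracket vanishes by the relation defining
   [slope_num]. *)
transitivity (s ^+ 3 * i ^+ 4 * (t * (1 + b * u ^+ 2) + (1 + b * u ^+ 2) * (c * u ^+ 2 - u) +
  (b - 2) * (u ^+ 2 * c - u) + u ^+ 3 - c)); first by lra.
by rewrite TE; lra.
Unshelve. all: by end_near. Qed.

End smoothness.

(** * Existence, uniqueness and regularity of the minimizer *)

Theorem theorem1 (R : realType) (p l : R) (hp : 1 < p) (hl : 0 < l <= pi / 2) :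
  exists h : R -> R,
    argmin (constrained_energy p l) (admissible p) h /\
    (forall k : R -> R,
       argmin (constrained_energy p l) (admissible p) k <->
       (eq_on01 k h \/ (l = pi / 2 /\ eq_on01 k (fun r => pi - h r)))) /\
    (l = pi / 2 -> forall r, 0 <= r <= 1 -> 0 <= h r <= pi / 2) /\
    Cinfty_on `]0, 1] h /\
    Ck_on `[0, 1] 1 h /\
    (forall r, 0 < r <= 1 -> 0 < h r) /\
    (forall r s, 0 < r -> r < s -> s <= 1 -> h r < h s) /\
    h 0 = 0 /\
    h 1 = l /\
    (forall r, 0 < r < 1 ->
       let h' := derive1 h r in
       let h'' := derive1n 2 h r in
       (p - 1) * h' ^+ 2 * h''
       + (p - 3) * (h' ^+ 2 * (sin (h r) * cos (h r) / r ^+ 2)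
                    - h' * (sin (h r) ^+ 2 / r ^+ 3))
       + h' ^+ 3 / r
       + h'' * sin (h r) ^+ 2 / r ^+ 2
       - sin (h r) ^+ 3 * cos (h r) / r ^+ 4 = 0).
Proof.
have b0 : 0 < p - 1 by rewrite subr_gt0.
have aE : p / 2 = (p - 1 + 1) / 2 by rewrite subrK.
have p0 : 0 < p by exact: lt_trans hp.
have pi0 : 0 < pi :> R := pi_gt0 R.
have /andP[l0 lpi] := hl.
have [q [F [F1 [h [dh [B [[q0 cq dq qb1] [cF cF1 dF FF1 Fmono]
  [h0 h1 hpos hF hmono] [ch hD dhw cdh hB]]]]]]]] := minimizer_exists b0 hl.
have [W [W' [C [C0 cW dW WC [W'E WE]]]]] := calibration_exists b0 aE q0 cq dq qb1.
have {}W'E z : W' z = p * (z * (2 - z)) `^ (p / 2 - 1) * q z * (1 + q z ^+ 2) `^ (p / 2 - 1).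
  by rewrite W'E subrK.
have {}WE z : 0 <= z <= 1 -> (2 - p) * W z =
    (z * (2 - z)) `^ (p / 2) * (1 + q z ^+ 2) `^ (p / 2 - 1) * (1 - (p - 1) * q z ^+ 2).
  by move=> /WE <-; congr (_ * _); lra.
have hlt r : 0 < r < 1 -> 0 < h r < l.
  move=> /andP[r0 r1]; rewrite -{1}h1 hmono ?(ltW r0)// andbT.
  by have /andP[] : 0 < h r <= l by apply: hpos; rewrite r0 ltW.
have cosl : `|cos l| = cos l by rewrite ger0_norm// cos_ge0_pihalf//; lra.
have EI := minimizer_energy hp hl q0 cq C0 cW (fun z z01 => let: And3 d _ _ := dW z z01 in d)
  WC W'E WE h0 h1 hpos (fun r r01 => proj2 (andP (hlt r r01))) ch cdh hD hB.
pose m := W (1 - cos l).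
(* The density sees only the squares of sin k and of the derivative, which handles h and its
   reflection at once. *)
have regular (k d : R -> R) : (forall r : R, 0 <= r <= 1 -> sin (k r) ^+ 2 = sin (h r) ^+ 2 /\ d r ^+ 2 = dh r ^+ 2) ->
    {within `[0, 1], continuous k} ->
    (forall r : R, 0 < r < 1 -> is_derive r 1 k (d r)) -> {within `[0, 1], continuous d} ->
    admissible p k /\ energy p k = m%:E.
  move=> kh ck dk cd; split; first exact: regular_admissible p0 ck dk cd.
  rewrite (energy_regular hp ck dk cd) -EI; apply: eq_integral => r.
  rewrite inE /= in_itv /= => /andP[r0 r1]; congr (_%:E).
  by have [] := kh r; rewrite ?ltW// /density !exprMn => -> ->.
have competitor k : eq_on01 k h \/ (l = pi / 2 /\ eq_on01 k (fun r => pi - h r)) ->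
    [/\ admissible p k, energy p k = m%:E & k 1 = l].
  have in1 : (1 : R) \in `[0, 1]%R by rewrite in_itv /= lexx ler01.
  have dhh (r : R) : 0 < r < 1 -> is_derive r 1 h (dh r).
    by move=> /andP[r0 r1]; apply: (hD r _).1; rewrite r0 ltW.
  have near_eq (k1 k2 : R -> R) (r : R) : eq_on01 k1 k2 -> 0 < r < 1 -> \near r, k2 r = k1 r.
    move=> kE /andP[r0 r1]; near=> x; rewrite kE// in_itv /=.
    by apply/andP; split; apply: ltW; near: x; [exact: lt_nbhsr|exact: lt_nbhsl].
  case=> [kE|[lE kE]].
    have [] := regular k dh; last by move=> ? ?; split => //; rewrite kE.
    - by move=> r r01; rewrite kE.
    - by apply: within_continuous_eq ch => r; rewrite /= => /kE.
    - by move=> r r01; exact: near_eq_is_derive (near_eq _ _ _ kE r01) (dhh r r01).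
    - exact: cdh.
  have [] := regular k (fun r => - dh r); last first.
    by move=> ? ?; split => //; rewrite kE// h1 lE; lra.
  - by move=> x; apply: (@cvgN _ R); exact: cdh.
  - move=> r r01; apply: near_eq_is_derive (near_eq _ _ _ kE r01) _.
    by apply: is_derive_eqr (is_derive_funB (is_derive_cst pi r 1) (dhh r r01)) _; rewrite sub0r.
  - apply: (@within_continuous_eq R _ (fun r => pi - h r)) => [r /= /kE //|x].
    by apply: (@cvgB _ R); [exact: cvg_cst|exact: ch].
  - by move=> r r01; rewrite kE// sqrrN addrC sinDpi sinN opprK.
have lower k : admissible p k -> (m%:E <= constrained_energy p l k)%E.
  move=> kadm; rewrite /constrained_energy; case: eqP => [k1|_]; last exact: leey.
  have [->|Ek] := eqVneq (energy p k) +oo%E; first exact: leey.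
  have Efin : (energy p k < +oo)%E by rewrite ltey.
  have E0 : (0 <= energy p k)%E by apply: integral_ge0 => r _; rewrite lee_fin powR_ge0.
  rewrite -[leRHS]fineK ?ge0_fin_numE// lee_fin /m -cosl.
  exact: (energy_lower_bound hp q0 C0 cW dW WC W'E WE kadm k1 Efin).
have cE k : k 1 = l -> constrained_energy p l k = energy p k.
  by move=> k1; rewrite /constrained_energy k1 eqxx.
have attained k : eq_on01 k h \/ (l = pi / 2 /\ eq_on01 k (fun r => pi - h r)) ->
    argmin (constrained_energy p l) (admissible p) k.
  move=> /competitor[kadm kE k1]; split; first exact: kadm.
  move=> k' k'adm.
  by rewrite (cE k k1) kE; exact: lower.
have hh : eq_on01 h h by [].
have hz r : 0 < r <= 1 -> 0 < 1 - cos (h r) <= 1.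
  move=> /hpos hr; have c0 : 0 <= cos (h r) by apply: cos_ge0_pihalf; lra.
  by rewrite subr_gt0 cos_lt1 ?gerBl//; lra.
exists h; split; first by apply: attained; left.
split.
  move=> k; split; last exact: attained.
  move=> [kadm kmin]; have [hadm hE _] := competitor h (or_introl hh).
  (* Comparison with h, whose energy is finite, excludes a minimizer with end value other than l. *)
  have := kmin h hadm; rewrite (cE h h1) hE {1}/constrained_energy.
  case: eqP => [k1 kle|_]; last by rewrite leye_eq.
  have Efin : (energy p k < +oo)%E by exact: le_lt_trans kle (ltry _).
  have kE : energy p k = m%:E.
    by apply/eqP; rewrite eq_le kle/=; have := lower k kadm; rewrite cE.
  have fE : fine (energy p k) = W (1 - `|cos l|) by rewrite kE cosl.
  have ck : {within `[0, 1], continuous k} by case: kadm => -[].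
  apply: (unfold_unique hl ch ck h1 k1 hlt) => r r01.
  have := minimal_folded_relation hp q0 C0 cW dW WC W'E WE kadm k1 Efin fE cF cF1 dF FF1 r01.
  have /andP[r0 r1] := r01.
  rewrite cosl -hF ?(ltW r0) ?(ltW r1)// /folded => FE.
  have z1 := folded01 k r; rewrite /folded in z1.
  have z2 := hz r; rewrite r0 (ltW r1) in z2; have {}z2 := z2 isT.
  (* Strict monotonicity of F identifies the arguments, which gives |cos k| = cos h. *)
  have [lt|gt|] := ltgtP (1 - `|cos (k r)|) (1 - cos (h r));
    last by move=> /(congr1 (fun x => 1 - x)) /=; rewrite !subKr.
    by have := Fmono _ _ _ lt; rewrite FE ltxx; case/andP: z1 => -> _ /(_ isT).
  have := Fmono _ _ _ gt; rewrite FE ltxx; case/andP: z2 => z20 _.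
  by rewrite (ltW z20) => /(_ isT).
split.
  move=> lE r /andP[]; rewrite le_eqVlt => /predU1P[<- _|r0 r1].
    by rewrite h0 lexx divr_ge0// ltW.
  by have : 0 < h r <= l by [apply: hpos; rewrite r0|]; rewrite lE; lra.
split; first exact: Cinfty_profile b0 q0 dq hz hD.
split.
  by exists dh; split => // x; rewrite /= in_itv /= => /dhw.
split; first by move=> r /hpos/andP[].
split; first by move=> r s r0 rs s1; apply: hmono => //; exact: ltW.
split => //; split => // r r01.
have := profile_ode b0 q0 dq hz hD r01.
by rewrite (_ : p - 1 - 2 = p - 3); last lra.
Unshelve. all: by end_near. Qed.
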